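(* Let $q>1$ and let $m_1<m_2<\cdots$ be positive integers with $\frac{m_{k+1}}{m_k}\ge q$ for all $k\in\mathbb{N}$. Let $(a_{k,n})_{1\le k\le n}$ be a triangular array of real numbers, and put $$S_n^{\mathrm W}(x)=\sum_{k=1}^n a_{k,n}W_{m_k}(x),\quad 0\le x\le 1,\qquad A_n=\Big(\sum_{k=1}^n a_{k,n}^2\Big)^{1/2},\qquad d_n=\max_{1\le k\le n}|a_{k,n}|,$$ where $W_m$ denotes the $m$th Walsh function. Suppose $A_n\to\infty$ as $n\to\infty$, and moreover that, as $n\to\infty$, - if $q\ge 2$: $\sum_{k=1}^n a_{k,n}^4\to\kappa_4<\infty$ and $n\,d_n^5\to 0$; - if $1<q<2$: there exists $\varepsilon>0$ such that $n^{1+\varepsilon}d_n^3\to 0$. Then for $y=o(A_n)$, $$\Big|\Big\{x\in[0,1]:\ \frac{S_n^{\mathrm W}(x)}{A_n}\ge y\Big\}\Big|=(1+o(1))\,\frac{1}{\sqrt{2\pi}}\int_{y}^\infty e^{-u^2/2}\,du=\frac{e^{-y^2/2}}{y\sqrt{2\pi}}\,(1+o(1)).$$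
   Context: Walsh functions: let $r_0(x)=1$ for $0\le x<\frac12$, $r_0(x)=-1$ for $\frac12\le x<1$, extended to $\mathbb{R}$ with period $1$, and let $r_n(x)=r_0(2^nx)$, $n\ge 0$, be the Rademacher functions. If $n=\sum_{i\ge 0}k_i2^i$ with $k_i\in\{0,1\}$ is the dyadic expansion of $n$ and $l_1,\dots,l_m$ are the indices $i$ with $k_i=1$, then $W_n(x)=\prod_{i=1}^m r_{l_i}(x)$. The notation $|\cdot|$ of a set denotes Lebesgue measure.
   Formalization: The second equality, with e^{-y^2/2}/(y sqrt(2 pi)), is stated only for sequences y = y_n = o(A_n) that tend to +infinity, since it fails for bounded y (e.g. y = 1); the first equality is stated for every real sequence y_n = o(A_n). *)

(* Defs.v *)
From HB Require Import structures.
From mathcomp Require Import all_boot all_order all_algebra.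
From mathcomp Require Import all_classical all_reals all_analysis.

Set Implicit Arguments.
Unset Strict Implicit.
Unset Printing Implicit Defensive.

Import Order.TTheory GRing.Theory Num.Theory.
Import numFieldNormedType.Exports.

Local Open Scope classical_set_scope.
Local Open Scope ring_scope.

Section Walsh.
Context {R : realType}.

Definition rademacher0 (x : R) : R :=
  if x - (Num.floor x)%:~R < 2^-1 then 1 else -1.

Definition rademacher (i : nat) (x : R) : R := rademacher0 (2 ^+ i * x).

Definition dyadic_digit (n i : nat) : bool := odd (n %/ 2 ^ i).

(* Since n < 2 ^ n, all nonzero dyadic digits of n have index below n. *)
Lemma dyadic_expansion (n : nat) :
  n = (\sum_(0 <= i < n) dyadic_digit n i * 2 ^ i)%N.
Proof.
have digits N : (n %% 2 ^ N = \sum_(0 <= i < N) dyadic_digit n i * 2 ^ i)%N.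
  elim: N => [|N IH]; first by rewrite big_nil expn0 modn1.
  rewrite big_nat_recr //= -IH /dyadic_digit -modn2.
  rewrite {1}(divn_eq (n %% 2 ^ N.+1) (2 ^ N)) expnS modn_divl addnC.
  by rewrite (modn_dvdm _ (dvdn_mull _ (dvdnn _))).
by rewrite -digits modn_small // ltn_expl.
Qed.

Definition walsh (n : nat) (x : R) : R :=
  \prod_(0 <= i < n | dyadic_digit n i) rademacher i x.

(* Triangular arrays (a_{k,n}), 1 <= k <= n, are total functions [a k n] of
   which only the entries with 1 <= k <= n are ever used. *)
Definition walsh_sum (m : nat -> nat) (a : nat -> nat -> R) (n : nat) (x : R)
    : R :=
  \sum_(1 <= k < n.+1) a k n * walsh (m k) x.

Definition row_norm (a : nat -> nat -> R) (n : nat) : R :=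
  Num.sqrt (\sum_(1 <= k < n.+1) a k n ^+ 2).

Definition row_max (a : nat -> nat -> R) (n : nat) : R :=
  \big[Num.max/0]_(1 <= k < n.+1) `|a k n|.

Definition gauss_tail (y : R) : R :=
  (Num.sqrt (2 * pi))^-1 *
  \int[lebesgue_measure]_(u in `[y, +oo[) expR (- (u ^+ 2 / 2)).

End Walsh.

(* Main.v *)
From Stdlib Require PeanoNat.
Require Import Defs.
From HB Require Import structures.
From mathcomp Require Import all_boot all_order all_algebra.
From mathcomp Require Import all_classical all_reals all_analysis.
From mathcomp Require Import measurable_realfun complex ring lra zify.

(** Why the tail of a lacunary Walsh sum is Gaussian on the whole range
    [y = o(A_n)].

    The proof compares Laplace transforms.  Multiplication of Walsh functions
    is exclusive or of their indices, and a Walsh function takes the values 1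
    and -1, so [exp (z S_n)] is [\prod_k cosh (z a_k)] times the Riesz product
    [\prod_k (1 + tanh (z a_k) W_(m_k))].  The first factor is the Gaussian
    transform [exp (z ^ 2 A_n ^ 2 / 2)] up to a relative error of order
    [|z| ^ 4 \sum_k a_k ^ 4].  The mean of the Riesz product is a sum over the
    sets of indices [k] for which the exclusive or of the [m_k] vanishes
    ([riesz_product_mean]), and is thus within [relation_weight - 1] of 1.  If
    [q >= 2] only the empty set occurs ([relation_weight_doubling]).  If
    [q < 2], every relation has members in groups of comparable size: the
    largest member must be accompanied by others, since [a xor b >= |a - b|]
    forbids a sum with one dominant term.  This leaves at most one free choice
    for three members, and the total weight of the nonempty relations is of
    order [|z| ^ 3 n d_n ^ 3] ([relation_weight_lacunary]).  Both errors are
    uniformly small for [z] in a small complex disc ([walsh_mgf_uniform]).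

    For [S_n / A_n] this says that the transform at [theta + i eta] has a small
    relative error [tau] with respect to [exp ((theta + i eta) ^ 2 / 2)], for
    [theta] and [eta] up to a small multiple of [A_n].  At level [y] the tilt
    [theta = max y 1] is used, and [eta] ranges over a band of width [b], a
    large multiple of [theta].  A Fejer kernel whose cosine transform lives on
    that band compares the tilted laws locally ([tilted_mean_compare]);
    integration against [exp (- theta v)] turns this into a comparison of
    tails smoothed on the scale [1 / b] ([smoothed_tailE]).  The tails are
    monotone and the Gaussian tail varies slowly on that scale, so the
    smoothing can be removed, with an error of order [tau] times the Chernoff
    bound [theta^-1 exp (theta ^ 2 / 2 - theta y)] ([tail_compare]).  For [y]
    bounded below, Mills' inequality shows that this bound is of the order of
    the Gaussian tail itself ([chernoff_le_gtail]), so the relative error tends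
    to 0 with [tau]; for very negative [y] both tails are close to 1.  The
    second form of the conclusion is the asymptotics of Mills' ratio
    ([gtail_asymp]). *)

Set Implicit Arguments.
Unset Strict Implicit.
Unset Printing Implicit Defensive.
Import Order.TTheory GRing.Theory Num.Theory.
Import numFieldNormedType.Exports.
Local Open Scope classical_set_scope.
Local Open Scope ring_scope.

Local Notation normc := Normc.normc.

(** * Dyadic digits and exclusive or *)

Lemma dyadic_digit_testbit (n i : nat) : dyadic_digit n i = Nat.testbit n i.
Proof.
have oddE k : odd k = Nat.odd k.
  by elim/ltn_ind: k => -[|[|k]] IH //=; rewrite negbK IH.
have halfE k : k./2 = Nat.div2 k.
  by elim/ltn_ind: k => -[|[|k]] IH //=; rewrite -IH.
elim: i n => [|i IH] n; first by rewrite /dyadic_digit expn0 divn1 /= oddE.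
by rewrite /= -IH /dyadic_digit -halfE expnS divnMA divn2.
Qed.

Lemma dyadic_digit_lxor (a b i : nat) :
  dyadic_digit (Nat.lxor a b) i = dyadic_digit a i (+) dyadic_digit b i.
Proof. by rewrite !dyadic_digit_testbit PeanoNat.Nat.lxor_spec; do 2 case: Nat.testbit. Qed.

Lemma dyadic_digit_big (n i N : nat) : (n <= N)%N -> (N <= i)%N -> dyadic_digit n i = false.
Proof.
move=> nN Ni; rewrite /dyadic_digit divn_small //.
exact: leq_ltn_trans (leq_trans nN Ni) (ltn_expl i _).
Qed.

Lemma dyadic_expansion_le (n N : nat) : (n <= N)%N ->
  n = (\sum_(0 <= i < N) dyadic_digit n i * 2 ^ i)%N.
Proof.
move=> nN; rewrite [LHS]dyadic_expansion.
have tail0 : (\sum_(n <= i < N) dyadic_digit n i * 2 ^ i = 0)%N.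
  rewrite big_nat_cond big1 // => i; rewrite andbT => /andP[ni _].
  by rewrite (dyadic_digit_big (leqnn n)).
by rewrite [RHS](@big_cat_nat _ _ _ n) //= tail0 addn0.
Qed.

(** Digitwise, exclusive or is addition without carries. *)
Lemma lxor_le (a b : nat) : (Nat.lxor a b <= a + b)%N.
Proof.
pose N := (Nat.lxor a b + (a + b))%N.
have [aN bN] : (a <= N)%N /\ (b <= N)%N by rewrite /N; lia.
rewrite [leqLHS](@dyadic_expansion_le _ N) ?leq_addr //.
rewrite [X in (_ <= X + _)%N](dyadic_expansion_le aN).
rewrite [X in (_ <= _ + X)%N](dyadic_expansion_le bN).
rewrite -big_split /=; apply: leq_sum => i _.
by rewrite dyadic_digit_lxor; do 2 case: dyadic_digit; rewrite ?mul0n ?mul1n //= ?leq_addr.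
Qed.

Lemma lxor_ge (a b : nat) : (a <= b + Nat.lxor a b)%N.
Proof.
have := lxor_le b (Nat.lxor a b).
by rewrite (PeanoNat.Nat.lxor_comm a b) -PeanoNat.Nat.lxor_assoc PeanoNat.Nat.lxor_nilpotent PeanoNat.Nat.lxor_0_l.
Qed.

Lemma lxorK (a b : nat) : Nat.lxor a (Nat.lxor a b) = b.
Proof. by rewrite -PeanoNat.Nat.lxor_assoc PeanoNat.Nat.lxor_nilpotent PeanoNat.Nat.lxor_0_l. Qed.

(** * Relations among lacunary integers *)

(** The sum of [t ^ #|T|] over the sets [T] of indices in [1, M] with
    [\xor_(k in T) m k = v], by recursion on the largest candidate index. *)
Fixpoint relation_weight (R : realType) (t : R) (m : nat -> nat) (M v : nat) : R :=
  if M is M'.+1 then relation_weight t m M' v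
                     + t * relation_weight t m M' (Nat.lxor v (m M))
  else (v == 0%N)%:R.

Section Relations.
Context {R : realType}.
Variables (t : R) (m : nat -> nat).
Local Notation weight := (relation_weight t m).

Lemma relation_weight_max M v :
  weight M v = (v == 0%N)%:R + t * \sum_(0 <= a < M) weight a (Nat.lxor v (m a.+1)).
Proof.
elim: M => [|M IH]; first by rewrite big_nil mulr0 addr0.
by rewrite big_nat_recr //= mulrDr addrA -IH.
Qed.

Lemma relation_weight_eq0 M v : (\sum_(1 <= k < M.+1) m k < v)%N -> weight M v = 0.
Proof.
elim: M v => [|M IH] v; first by rewrite big_nil /=; case: v.
rewrite big_nat_recr //= => sv; rewrite !IH ?mulr0 ?addr0 //; last by lia.
by have := lxor_ge v (m M.+1); rewrite PeanoNat.Nat.lxor_comm; lia.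
Qed.

Lemma relation_weight_ge0 M v : 0 <= t -> 0 <= weight M v.
Proof.
by move=> t_ge0; elim: M v => [|M IH] v /=; rewrite ?ler0n // addr_ge0 // mulr_ge0.
Qed.

End Relations.

(** When [m] at least doubles, the largest member of a nonempty set exceeds the
    sum of the others, so no nonempty set has vanishing exclusive or. *)
Lemma relation_weight_doubling (R : realType) (t : R) (m : nat -> nat) M :
  (forall k, (1 <= k)%N -> (0 < m k)%N) ->
  (forall k, (1 <= k)%N -> (2 * m k <= m k.+1)%N) ->
  relation_weight t m M 0 = 1.
Proof.
move=> m_gt0 m2.
have sumlt k : (\sum_(1 <= j < k.+1) m j < m k.+1)%N.
  elim: k => [|k IH]; first by rewrite big_nil m_gt0.
  by rewrite big_nat_recr //=; have := m2 k.+1 isT; lia.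
elim: M => [//|M IH] /=.
by rewrite IH PeanoNat.Nat.lxor_0_l relation_weight_eq0 ?mulr0 ?addr0.
Qed.

Section Lacunary.
Context {R : realType}.
Variables (q : R) (m : nat -> nat).
Hypothesis q_gt1 : 1 < q.
Hypothesis m_gt0 : forall k, (1 <= k)%N -> (0 < m k)%N.
Hypothesis m_lac : forall k, (1 <= k)%N -> q * (m k)%:R <= (m k.+1)%:R.

Let gap : R := (q - 1) / q.

Let q_gt0 : 0 < q. Proof. exact: lt_trans q_gt1. Qed.
Let gap_gt0 : 0 < gap. Proof. by rewrite divr_gt0 // subr_gt0. Qed.
Let gap_lt1 : gap < 1. Proof. by rewrite ltr_pdivrMr // mul1r gtrBl. Qed.
Let gapq : gap * q = q - 1. Proof. by rewrite divfK // gt_eqF. Qed.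

Lemma lacunary_expn k i : (1 <= k)%N -> q ^+ i * (m k)%:R <= (m (k + i))%:R.
Proof.
move=> k1; elim: i => [|i IH]; first by rewrite mul1r addn0.
rewrite exprS -mulrA addnS; apply: le_trans (m_lac _); last by lia.
by rewrite ler_pM2l.
Qed.

Lemma lacunary_homo j k : (1 <= j)%N -> (j < k)%N -> q * (m j)%:R <= (m k)%:R.
Proof.
move=> j1 jk; have -> : k = (j + (k - j.+1).+1)%N by lia.
apply: le_trans (lacunary_expn _ j1); rewrite ler_wpM2r //.
by rewrite exprS ler_peMr ?(ltW q_gt0) // exprn_ege1 // ltW.
Qed.

Lemma lacunary_sum M : (0 < M)%N ->
  gap * (\sum_(1 <= k < M.+1) m k)%:R <= (m M)%:R.
Proof.
elim: M => // -[_ _|M /(_ isT) IH _].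
  by rewrite big_nat1 ler_piMl // ltW.
rewrite big_nat_recr //= natrD mulrDr.
have l := @m_lac M.+1 isT; have x0 : 0 < (m M.+1)%:R :> R by rewrite ltr0n m_gt0.
have g2 : (1 - gap) * q = 1 by rewrite mulrBl gapq; ring.
have : (m M.+1)%:R <= (1 - gap) * (m M.+2)%:R.
  have -> : (m M.+1)%:R = (1 - gap) * (q * (m M.+1)%:R) by rewrite mulrA g2 mul1r.
  by rewrite ler_pM2l // subr_gt0.
by move=> h; move: IH; lra.
Qed.

Variable L : nat.
Hypothesis L_large : 4 < gap ^+ 2 * q ^+ L.

(** At most [L] of the [m k] lie in a window whose ends have ratio
    [4 / gap ^ 2]. *)
Lemma lacunary_window_sum (F : nat -> R) (G lo : R) (M : nat) :
  0 < lo -> (forall a, 0 <= F a) -> (forall a, (a < M)%N -> F a <= G) ->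
  (forall a, (a < M)%N -> F a != 0 ->
     lo <= (m a.+1)%:R /\ gap ^+ 2 * (m a.+1)%:R <= 4 * lo) ->
  0 <= G ->
  \sum_(0 <= a < M) F a <= L%:R * G.
Proof.
move=> lo0 F0 FG Fw G0.
have [[a0 a0M]|none] := pselect (exists a, (a < M)%N && (F a != 0)); last first.
  rewrite big_nat_cond big1 ?mulr_ge0 // => a; rewrite andbT => /andP[_ aM].
  by apply: contra_notP none => /eqP Fa; exists a; rewrite aM.
have exP : exists a, (a < M)%N && (F a != 0) by exists a0.
case: (ex_minnP exP) => {}a0 {exP} /andP[{}a0M Fa0] mina0.
have [lo1 _] := Fw _ a0M Fa0.
pose G' a := if (a0 <= a < a0 + L)%N then G else 0.
have leG a : (a < M)%N -> F a <= G' a.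
  move=> aM; rewrite /G'; case: ifPn => [_|]; first exact: FG.
  have [->//|Fa] := eqVneq (F a) 0.
  have [_ hi] := Fw _ aM Fa; have a0a := mina0 a; rewrite aM Fa in a0a.
  have {}a0a := a0a isT; rewrite a0a /= -leqNgt => aL.
  suff : 4 * lo < gap ^+ 2 * (m a.+1)%:R by rewrite ltNge hi.
  apply: lt_le_trans (_ : (gap ^+ 2 * q ^+ L) * lo <= _); first by rewrite ltr_pM2r.
  rewrite -mulrA ler_wpM2l ?exprn_ge0 ?(ltW gap_gt0) //.
  apply: (@le_trans _ _ (q ^+ (a - a0) * (m a0.+1)%:R)).
    by rewrite ler_pM ?exprn_ge0 ?(ltW q_gt0) ?(ltW lo0) // ler_weXn2l ?(ltW q_gt1) //; lia.
  have -> : a.+1 = (a0.+1 + (a - a0))%N by lia.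
  exact: lacunary_expn.
apply: (@le_trans _ _ (\sum_(0 <= a < M) G' a)).
  by apply: ler_sum_nat => a /= aM; apply: leG.
apply: (@le_trans _ _ (\sum_(0 <= a < M + (a0 + L)) G' a)).
  rewrite [leRHS](@big_cat_nat _ _ _ M) ?leq_addr //= lerDl.
  by apply: sumr_ge0 => a _; rewrite /G'; case: ifP.
rewrite (@big_cat_nat _ _ _ a0) //=; last by lia.
rewrite [X in X + _]big_nat_cond big1 ?add0r; last first.
  by move=> a; rewrite andbT /G' => /andP[_]; case: (leqP a0 a).
rewrite (@big_cat_nat _ _ _ (a0 + L)) //=; [|lia..].
rewrite [X in _ + X]big_nat_cond [X in _ + X]big1 ?addr0; last first.
  by move=> a; rewrite andbT /G' => /andP[h _]; rewrite [(a < _)%N]ltnNge h andbF.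
rewrite (eq_big_nat _ _ (F2 := fun=> G)); last by move=> a h; rewrite /G' h.
by rewrite sumr_const_nat addKn mulr_natl.
Qed.

Variable t : R.
Hypothesis t_ge0 : 0 <= t.
Local Notation weight := (relation_weight t m).

(** A set of indices below the [a]-th with exclusive or [w] must contain an
    index with [m] comparable to [w]. *)
Let weight_term_eq0 a w : gap * w%:R > (m a.+1)%:R ->
  weight a (Nat.lxor w (m a.+1)) = 0.
Proof.
move=> wlarge; apply: relation_weight_eq0.
have : (\sum_(1 <= k < a.+2) m k < w)%N.
  rewrite -(ltr_nat R) -(ltr_pM2l gap_gt0); apply: le_lt_trans wlarge.
  exact: lacunary_sum.
rewrite big_nat_recr //= => h.
by have := lxor_ge w (m a.+1); rewrite PeanoNat.Nat.lxor_comm; lia.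
Qed.

Let weight_window (G lo : R) M w : (0 < w)%N -> 0 <= G -> 0 < lo ->
  (forall a, (a < M)%N -> forall v, weight a v <= G) ->
  lo <= gap * w%:R ->
  (forall a, (a < M)%N -> gap ^+ 2 * (m a.+1)%:R <= 4 * lo) ->
  weight M w <= t * (L%:R * G).
Proof.
move=> w0 G0 lo0 WG low hi; rewrite relation_weight_max eqn0Ngt w0 add0r.
rewrite ler_wpM2l //; apply: (lacunary_window_sum lo0) => //.
- by move=> a; exact: relation_weight_ge0.
- by move=> a aM; exact: WG.
move=> a aM Wa; split; last exact: hi.
apply: le_trans low _; rewrite leNgt; apply: contraNN Wa => /weight_term_eq0 ->.
by rewrite eqxx.
Qed.

(** The two remaining large members: if [v] is much smaller than the largest
    member [m a.+1], then two further members are comparable to it. *)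
Let weight_far (G : R) a v : 0 <= G ->
  (forall b, (b < a)%N -> forall u, weight b u <= G) ->
  4 * v%:R < gap * (m a.+1)%:R ->
  weight a (Nat.lxor v (m a.+1)) <= t * (L%:R * (t * (L%:R * G))).
Proof.
move=> G0 WG far; set x := m a.+1 in far *.
have x0 : 0 < x%:R :> R by rewrite ltr0n m_gt0.
have tri (c d : nat) : c%:R <= d%:R + (Nat.lxor c d)%:R :> R.
  by rewrite -natrD ler_nat lxor_ge.
have gx : gap * x%:R < x%:R by rewrite gtr_pMl.
have g2x : gap ^+ 2 * x%:R < gap * x%:R by rewrite expr2 -mulrA ltr_pM2l.
have gx0 : 0 < gap * x%:R by rewrite mulr_gt0.
have g2x0 : 0 < gap ^+ 2 * x%:R by rewrite mulr_gt0 ?exprn_gt0.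
set w := Nat.lxor v x.
have hw : 2^-1 * x%:R <= w%:R :> R.
  by have := tri x v; rewrite PeanoNat.Nat.lxor_comm -/w; lra.
have w0 : (0 < w)%N by rewrite -(ltr0n R); lra.
have below b : (b < a)%N -> (m b.+1)%:R <= (1 - gap) * x%:R.
  move=> ba; have l := @lacunary_homo b.+1 a.+1 isT ba.
  rewrite -(ler_pM2l q_gt0); apply: le_trans l _.
  by rewrite mulrA mulrBr mulr1 (mulrC q) gapq opprB addrC subrK mul1r.
rewrite relation_weight_max eqn0Ngt w0 add0r ler_wpM2l //.
have lo0 : 0 < 2^-1 * (gap * x%:R) by rewrite mulr_gt0 // invr_gt0.
apply: (lacunary_window_sum lo0).
- by move=> b; exact: relation_weight_ge0.
- move=> b ba; have hb := below b ba.
  set u := Nat.lxor w _.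
  have tu := tri x (Nat.lxor v u).
  have uE : Nat.lxor x (Nat.lxor v u) = m b.+1.
    by rewrite /u /w PeanoNat.Nat.lxor_assoc !lxorK.
  have : (Nat.lxor v u)%:R <= v%:R + u%:R :> R by rewrite -natrD ler_nat lxor_le.
  rewrite uE in tu => tuv.
  have hu : 2^-1 * (gap * x%:R) <= u%:R by lra.
  have u0 : (0 < u)%N by rewrite -(ltr0n R); lra.
  apply: (@weight_window G (2^-1 * (gap ^+ 2 * x%:R))) => //.
  + by rewrite mulr_gt0 // invr_gt0.
  + by move=> c cb; apply: WG; exact: ltn_trans ba.
  + by rewrite -(ler_pM2l gap_gt0) in hu; move: hu; rewrite expr2; lra.
  + move=> c cb; have hc := below c (ltn_trans cb ba).
    have : gap ^+ 2 * (m c.+1)%:R <= gap ^+ 2 * x%:R.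
      rewrite ler_wpM2l ?exprn_ge0 ?(ltW gap_gt0) //.
      by move: hc gx0; lra.
    by move: g2x0; lra.
- move=> b ba Wb; have hb := below b ba; split.
    rewrite leNgt; apply: contraNN Wb => hlt; rewrite weight_term_eq0 ?eqxx //.
    by apply: lt_le_trans hlt _; rewrite -(ler_pM2l gap_gt0) in hw; move: hw; lra.
  have : gap ^+ 2 * (m b.+1)%:R <= gap ^+ 2 * x%:R.
    rewrite ler_wpM2l ?exprn_ge0 ?(ltW gap_gt0) //.
    by move: hb gx0; lra.
  by move: g2x0; lra.
- by rewrite !mulr_ge0.
Qed.

(** The sum over the largest member is split according to whether that member
    is far above [v]; near members lie in one window, far ones carry [t ^ 3]. *)
Let weight_step (G : R) (M v : nat) : 0 <= G ->
  (forall a, (a < M)%N -> forall u, weight a u <= G) ->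
  weight M v <= (v == 0%N)%:R + (v != 0%N)%:R * (t * (L%:R * G))
                + M%:R * (t * (t * (L%:R * (t * (L%:R * G))))).
Proof.
move=> G0 WG; rewrite relation_weight_max -addrA lerD2l.
pose far a := 4 * v%:R < gap * (m a.+1)%:R.
pose F1 a := if far a then 0 else weight a (Nat.lxor v (m a.+1)).
pose F2 a := if far a then weight a (Nat.lxor v (m a.+1)) else 0.
rewrite (eq_big_nat _ _ (F2 := fun a => F1 a + F2 a)); last first.
  by move=> a _; rewrite /F1 /F2; case: ifP; rewrite ?addr0 ?add0r.
rewrite big_split /= mulrDr lerD //; last first.
  rewrite mulrCA ler_wpM2l //.
  apply: (@le_trans _ _ (\sum_(0 <= a < M) (t * (L%:R * (t * (L%:R * G)))))).
    apply: ler_sum_nat => a /= aM; rewrite /F2; case: ifPn => fa.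
      by apply: weight_far => // b ba u; apply: WG; exact: ltn_trans aM.
    by rewrite !mulr_ge0.
  by rewrite sumr_const_nat subn0 -[leLHS]mulr_natl.
have [v0|v0] := eqVneq v 0%N.
  rewrite mul0r big_nat_cond big1 ?mulr0 // => a _; rewrite /F1 /far v0 mulr0.
  by rewrite mulr_gt0 // ltr0n m_gt0.
rewrite mul1r ler_wpM2l //.
have v1 : 0 < v%:R :> R by rewrite ltr0n lt0n.
have lo0 : 0 < gap * v%:R by rewrite mulr_gt0.
apply: (lacunary_window_sum lo0) => //.
- by move=> a; rewrite /F1; case: ifP => // _; exact: relation_weight_ge0.
- by move=> a aM; rewrite /F1; case: ifP => // _; exact: WG.
move=> a aM; rewrite /F1 /far; case: ltP => [|near]; first by rewrite eqxx.
move=> Wa; split.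
  by rewrite leNgt; apply: contraNN Wa => /weight_term_eq0 ->; rewrite eqxx.
by rewrite expr2 -mulrA [leRHS]mulrCA ler_pM2l.
Qed.

(** In a relation the largest member either is comparable to the prescribed
    value or, by [weight_far], comes with two neighbours.  So every new member
    costs a bounded number of choices times [t], or [M] choices times [t ^ 3]. *)
Lemma relation_weight_lacunary (n M : nat) :
  L%:R * t <= 4^-1 -> n%:R * t ^+ 3 * L%:R ^+ 2 <= 8^-1 -> (M <= n)%N ->
  relation_weight t m M 0 <= 1 + 2 * (n%:R * t ^+ 3 * L%:R ^+ 2).
Proof.
move=> Lt nt Mn.
have cub k : (k <= n)%N ->
    k%:R * (t * (t * (L%:R * (t * (L%:R * 2))))) <= 2 * (n%:R * t ^+ 3 * L%:R ^+ 2).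
  move=> kn; rewrite [leLHS](_ : _ = 2 * (k%:R * t ^+ 3 * L%:R ^+ 2)); last by ring.
  by rewrite ler_pM2l // !ler_wpM2r ?exprn_ge0 // ler_nat.
(* The bound 2 reproduces itself, and is then used once more at value 0. *)
have W2 : forall a, (a <= n)%N -> forall u, weight a u <= 2.
  elim/ltn_ind => a IH an u; apply: le_trans (weight_step (G := 2) _ _ _) _ => //.
    by move=> b ba v; apply: IH => //; exact: leq_trans (ltnW ba) an.
  have := cub _ an; case: eqP => _; rewrite ?mul0r ?mul1r /=; move: Lt nt; nra.
apply: le_trans (weight_step (G := 2) _ _ _) _ => //.
  by move=> a aM v; apply: W2; exact: leq_trans (ltnW aM) Mn.
by rewrite eqxx mul0r addr0 lerD2l cub.
Qed.

End Lacunary.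

(** * Walsh functions on dyadic cells *)

Lemma dyadic_digit_lt (n i N : nat) : (n < 2 ^ N)%N -> (N <= i)%N ->
  dyadic_digit n i = false.
Proof.
move=> nN Ni; rewrite /dyadic_digit divn_small //.
by apply: leq_trans nN _; rewrite leq_exp2l.
Qed.

Lemma dyadic_digit_neq0 (n : nat) : n != 0%N -> exists i, dyadic_digit n i.
Proof.
apply: contra_neqP => none; rewrite (dyadic_expansion n) big1 // => i _.
by case: (boolP (dyadic_digit n i)) => // di; case: none; exists i.
Qed.

Lemma lxor_lt (a b N : nat) : (a < 2 ^ N)%N -> (b < 2 ^ N)%N -> (Nat.lxor a b < 2 ^ N)%N.
Proof.
move=> aN bN; rewrite ltnNge -divn_gt0 ?expn_gt0 // -eqn0Ngt.
apply: contraT => h; have [k] := dyadic_digit_neq0 h; clear h.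
rewrite /dyadic_digit -divnMA -expnD -/(dyadic_digit _ _) dyadic_digit_lxor.
by rewrite !(@dyadic_digit_lt _ _ N) ?leq_addr.
Qed.

Lemma dyadic_digitD_exp (j s N : nat) : (j < 2 ^ N)%N -> (s < N)%N ->
  dyadic_digit (2 ^ N + j) s = dyadic_digit j s.
Proof.
move=> jN sN; rewrite /dyadic_digit -{1}(subnK (ltnW sN)) expnD divnMDl ?expn_gt0 //.
by rewrite oddD oddX /= subn_eq0 leqNgt sN.
Qed.

Lemma dyadic_digit_top (j N : nat) : (j < 2 ^ N)%N -> dyadic_digit (2 ^ N + j) N.
Proof.
by move=> jN; rewrite /dyadic_digit divnDl ?dvdnn // divnn expn_gt0 divn_small.
Qed.

(** The digits of a uniformly random [j < 2 ^ N] are independent fair bits. *)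
Lemma sum_prod_dyadic_digit (R : comPzRingType) (g : nat -> bool -> R) (N : nat) :
  \sum_(0 <= j < 2 ^ N) \prod_(0 <= s < N) g s (dyadic_digit j s) =
  \prod_(0 <= s < N) (g s false + g s true).
Proof.
elim: N => [|N IH]; first by rewrite expn0 big_nat1 !big_nil.
rewrite expnS mul2n -addnn (@big_cat_nat _ _ _ (2 ^ N)) ?leq_addr //=.
rewrite -{2}[(2 ^ N)%N]add0n big_addn addnK big_nat_recr //= -IH mulrDr.
rewrite !big_distrl /=; congr (_ + _); apply: eq_big_nat => j /= jN.
  by rewrite big_nat_recr //= (dyadic_digit_lt jN (leqnn N)).
rewrite big_nat_recr //= addnC dyadic_digit_top //; congr (_ * _).
by apply: eq_big_nat => s /= sN; rewrite dyadic_digitD_exp.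
Qed.

Section WalshCells.
Context {R : realType}.
Implicit Types (x : R) (N j n : nat).

Lemma rademacher_sqr i x : rademacher i x * rademacher i x = 1.
Proof. by rewrite /rademacher /rademacher0; case: ifP; rewrite ?mulrNN mulr1. Qed.

Lemma walsh_wide n N x : (n <= N)%N ->
  walsh n x = \prod_(0 <= i < N) (if dyadic_digit n i then rademacher i x else 1).
Proof.
move=> nN; rewrite /walsh big_mkcond [RHS](@big_cat_nat _ _ _ n) //=.
have tail1 : \prod_(n <= i < N) (if dyadic_digit n i then rademacher i x else 1) = 1.
  rewrite big_nat_cond big1 // => i; rewrite andbT => /andP[ni _].
  by rewrite (dyadic_digit_big (leqnn n)).
by rewrite tail1 mulr1.
Qed.

Lemma walsh_lxor a b x : walsh (Nat.lxor a b) x = walsh a x * walsh b x.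
Proof.
pose N := (Nat.lxor a b + (a + b))%N.
have [aN bN] : (a <= N)%N /\ (b <= N)%N by rewrite /N; lia.
rewrite (walsh_wide _ aN) (walsh_wide _ bN) (@walsh_wide _ N) ?leq_addr //.
rewrite -big_split /=; apply: eq_bigr => i _; rewrite dyadic_digit_lxor.
by do 2 case: dyadic_digit; rewrite ?mulr1 ?mul1r ?rademacher_sqr.
Qed.

Lemma walsh_pm1 n x : walsh n x = 1 \/ walsh n x = -1.
Proof.
rewrite /walsh; elim/big_ind: _ => [|u v [->|->] [->|->]|i _].
- by left.
- by left; rewrite mulr1.
- by right; rewrite mul1r.
- by right; rewrite mulr1.
- by left; rewrite mulrNN mulr1.
by rewrite /rademacher /rademacher0; case: ifP; [left|right].
Qed.

Definition dyadic_cell N j : set R :=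
  `[j%:R / 2 ^+ N, j.+1%:R / 2 ^+ N[%classic.

(** The binary digit of rank [i] of a point is read off the index of its cell,
    where it has weight [2 ^ (N.-1 - i)]. *)
Lemma dyadic_cell_rademacher N j i x : (i < N)%N -> dyadic_cell N j x ->
  rademacher i x = (-1) ^+ dyadic_digit j (N.-1 - i).
Proof.
move=> iN; rewrite /dyadic_cell /= in_itv /= => /andP[xlo xhi].
pose s := (N.-1 - i)%N; have NE : N = (i + s.+1)%N by rewrite /s; lia.
rewrite -/s /dyadic_digit; set g := (j %/ 2 ^ s)%N.
have p0 k : 0 < 2 ^+ k :> R by rewrite exprn_gt0.
have s0 := p0 s; have N0 := p0 N.
have sE : 2 ^+ s = (2 ^ s)%:R :> R by rewrite natrX.
have glo : (g * 2 ^ s <= j)%N by exact: leq_trunc_div.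
have ghi : (j.+1 <= g.+1 * 2 ^ s)%N by rewrite ltn_ceil // expn_gt0.
rewrite ler_pdivrMr // in xlo; rewrite ltr_pdivlMr // in xhi.
have scale : x * 2 ^+ N = (2 * (2 ^+ i * x)) * 2 ^+ s.
  by rewrite {1}NE exprD exprS; ring.
have lo : g%:R <= 2 * (2 ^+ i * x).
  rewrite -(ler_pM2r s0) -scale; apply: le_trans xlo.
  by rewrite sE -natrM ler_nat.
have hi : 2 * (2 ^+ i * x) < g%:R + 1.
  rewrite -(ltr_pM2r s0) -scale; apply: lt_le_trans xhi _.
  by rewrite natr1 sE -natrM ler_nat.
rewrite /rademacher /rademacher0; set z := 2 ^+ i * x in lo hi *.
have gE := odd_double_half g.
have gER : g%:R = (odd g)%:R + 2 * (g./2)%:R :> R.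
  by rewrite -{1}gE natrD -mul2n natrM.
have fl : Num.floor z = (g./2)%:Z.
  apply/eqP; rewrite floor_eq; rewrite rmorphD /= -pmulrn.
  by move: lo hi; rewrite gER; case: (odd g) => /= lo hi; apply/andP; split; lra.
rewrite fl -pmulrn; case: ltP; move: lo hi; rewrite gER.
  by case: (odd g) => //=; lra.
by case: (odd g) => //=; lra.
Qed.

Lemma dyadic_cell_walsh N j n x : (n < 2 ^ N)%N -> dyadic_cell N j x ->
  walsh n x = \prod_(0 <= s < N)
    (if dyadic_digit n (N.-1 - s) then (-1) ^+ dyadic_digit j s else 1).
Proof.
move=> nN xj; rewrite (@walsh_wide n (n + N)) ?leq_addr //.
rewrite (@big_cat_nat _ _ _ N) ?leq_addl //=.
have tail1 : \prod_(N <= i < n + N) (if dyadic_digit n i then rademacher i x else 1) = 1.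
  rewrite big_nat_cond big1 // => i; rewrite andbT => /andP[ni _].
  by rewrite (dyadic_digit_lt nN).
rewrite tail1 mulr1 [RHS]big_nat_rev /= add0n; apply: eq_big_nat => i /= iN.
have -> : (N.-1 - (N - i.+1))%N = i by lia.
have -> : (N - i.+1)%N = (N.-1 - i)%N by lia.
by rewrite (dyadic_cell_rademacher iN xj).
Qed.

Definition dyadic_point N j : R := j%:R / 2 ^+ N.

Lemma dyadic_cell_point N j : dyadic_cell N j (dyadic_point N j).
Proof.
rewrite /dyadic_cell /= in_itv /= lexx /=.
by rewrite ltr_pM2r ?invr_gt0 ?exprn_gt0 // ltr_nat.
Qed.

Lemma walsh_constant N j n x : (n < 2 ^ N)%N -> dyadic_cell N j x ->
  walsh n x = walsh n (dyadic_point N j).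
Proof.
move=> nN xj; rewrite (dyadic_cell_walsh nN xj).
by rewrite (dyadic_cell_walsh nN (dyadic_cell_point N j)).
Qed.

(** The sum factors over the digits of [j], and a digit [k] of [n] equal to 1
    contributes the factor [1 + -1]. *)
Lemma walsh_orthogonal N n : (n < 2 ^ N)%N ->
  \sum_(0 <= j < 2 ^ N) walsh n (dyadic_point N j) = 2 ^+ N * (n == 0%N)%:R.
Proof.
move=> nN.
pose g s b : R := if dyadic_digit n (N.-1 - s) then (-1) ^+ (b : bool) else 1.
rewrite (eq_bigr (fun j => \prod_(0 <= s < N) g s (dyadic_digit j s))); last first.
  by move=> j _; rewrite (dyadic_cell_walsh nN (dyadic_cell_point N j)).
rewrite sum_prod_dyadic_digit; have [nE|n0] := eqVneq n 0%N.
  rewrite (eq_bigr (fun=> 2)) ?prodr_const_nat ?subn0 ?mulr1 // => s _.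
  by rewrite /g nE /dyadic_digit div0n.
have [k dk] := dyadic_digit_neq0 n0.
have kN : (k < N)%N.
  by rewrite ltnNge; apply: contraL dk => Ni; rewrite (dyadic_digit_lt nN Ni).
rewrite mulr0 (@big_cat_nat _ _ _ (N.-1 - k)) //=; last by lia.
rewrite [X in _ * X]big_ltn; last by lia.
rewrite /g (_ : (N.-1 - (N.-1 - k))%N = k); last by lia.
by rewrite dk expr0 expr1 subrr mul0r mulr0.
Qed.

End WalshCells.

(** * Elementary functions near zero *)

Section RealTaylor.
Context {R : realType}.
Implicit Types x a b p : R.

Lemma MVT0 (f f' : R -> R) x : (forall y, is_derive y (1 : R) f (f' y)) ->
  exists2 c, `|c| <= `|x| & f x - f 0 = f' c * x.
Proof.
move=> df; have cf : continuous f.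
  by move=> y; apply/differentiable_continuous/derivable1_diffP; case: (df y).
have [x0|x0|->] := ltgtP x 0; last by exists 0; rewrite ?subrr ?mulr0.
- have [c + fc] := @MVT _ f f' _ _ x0 (fun y _ => df y) (continuous_subspaceT cf).
  rewrite in_itv /= => /andP[xc c0]; exists c; first by rewrite !ltr0_norm // lerN2 ltW.
  by rewrite -opprB fc; ring.
- have [c + fc] := @MVT _ f f' _ _ x0 (fun y _ => df y) (continuous_subspaceT cf).
  rewrite in_itv /= => /andP[c0 cx]; exists c; first by rewrite !gtr0_norm // ltW.
  by rewrite fc subr0.
Qed.

Lemma normr_sin_le x : `|sin x| <= `|x|.
Proof.
have [c _] := @MVT0 (@sin R) (@cos R) x (fun y => is_derive_sin y).
by rewrite sin0 subr0 => ->; rewrite normrM ler_piMl // cos_max.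
Qed.

Lemma cosE_half x : cos x = 1 - 2 * sin (x / 2) ^+ 2.
Proof.
have -> : cos x = cos (x / 2 *+ 2) by congr cos; rewrite -mulr_natr divfK.
by rewrite cos_mulr2n cos2sin2 -mulr_natr; ring.
Qed.

Lemma cos_ge x : 1 - x ^+ 2 / 2 <= cos x.
Proof.
rewrite cosE_half; have h := normr_sin_le (x / 2).
have : sin (x / 2) ^+ 2 <= (x / 2) ^+ 2.
  rewrite -[leLHS]real_normK ?num_real // -[leRHS]real_normK ?num_real //.
  by rewrite lerXn2r ?nnegrE.
by move=> h2; lra.
Qed.

Lemma sin_third_order x : `|sin x - x| <= `|x| ^+ 3.
Proof.
have dsin y : is_derive y (1 : R) (fun z : R => sin z - z) (cos y - 1).
  exact: is_deriveB.
have [c cx] := MVT0 x dsin; rewrite sin0 subr0 subr0 => ->.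
rewrite normrM exprSr ler_wpM2r //; have := cos_ge c; have := cos_le1 c.
have : c ^+ 2 <= `|x| ^+ 2 by rewrite -[c ^+ 2]real_normK ?num_real // lerXn2r ?nnegrE.
have := sqr_ge0 c; move=> *; rewrite ler0_norm; lra.
Qed.

(** The cosine and the hyperbolic cosine have the half-angle form
    [1 -+ 2 s ^ 2], so their fourth-order remainders are differences of two
    squares. *)
Lemma square_third_order (s y : R) : `|s - y| <= 8 * `|y| ^+ 3 -> `|y| <= 1 ->
  `|s ^+ 2 - y ^+ 2| <= 80 * y ^+ 4.
Proof.
move=> sy y1; have n4 : y ^+ 4 = `|y| ^+ 4.
  by rewrite -[LHS]ger0_norm ?normrX // -[4%N]/(2 * 2)%N exprM sqr_ge0.
have sDy : `|s + y| <= 10 * `|y|.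
  have -> : s + y = (s - y) + 2 * y by ring.
  apply: le_trans (ler_normD _ _) _; rewrite normrM (@ger0_norm _ 2) //.
  have : `|y| ^+ 3 <= `|y| by rewrite -[leRHS]expr1 ler_wiXn2l.
  by lra.
have -> : s ^+ 2 - y ^+ 2 = (s - y) * (s + y) by ring.
rewrite normrM n4 [leRHS](_ : _ = 8 * `|y| ^+ 3 * (10 * `|y|)); last by ring.
exact: ler_pM.
Qed.

Lemma cos_fourth_order x : `|x| <= 1 -> `|cos x - (1 - x ^+ 2 / 2)| <= 10 * x ^+ 4.
Proof.
move=> x1.
have y1 : `|x / 2| <= 1 by rewrite normrM [`|2^-1|]ger0_norm ?invr_ge0 //; lra.
have hs : `|sin (x / 2) - x / 2| <= 8 * `|x / 2| ^+ 3.
  apply: le_trans (sin_third_order _) _.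
  by rewrite ler_peMl ?exprn_ge0 // ler1n.
have sq := square_third_order hs y1; rewrite cosE_half.
rewrite (_ : _ - _ = - 2 * (sin (x / 2) ^+ 2 - (x / 2) ^+ 2)); last by field.
by rewrite normrM normrN (@ger0_norm _ 2) //; move: sq; lra.
Qed.

Definition sinhR x := (expR x - expR (- x)) / 2.
Definition coshR x := (expR x + expR (- x)) / 2.

Lemma sinhR0 : sinhR 0 = 0.
Proof. by rewrite /sinhR oppr0 subrr mul0r. Qed.

Lemma is_derive_expRN x : is_derive x (1 : R) (fun y => expR (- y)) (- expR (- x)).
Proof. by apply: is_derive_eq; rewrite mulrN1. Qed.

Lemma is_derive_sinhR x : is_derive x (1 : R) sinhR (coshR x).
Proof.
rewrite /sinhR /coshR; have d1 := is_derive_expRN x.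
by apply: is_derive_eq; rewrite !scaler0 add0r opprK [RHS]mulrC.
Qed.

Lemma coshRE_half x : coshR x = 1 + 2 * sinhR (x / 2) ^+ 2.
Proof.
rewrite /coshR /sinhR.
have -> : expR x = expR (x / 2) ^+ 2 by rewrite expr2 -expRD; congr expR; field.
have -> : expR (- x) = expR (- (x / 2)) ^+ 2 by rewrite expr2 -expRD; congr expR; field.
have E : expR (x / 2) * expR (- (x / 2)) = 1 by rewrite -expRD subrr expR0.
move: (expR (x / 2)) (expR (- (x / 2))) E => u v E.
rewrite (_ : 1 + _ = 1 - u * v + (u ^+ 2 + v ^+ 2) / 2); last by field.
by rewrite E subrr add0r.
Qed.

(** For [`|p| <= 1/2] both inequalities follow from [1 + p <= expR p]. *)
Lemma expR_second_order p : `|p| <= 2^-1 -> `|expR p - (1 + p)| <= 2 * p ^+ 2.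
Proof.
move=> p1; have lo := expR_ge1Dx p; have lo' := expR_ge1Dx (- p).
have E : expR p * expR (- p) = 1 by rewrite -expRD subrr expR0.
have [pl pu] : - 2^-1 <= p /\ p <= 2^-1 by apply/andP; rewrite -ler_norml.
have e0 := expR_gt0 p; rewrite ger0_norm ?subr_ge0 //.
have h : expR p * (1 - p) <= expR p * expR (- p) by rewrite ler_pM2l.
rewrite E in h.
by nra.
Qed.

Lemma coshR_le x : `|x| <= 1 -> coshR x <= 4.
Proof.
move=> x1.
have p0 (z : R) : `|z| <= 1 -> expR z <= 4.
  move=> z1; have -> : expR z = expR (z / 2) ^+ 2 by rewrite expr2 -expRD; congr expR; field.
  have : `|z / 2| <= 2^-1 by rewrite normrM [`|2^-1|]ger0_norm ?invr_ge0 //; lra.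
  move=> /[dup] h /expR_second_order; rewrite ler_norml => /andP[_].
  move: h; rewrite ler_norml => /andP[h1 h2]; have := expR_gt0 (z / 2).
  move=> e0 e1; have u2 : (z / 2) ^+ 2 <= 4^-1 by nra.
  have e2 : expR (z / 2) <= 2 by lra.
  by rewrite (_ : 4 = 2 ^+ 2 :> R) ?lerXn2r ?nnegrE ?(ltW e0) //; ring.
have a := p0 x x1; have b : expR (- x) <= 4 by apply: p0; rewrite normrN.
by rewrite /coshR; lra.
Qed.

Lemma normr_sinhR_le x : `|x| <= 1 -> `|sinhR x| <= 4 * `|x|.
Proof.
move=> x1; have [c cx] := MVT0 x is_derive_sinhR.
rewrite sinhR0 subr0 => ->.
rewrite normrM ler_wpM2r // ger0_norm; first exact: coshR_le (le_trans cx x1).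
by rewrite divr_ge0 // addr_ge0 // expR_ge0.
Qed.

Lemma sinhR_third_order x : `|x| <= 1 -> `|sinhR x - x| <= 8 * `|x| ^+ 3.
Proof.
move=> x1.
have dsinh y : is_derive y (1 : R) (fun z : R => sinhR z - z) (coshR y - 1).
  by apply: is_deriveB; exact: is_derive_sinhR.
have [c cx] := MVT0 x dsinh.
rewrite sinhR0 !subr0 => ->.
rewrite normrM exprSr mulrA ler_wpM2r // coshRE_half addrC addKr.
have c2 : `|c / 2| = `|c| / 2 by rewrite normrM (@ger0_norm _ 2^-1) ?invr_ge0.
have s1 : `|sinhR (c / 2)| <= 2 * `|x|.
  by apply: le_trans (normr_sinhR_le _) _; rewrite c2; lra.
rewrite ger0_norm; last by rewrite pmulr_rge0 // sqr_ge0.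
have : sinhR (c / 2) ^+ 2 <= (2 * `|x|) ^+ 2.
  by rewrite -[leLHS]real_normK ?num_real // lerXn2r ?nnegrE // mulr_ge0.
by move=> h; lra.
Qed.

Lemma coshR_fourth_order x : `|x| <= 1 -> `|coshR x - (1 + x ^+ 2 / 2)| <= 10 * x ^+ 4.
Proof.
move=> x1.
have y1 : `|x / 2| <= 1 by rewrite normrM (@ger0_norm _ 2^-1) ?invr_ge0 //; lra.
have sq := square_third_order (sinhR_third_order y1) y1; rewrite coshRE_half.
rewrite (_ : _ - _ = 2 * (sinhR (x / 2) ^+ 2 - (x / 2) ^+ 2)); last by field.
by rewrite normrM (@ger0_norm _ 2) //; move: sq; lra.
Qed.

End RealTaylor.

Section ComplexExponential.
Local Open Scope complex_scope.
Context {R : realType}.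
Implicit Types z w : R[i].
Local Notation Re := (@complex.Re R).
Local Notation Im := (@complex.Im R).

Definition cexp z : R[i] :=
  Complex (expR (Re z) * cos (Im z)) (expR (Re z) * sin (Im z)).
Definition ccosh z : R[i] :=
  Complex (coshR (Re z) * cos (Im z)) (sinhR (Re z) * sin (Im z)).
Definition csinh z : R[i] :=
  Complex (sinhR (Re z) * cos (Im z)) (coshR (Re z) * sin (Im z)).

Lemma cexp0 : cexp 0 = 1.
Proof. by rewrite /cexp /= expR0 cos0 sin0 mulr1 mulr0. Qed.

Lemma cexpD z w : cexp (z + w) = cexp z * cexp w.
Proof.
case: z w => [a b] [c d]; rewrite /cexp /= expRD cosD sinD.
by congr Complex; ring.
Qed.

Lemma cexp_sum (I : Type) (r : seq I) (F : I -> R[i]) :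
  cexp (\sum_(i <- r) F i) = \prod_(i <- r) cexp (F i).
Proof. by apply: (big_morph cexp cexpD cexp0). Qed.

Lemma normc_cexp z : normc (cexp z) = expR (Re z).
Proof.
by rewrite /cexp /= !exprMn -mulrDr cos2Dsin2 mulr1 sqrtr_sqr ger0_norm ?expR_ge0.
Qed.

Lemma cexp_sign z (s : R) : s = 1 \/ s = -1 ->
  cexp (z * s%:C) = ccosh z + s%:C * csinh z.
Proof.
case: z => [a b] hs; have -> : Complex a b * s%:C = Complex (a * s) (b * s).
  by congr Complex; ring.
apply/eqP; rewrite eq_complex /cexp /ccosh /csinh /coshR /sinhR /=.
case: hs => ->; rewrite ?mulr1 ?mulrN1 ?cosN ?sinN;
  by apply/andP; split; apply/eqP; field.
Qed.

Lemma normc_le_add (a b : R) : normc (Complex a b) <= `|a| + `|b|.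
Proof.
rewrite /= -[leRHS]ger0_norm ?addr_ge0 // -sqrtr_sqr ler_wsqrtr //.
rewrite sqrrD !real_normK ?num_real // addrAC lerDl.
by rewrite mulrn_wge0 // mulr_ge0.
Qed.

Lemma normc_ge0 z : 0 <= normc z.
Proof. by case: z => a b; exact: sqrtr_ge0. Qed.

Lemma normr_Re_le z : `|Re z| <= normc z.
Proof.
case: z => a b /=; rewrite -sqrtr_sqr ler_wsqrtr // lerDl; exact: sqr_ge0.
Qed.

Lemma normr_Im_le z : `|Im z| <= normc z.
Proof.
case: z => a b /=; rewrite -sqrtr_sqr ler_wsqrtr // lerDr; exact: sqr_ge0.
Qed.

Lemma mul_approx (x x' y y' : R) (e f X Y : R) :
  `|x - x'| <= e -> `|y - y'| <= f -> `|y| <= Y -> `|x'| <= X ->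
  `|x * y - x' * y'| <= e * Y + X * f.
Proof.
move=> hx hy hY hX.
have -> : x * y - x' * y' = (x - x') * y + x' * (y - y') by ring.
by apply: le_trans (ler_normD _ _) _; rewrite !normrM lerD // ler_pM.
Qed.

(** Both functions are [1 + z ^ 2 / 2] up to a remainder of order four. *)
Lemma ccosh_gauss z : normc z <= 1 ->
  normc (ccosh z - cexp ((2^-1)%:C * z ^+ 2)) <= 44 * normc z ^+ 4.
Proof.
move=> n1; have := normr_Re_le z; have := normr_Im_le z; have := normc_ge0 z.
move: n1; set n := normc z; move: n => n n1 n0; case: z => a b.
move=> bn' an'; have bn : `|b| <= n := bn'; have an : `|a| <= n := an'.
have a1 := le_trans an n1; have b1 := le_trans bn n1.
pose p := (a ^+ 2 - b ^+ 2) / 2; pose r := a * b.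
have -> : (2^-1)%:C * Complex a b ^+ 2 = Complex p r.
  by rewrite /p /r expr2; congr Complex; field.
have a2 : a ^+ 2 <= n ^+ 2 by rewrite -[leLHS]real_normK ?num_real // lerXn2r ?nnegrE.
have b2 : b ^+ 2 <= n ^+ 2 by rewrite -[leLHS]real_normK ?num_real // lerXn2r ?nnegrE.
have n2 : n ^+ 2 <= 1 by rewrite -(expr1n _ 2) lerXn2r ?nnegrE.
have [a20 b20] := (sqr_ge0 a, sqr_ge0 b).
have pn : `|p| <= n ^+ 2 / 2 by rewrite ler_norml /p; apply/andP; split; lra.
have rn : `|r| <= n ^+ 2 by rewrite normrM expr2 ler_pM.
have p2 : p ^+ 2 <= n ^+ 4 / 4.
  rewrite -[leLHS]real_normK ?num_real // (_ : n ^+ 4 / 4 = (n ^+ 2 / 2) ^+ 2); last by field.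
  by rewrite lerXn2r ?nnegrE ?divr_ge0 ?exprn_ge0.
have r2 : r ^+ 2 <= n ^+ 4.
  rewrite -[leLHS]real_normK ?num_real // (_ : n ^+ 4 = (n ^+ 2) ^+ 2); last by ring.
  by rewrite lerXn2r ?nnegrE ?exprn_ge0.
have e4 (x : R) : x ^+ 4 = (x ^+ 2) ^+ 2 by rewrite -exprM.
have a4 : a ^+ 4 <= n ^+ 4 by rewrite !e4 lerXn2r ?nnegrE ?sqr_ge0.
have b4 : b ^+ 4 <= n ^+ 4 by rewrite !e4 lerXn2r ?nnegrE ?sqr_ge0.
have ab4 : a ^+ 2 * b ^+ 2 <= n ^+ 4.
  by rewrite e4 expr2 ler_pM.
have ph : `|p| <= 2^-1 by apply: le_trans pn _; lra.
have [hch hsh] := (coshR_fourth_order a1, sinhR_third_order a1).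
have [hcos hsin] := (cos_fourth_order b1, sin_third_order b).
have hexp := expR_second_order ph.
have n4 : 0 <= n ^+ 4 by rewrite exprn_ge0.
have n3 : n ^+ 4 = n ^+ 3 * n by rewrite exprSr.
have a3 : `|a| ^+ 3 <= n ^+ 3 by rewrite lerXn2r ?nnegrE.
have b3 : `|b| ^+ 3 <= n ^+ 3 by rewrite lerXn2r ?nnegrE.
have hre1 : `|coshR a * cos b - (1 + a ^+ 2 / 2) * (1 - b ^+ 2 / 2)| <=
    10 * a ^+ 4 * 1 + 2 * (10 * b ^+ 4).
  apply: mul_approx => //; first exact: cos_max.
  by rewrite ler_norml; apply/andP; split; clear - a2 n2 a20; lra.
have hre2 : `|expR p * cos r - (1 + p) * 1| <= 2 * p ^+ 2 * 1 + 2 * (r ^+ 2 / 2).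
  apply: mul_approx => //; last 2 first.
  - exact: cos_max.
  - by move: ph; clear; rewrite !ler_norml => /andP[? ?]; apply/andP; split; lra.
  by have := cos_ge r; have := cos_le1 r; clear => ? ?; rewrite ler_norml; apply/andP; split; lra.
have him1 : `|sinhR a * sin b - a * b| <= 8 * n ^+ 3 * n + n * n ^+ 3.
  apply: mul_approx => //.
  - by apply: le_trans hsh _; rewrite ler_pM2l.
  - exact: le_trans hsin _.
  - exact: le_trans (normr_sin_le b) _.
have him2 : `|expR p * sin r - 1 * r| <= n ^+ 2 * n ^+ 2 + 1 * n ^+ 4.
  apply: mul_approx => //.
  - rewrite (_ : _ - 1 = (expR p - (1 + p)) + p); last by ring.
    apply: le_trans (ler_normD _ _) _.
    have : n ^+ 4 <= n ^+ 2 by rewrite ler_wiXn2l.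
    by move: hexp pn p2; clear; lra.
  - apply: le_trans (sin_third_order r) _.
    rewrite exprS e4 -[leRHS]mul1r ler_pM ?exprn_ge0 ?(le_trans rn) //.
    by rewrite lerXn2r ?nnegrE ?exprn_ge0.
  - exact: le_trans (normr_sin_le r) _.
  - by rewrite normr1.
rewrite /ccosh /cexp /=; apply: le_trans (normc_le_add _ _) _.
have -> : coshR a * cos b - expR p * cos r =
  (coshR a * cos b - (1 + a ^+ 2 / 2) * (1 - b ^+ 2 / 2))
  - (expR p * cos r - (1 + p) * 1) - a ^+ 2 * b ^+ 2 / 4 by rewrite /p; field.
have -> : sinhR a * sin b - expR p * sin r =
  (sinhR a * sin b - a * b) - (expR p * sin r - 1 * r) by rewrite /r; ring.
have t1 := ler_normB (sinhR a * sin b - a * b) (expR p * sin r - 1 * r).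
move: hre1 hre2 him1 him2 t1; set u1 := coshR a * _ - _; set u2 := expR p * cos r - _.
set u3 := sinhR a * _ - _; set u4 := expR p * sin r - _ => hre1 hre2 him1 him2 t1.
have t2 := ler_normB (u1 - u2) (a ^+ 2 * b ^+ 2 / 4).
have t3 := ler_normB u1 u2.
have t4 : `|a ^+ 2 * b ^+ 2 / 4| = a ^+ 2 * b ^+ 2 / 4.
  by rewrite ger0_norm // divr_ge0 // mulr_ge0.
have e22 : n ^+ 2 * n ^+ 2 = n ^+ 4 by rewrite -exprD.
have e13 : n * n ^+ 3 = n ^+ 4 by rewrite -exprS.
have e31 : 8 * n ^+ 3 * n = 8 * n ^+ 4 by rewrite -mulrA -exprSr.
rewrite e22 in him2; rewrite e13 e31 in him1.
move: t1 t2 t3; rewrite t4; move: hre1 hre2 him1 him2 a4 b4 p2 r2 ab4 n4; clear.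
by lra.
Qed.

Lemma normc_csinh z : normc z <= 1 -> normc (csinh z) <= 8 * normc z.
Proof.
move=> n1; have := normr_Re_le z; have := normr_Im_le z; have := normc_ge0 z.
move: n1; set n := normc z; move: n => n n1 n0; case: z => a b /= bn an.
have a1 := le_trans an n1.
apply: le_trans (normc_le_add _ _) _; rewrite (normrM (sinhR a)) (normrM (coshR a)).
have c0 : 0 <= coshR a by rewrite divr_ge0 // addr_ge0 // expR_ge0.
have : `|sinhR a| * `|cos b| <= 4 * n * 1.
  rewrite ler_pM ?cos_max //; apply: le_trans (normr_sinhR_le a1) _.
  by rewrite ler_pM2l.
have : `|coshR a| * `|sin b| <= 4 * n.
  rewrite ler_pM ?(le_trans (normr_sin_le b)) // ger0_norm //; exact: coshR_le.
by lra.
Qed.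

(** The real part of [z ^ 2 / 2] is at least [- 1 / 32] here. *)
Lemma cexp_gauss_ge z : normc z <= 4^-1 -> 2^-1 <= normc (cexp ((2^-1)%:C * z ^+ 2)).
Proof.
move=> n1; rewrite normc_cexp; apply: le_trans (expR_ge1Dx _).
have := normr_Im_le z; have := normr_Re_le z; case: z n1 => a b n1 /=.
move=> an bn; have a1 := le_trans an n1; have b1 := le_trans bn n1.
move: a1 b1; rewrite !ler_norml => /andP[? ?] /andP[? ?].
by rewrite mul0r subr0; nra.
Qed.

End ComplexExponential.

(** * The Laplace transform of a Walsh sum *)

Section NormProducts.
Local Open Scope complex_scope.
Context {R : realType}.
Implicit Types z w : R[i].

Lemma normcD_le z w : normc (z + w) <= normc z + normc w.
Proof. exact: le_normcD. Qed.

Lemma normc_real (x : R) : normc x%:C = `|x|.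
Proof. by rewrite /= expr0n /= addr0 sqrtr_sqr. Qed.

Lemma normcMM z w : normc (z * w) = normc z * normc w.
Proof. exact: Normc.normcM. Qed.

Lemma normc_mul_sub1 z w (e f : R) : normc (z - 1) <= e -> normc (w - 1) <= f ->
  normc (z * w - 1) <= (1 + e) * (1 + f) - 1.
Proof.
move=> ze wf; have [e0 f0] := (le_trans (normc_ge0 _) ze, le_trans (normc_ge0 _) wf).
have -> : z * w - 1 = (z - 1) * (w - 1) + ((z - 1) + (w - 1)) by ring.
apply: le_trans (normcD_le _ _) _.
have h1 : normc ((z - 1) * (w - 1)) <= e * f by rewrite normcMM ler_pM ?normc_ge0.
have h2 := normcD_le (z - 1) (w - 1).
by move: h1 h2 ze wf; lra.
Qed.

(** The majorant [\prod_k (1 + e k) - 1] is bounded with [1 + e <= expR e]. *)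
Lemma normc_prod_sub1 (F : nat -> R[i]) (e : nat -> R) (n : nat) :
  (forall k, (1 <= k <= n)%N -> normc (F k - 1) <= e k) ->
  normc (\prod_(1 <= k < n.+1) F k - 1) <= expR (\sum_(1 <= k < n.+1) e k) - 1.
Proof.
elim: n => [|n IH] Fe.
  by rewrite !big_geq // subrr expR0 subrr Normc.normc0.
rewrite big_nat_recr //= (@big_nat_recr _ _ _ _ _ e) //= expRD; have Fn := Fe n.+1 (leqnn _).
apply: le_trans (normc_mul_sub1 (IH _) Fn) _.
  by move=> k /andP[k1 kn]; apply: Fe; rewrite k1 ltnW.
rewrite lerD2r [1 + (_ - 1)]addrC subrK ler_wpM2l ?expR_ge0 //.
by rewrite expR_ge1Dx.
Qed.

End NormProducts.

Section WalshMGF.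
Local Open Scope complex_scope.
Context {R : realType}.
Variables (N : nat) (m : nat -> nat).

Definition dyadic_mean (f : nat -> R[i]) : R[i] :=
  ((2 ^+ N)^-1)%:C * \sum_(0 <= j < 2 ^ N) f j.

Let W v j : R[i] := (walsh v (dyadic_point N j) : R)%:C.
Let riesz (tau : nat -> R[i]) M v :=
  dyadic_mean (fun j => (\prod_(1 <= k < M.+1) (1 + tau k * W (m k) j)) * W v j).

(** Expanding the Riesz product, each set [T] of factors contributes the mean of
    [W (\xor_(k in T) m k)], which is 0 or 1. *)
Lemma riesz_product_mean (tau : nat -> R[i]) (t : R) (M v : nat) :
  (forall k, (1 <= k <= M)%N -> (m k < 2 ^ N)%N) ->
  (forall k, (1 <= k <= M)%N -> normc (tau k) <= t) ->
  (v < 2 ^ N)%N ->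
  normc (riesz tau M v - (v == 0%N)%:R) <= relation_weight t m M v - (v == 0%N)%:R.
Proof.
elim: M v => [|M IH] v mN taut vN.
  rewrite /riesz /dyadic_mean /= subrr.
  rewrite (eq_bigr (fun j => W v j)); last by move=> j _; rewrite big_geq // mul1r.
  rewrite -(rmorph_sum (real_complex R)) /= walsh_orthogonal // -rmorphM /= mulrA.
  rewrite mulVf ?expf_neq0 // mul1r; by case: (v == 0%N) => /=; rewrite !subrr expr0n addr0 sqrtr0.
have mM : (m M.+1 < 2 ^ N)%N by apply: mN; rewrite ltnSn.
have step : riesz tau M.+1 v = riesz tau M v
    + tau M.+1 * riesz tau M (Nat.lxor v (m M.+1)).
  rewrite /riesz /dyadic_mean mulrCA -mulrDr; congr (_ * _).
  rewrite big_distrr -big_split /=; apply: eq_bigr => j _.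
  by rewrite big_nat_recr //= /W walsh_lxor rmorphM /=; ring.
have mN' k : (1 <= k <= M)%N -> (m k < 2 ^ N)%N.
  by move=> /andP[k1 kM]; apply: mN; rewrite k1 ltnW.
have taut' k : (1 <= k <= M)%N -> normc (tau k) <= t.
  by move=> /andP[k1 kM]; apply: taut; rewrite k1 ltnW.
have h1 := IH v mN' taut' vN.
set u := Nat.lxor v _ in step *; have uN : (u < 2 ^ N)%N by exact: lxor_lt.
have h2 := IH u mN' taut' uN.
have ht : normc (tau M.+1) <= t by apply: taut; rewrite ltnSn.
have t0 := le_trans (normc_ge0 _) ht.
rewrite step addrAC /= -/u [leRHS]addrAC; apply: le_trans (normcD_le _ _) _.
rewrite lerD // normcMM ler_pM ?normc_ge0 //.
rewrite -[X in normc X](subrK (u == 0%N)%:R); apply: le_trans (normcD_le _ _) _.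
have -> : normc ((u == 0%N)%:R : R[i]) = (u == 0%N)%:R.
  by case: (u == 0%N); rewrite ?Normc.normc1 ?Normc.normc0.
by rewrite -lerBrDr.
Qed.

Variables (n : nat) (b : nat -> R).

Let S j := \sum_(1 <= k < n.+1) b k * walsh (m k) (dyadic_point N j).

(** With [w k = z * b k], the exponential of [z * S] is
    [\prod_k ccosh (w k)] times a Riesz product with coefficients
    [csinh (w k) / ccosh (w k)], and each [ccosh (w k)] is close to
    [cexp (w k ^ 2 / 2)].  The relative errors of the two parts multiply. *)
Lemma walsh_mgf (z gauss : R[i]) (d : R) :
  gauss = cexp ((2^-1)%:C * z ^+ 2 * (\sum_(1 <= k < n.+1) b k ^+ 2)%:C) ->
  (forall k, (1 <= k <= n)%N -> (m k < 2 ^ N)%N) ->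
  (forall k, (1 <= k <= n)%N -> `|b k| <= d) ->
  normc z * d <= 4^-1 ->
  normc (dyadic_mean (fun j => cexp (z * (S j)%:C)) - gauss) <=
  normc gauss *
    (expR (88 * normc z ^+ 4 * \sum_(1 <= k < n.+1) b k ^+ 4)
     * relation_weight (32 * (normc z * d)) m n 0 - 1).
Proof.
move=> gaussD mN bd zd.
pose w k := z * (b k)%:C; pose g k := cexp ((2^-1)%:C * w k ^+ 2).
pose c k := ccosh (w k); pose tau k := csinh (w k) / c k; pose r k := c k / g k.
have wn k : normc (w k) = normc z * `|b k| by rewrite normcMM normc_real.
have w4 k : (1 <= k <= n)%N -> normc (w k) <= 4^-1.
  move=> kn; rewrite wn; apply: le_trans zd; rewrite ler_wpM2l ?normc_ge0 //.
  exact: bd.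
have w1 k : (1 <= k <= n)%N -> normc (w k) <= 1.
  by move=> kn; apply: le_trans (w4 k kn) _; lra.
have g2 k : (1 <= k <= n)%N -> 2^-1 <= normc (g k).
  by move=> kn; apply: cexp_gauss_ge; exact: w4.
have neq0 (x : R[i]) : 0 < normc x -> x != 0.
  by apply: contraTneq => ->; rewrite Normc.normc0 ltxx.
have g0 k : (1 <= k <= n)%N -> g k != 0.
  by move=> kn; apply: neq0; apply: lt_le_trans (g2 k kn); rewrite invr_gt0.
have cg k : (1 <= k <= n)%N -> normc (c k - g k) <= 44 * normc (w k) ^+ 4.
  by move=> kn; apply: ccosh_gauss; exact: w1.
have c4 k : (1 <= k <= n)%N -> 4^-1 <= normc (c k).
  move=> kn; have h1 := g2 k kn; have h2 := cg k kn.
  have h3 : normc (g k) <= normc (c k) + normc (c k - g k).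
    rewrite -[in normc (c k - g k)]opprB normcN -[in leLHS](subrK (c k) (g k)) addrC.
    exact: normcD_le.
  have : normc (w k) ^+ 4 <= 4^-1 ^+ 4.
    by rewrite lerXn2r ?nnegrE ?normc_ge0 ?invr_ge0 // w4.
  by move: h1 h2 h3; clear; lra.
have c0 k : (1 <= k <= n)%N -> c k != 0.
  by move=> kn; apply: neq0; apply: lt_le_trans (c4 k kn); rewrite invr_gt0.
(* 32 = 8 * 4, from [normc_csinh] and the lower bound for [ccosh]. *)
have taud k : (1 <= k <= n)%N -> normc (tau k) <= 32 * (normc z * d).
  move=> kn; rewrite /tau normcMM Normc.normcV.
  rewrite ler_pdivrMr; last by apply: lt_le_trans (c4 k kn); rewrite invr_gt0.
  apply: le_trans (normc_csinh (w1 k kn)) _; rewrite wn.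
  have h1 := c4 k kn; have h2 : normc z * `|b k| <= normc z * d.
    by rewrite ler_wpM2l ?normc_ge0 // bd.
  have h3 : 0 <= normc z * `|b k| by rewrite mulr_ge0 ?normc_ge0.
  by nra.
(* 88 = 44 * 2, from [ccosh_gauss] and [cexp_gauss_ge]. *)
have rd k : (1 <= k <= n)%N -> normc (r k - 1) <= 88 * normc z ^+ 4 * b k ^+ 4.
  move=> kn; rewrite /r -[X in _ - X](divff (g0 k kn)) -mulrBl normcMM Normc.normcV.
  rewrite ler_pdivrMr; last by apply: lt_le_trans (g2 k kn); rewrite invr_gt0.
  apply: le_trans (cg k kn) _; rewrite wn exprMn.
  have -> : `|b k| ^+ 4 = b k ^+ 4.
    by rewrite -normrX ger0_norm // (exprM _ 2 2) sqr_ge0.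
  have h1 := g2 k kn.
  have h3 : 0 <= normc z ^+ 4 * b k ^+ 4.
    by rewrite mulr_ge0 //; rewrite (exprM _ 2 2) sqr_ge0.
  by nra.
have gaussE : gauss = \prod_(1 <= k < n.+1) g k.
  rewrite gaussD /g -cexp_sum rmorph_sum big_distrr /=; congr cexp.
  by apply: eq_bigr => k _; rewrite /w rmorphXn /=; ring.
have meanE : dyadic_mean (fun j => cexp (z * (S j)%:C)) =
    (\prod_(1 <= k < n.+1) c k) * riesz tau n 0.
  rewrite /riesz /dyadic_mean mulrCA; congr (_ * _); rewrite big_distrr /=.
  apply: eq_bigr => j _; rewrite /S rmorph_sum big_distrr /= cexp_sum.
  have -> : W 0 j = 1 by rewrite /W /walsh big_geq.
  rewrite mulr1 -big_split /=.
  apply: eq_big_nat => k; rewrite ltnS => kn.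
  rewrite rmorphM /= mulrA cexp_sign; last exact: walsh_pm1.
  by rewrite mulrDr mulr1 -/(w k) -/(c k) mulrA (mulrC (c k)) /tau divfK ?c0 // mulrC.
have cE : \prod_(1 <= k < n.+1) c k = gauss * \prod_(1 <= k < n.+1) r k.
  rewrite gaussE -big_split /=; apply: eq_big_nat => k; rewrite ltnS => kn.
  by rewrite /r mulrC divfK ?g0.
rewrite meanE cE -mulrA -[X in _ - X]mulr1 -mulrBr normcMM.
rewrite ler_wpM2l ?normc_ge0 //.
have hr := normc_prod_sub1 rd; rewrite -big_distrr /= in hr.
have hT := @riesz_product_mean tau _ n 0 mN taud (expn_gt0 2 N).
apply: le_trans (normc_mul_sub1 hr hT) _.
by rewrite eqxx mulr1n ![1 + (_ - 1)]addrC !subrK.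
Qed.

End WalshMGF.

(** * Laws, tilts and smoothed tails *)

Section Reflection.
Context {R : realType}.
Local Notation mu := (@lebesgue_measure R).
Local Open Scope ereal_scope.

Lemma pushforward_lebesgue_reflect (x : R) (A : set R) : measurable A ->
  pushforward mu (fun v : measurableTypeR R => (x - v)%R : measurableTypeR R) A = mu A.
Proof.
move=> mA; apply/esym/lebesgue_measure_unique => //=.
  by apply: measurable_funB.
move=> _ _ [[a b]] _ <-; rewrite /pushforward /=.
have -> : (fun v : R => x - v)%R @^-1` `]a, b]%classic = `[(x - b)%R, (x - a)%R[%classic.
  by apply/seteqP; split=> v /=; rewrite !in_itv /= => /andP[? ?]; apply/andP; split; lra.
rewrite !lebesgue_measure_itv /= !lte_fin.
have -> : (x - b < x - a)%R = (a < b)%R by rewrite ltrD2l ltrN2.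
by case: ifP => // _; rewrite -!EFinB; congr EFin; ring.
Qed.

Lemma ge0_integral_reflect (x : R) (f : R -> \bar R) :
  measurable_fun setT f -> (forall y, 0 <= f y) ->
  \int[mu]_y f y = \int[mu]_v f (x - v)%R.
Proof.
move=> mf f0.
have mphi : measurable_fun setT (fun v : measurableTypeR R => (x - v)%R : measurableTypeR R).
  by apply: measurable_funB.
rewrite -[RHS](@ge0_integral_pushforward _ _ _ _ _ _ mphi mu setT f) //.
by apply: eq_measure_integral => A mA _; first [exact: pushforward_lebesgue_reflect|exact/esym/pushforward_lebesgue_reflect].
Qed.

Lemma ge0_integral_translate (x : R) (f : R -> \bar R) :
  measurable_fun setT f -> (forall y, 0 <= f y) ->
  \int[mu]_y f y = \int[mu]_v f (v + x)%R.
Proof.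
move=> mf f0; rewrite (@ge0_integral_reflect 0%R) //.
rewrite (@ge0_integral_reflect (- x)%R (fun v => f (0 - v)%R)) //.
  by apply: eq_integral => v _; congr f; ring.
by apply: measurableT_comp mf _; apply: measurable_funB.
Qed.

End Reflection.

Section Laws.
Context {R : realType}.
Local Notation mu := (@lebesgue_measure R).

Definition step (x : R) : R := \1_(`[0, +oo[%classic : set R) x.

Lemma stepE x : step x = ((0 <= x)%R)%:R.
Proof.
rewrite /step indicE; congr (nat_of_bool _)%:R.
by apply/idP/idP; rewrite inE /= in_itv /= andbT.
Qed.

Lemma step_ge0 x : 0 <= step x. Proof. by rewrite stepE ler0n. Qed.

Lemma measurable_step : measurable_fun setT step.
Proof. exact: measurable_indic. Qed.

(** A law is given by a density [w] with respect to Lebesgue measure and a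
    variable [X]; a uniform variable on [0, 1[ and a variable with density are
    both of this form. *)
Section OneLaw.
Variables (w X k : R -> R) (theta : R).
Hypothesis w_ge0 : forall t, 0 <= w t.
Hypothesis mw : measurable_fun setT w.
Hypothesis mX : measurable_fun setT X.
Hypothesis k_ge0 : forall v, 0 <= k v.
Hypothesis mk : measurable_fun setT k.

Definition law_tail (c : R) : \bar R := (\int[mu]_t (w t * step (X t - c))%:E)%E.

Definition tilted_mean (s : R) : \bar R :=
  (\int[mu]_t (w t * (expR (theta * X t) * k (X t - s)))%:E)%E.

Definition smoothed_tail (s : R) : \bar R :=
  (\int[mu]_c ((expR (theta * c) * k (c - s))%:E * law_tail c))%E.

Let mexp d (T : measurableType d) (f : T -> R) : measurable_fun setT f -> measurable_fun setT (fun t => expR (f t)).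
Proof. by move=> mf; apply: measurableT_comp. Qed.

(** Substituting [c = X t - v] in the inner integral.  The identity expresses
    the smoothed tail through the tilted means, which Fourier analysis reaches. *)
Lemma smoothed_tailE s : smoothed_tail s =
  (\int[mu]_v ((step v * expR (- (theta * v)))%:E * tilted_mean (s + v)))%E.
Proof.
rewrite /smoothed_tail /law_tail.
pose f (p : R * R) : \bar R :=
  (expR (theta * p.1) * k (p.1 - s) * (w p.2 * step (X p.2 - p.1)))%:E.
pose g (p : R * R) : \bar R :=
  (step p.2 * expR (- (theta * p.2)) *
   (w p.1 * (expR (theta * X p.1) * k (X p.1 - (s + p.2)))))%:E.
have m1 : measurable_fun setT (fun p : R * R => p.1) by exact: measurable_fst.
have m2 : measurable_fun setT (fun p : R * R => p.2) by exact: measurable_snd.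
have mf : measurable_fun setT f.
  apply/measurable_EFinP; apply: measurable_funM; apply: measurable_funM.
  - by apply: mexp; apply: measurable_funM.
  - by apply: measurableT_comp mk _; apply: measurable_funB.
  - exact: measurableT_comp mw _.
  - apply: measurableT_comp measurable_step _; apply: measurable_funB => //.
    exact: measurableT_comp mX _.
have mg : measurable_fun setT g.
  have mX1 : measurable_fun setT (fun p : R * R => X p.1) by exact: measurableT_comp mX _.
  apply/measurable_EFinP; apply: measurable_funM; apply: measurable_funM.
  - exact: measurableT_comp measurable_step _.
  - by apply: mexp; apply: measurableT_comp => //; apply: measurable_funM.
  - exact: measurableT_comp mw _.
  - apply: measurable_funM; first by apply: mexp; apply: measurable_funM.
    by apply: measurableT_comp mk _; apply: measurable_funB => //; apply: measurable_funD.
have f0 p : (0 <= f p)%E by rewrite lee_fin !mulr_ge0 ?expR_ge0 ?step_ge0.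
have g0 p : (0 <= g p)%E by rewrite lee_fin !mulr_ge0 ?expR_ge0 ?step_ge0.
have msec1 (h : R * R -> \bar R) x : measurable_fun setT h -> measurable_fun setT (fun y => h (x, y)).
  by move=> mh; apply: measurableT_comp mh _; exact: measurable_pair1.
have msec2 (h : R * R -> \bar R) y : measurable_fun setT h -> measurable_fun setT (fun x => h (x, y)).
  by move=> mh; apply: measurableT_comp mh _; exact: measurable_pair2.
transitivity (\int[mu]_c \int[mu]_t f (c, t))%E.
  apply: eq_integral => c _; rewrite -ge0_integralZl ?lee_fin ?mulr_ge0 ?expR_ge0 //.
  - apply/measurable_EFinP; apply: measurable_funM => //.
    by apply: measurableT_comp measurable_step _; apply: measurable_funB.
  - by move=> t _; rewrite lee_fin mulr_ge0 ?step_ge0.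
rewrite fubini_tonelli //.
transitivity (\int[mu]_t \int[mu]_v g (t, v))%E.
  apply: eq_integral => t _; rewrite [LHS](ge0_integral_reflect (X t)) //; last exact: (msec2 f t mf).
  apply: eq_integral => v _; rewrite /f /g /=; congr EFin.
  have -> : X t - (X t - v) = v by ring.
  have -> : X t - v - s = X t - (s + v) by ring.
  have -> : theta * (X t - v) = theta * X t + - (theta * v) by ring.
  by rewrite expRD; ring.
rewrite fubini_tonelli //; apply: eq_integral => v _.
rewrite /tilted_mean -ge0_integralZl ?lee_fin ?mulr_ge0 ?expR_ge0 ?step_ge0 //.
- apply/measurable_EFinP; apply: measurable_funM => //; apply: measurable_funM.
    by apply: mexp; apply: measurable_funM.
  by apply: measurableT_comp mk _; apply: measurable_funB.
- by move=> t _; rewrite lee_fin !mulr_ge0 ?expR_ge0.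
Qed.

End OneLaw.

End Laws.

(** * The Fejer kernel *)

Section FTC.
Context {R : realType}.
Local Notation mu := (@lebesgue_measure R).

Lemma is_derive_continuous (F f : R -> R) :
  (forall x, is_derive x (1 : R) F (f x)) -> continuous F.
Proof.
by move=> dF y; apply/differentiable_continuous/derivable1_diffP; case: (dF y).
Qed.

Lemma integral_is_derive (F f : R -> R) (a b : R) : a < b -> continuous f ->
  (forall x, is_derive x (1 : R) F (f x)) ->
  (\int[mu]_(x in `[a, b]) (f x)%:E = (F b - F a)%:E)%E.
Proof.
move=> ab cf dF; have cF := is_derive_continuous dF.
rewrite (@continuous_FTC2 _ f F) //; first exact: continuous_subspaceT.
- split; first by move=> x _; case: (dF x).
  + by apply: cvg_at_right_filter; exact: cF.
  + by apply: cvg_at_left_filter; exact: cF.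
- by move=> x _; rewrite derive1E; case: (dF x).
Qed.

End FTC.

Section Fejer.
Context {R : realType}.
Local Notation mu := (@lebesgue_measure R).
Implicit Types (u xi : R).

(** The Fejer density times [pi]; at 0 the quotient is replaced by its limit. *)
Definition fejer u : R := (1 - cos u) / u ^+ 2 + \1_[set (0 : R)] u / 2.

Lemma fejer0 : fejer 0 = 2^-1.
Proof. by rewrite /fejer cos0 subrr mul0r add0r indicE mem_set // mul1r. Qed.

Lemma fejerE u : u != 0 -> fejer u = (1 - cos u) / u ^+ 2.
Proof.
by move=> u0; rewrite /fejer indicE memNset ?mul0r ?addr0 //=; exact/eqP.
Qed.

Lemma fejer_ge0 u : 0 <= fejer u.
Proof.
by rewrite /fejer addr_ge0 ?divr_ge0 ?sqr_ge0 ?subr_ge0 ?cos_le1.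
Qed.

Lemma fejer_le u : u != 0 -> fejer u <= 2 / u ^+ 2.
Proof.
move=> u0; rewrite fejerE // ler_wpM2r ?invr_ge0 ?sqr_ge0 //.
by have := cos_geN1 u; lra.
Qed.

Lemma fejer_ge u : `|u| <= 10^-1 -> 4 / 10 <= fejer u.
Proof.
move=> u1; have [->|u0] := eqVneq u 0; first by rewrite fejer0; lra.
have u2 : 0 < u ^+ 2 by rewrite exprn_even_gt0.
rewrite fejerE // ler_pdivlMr //.
have /cos_fourth_order : `|u| <= 1 by apply: le_trans u1 _; lra.
rewrite ler_norml => /andP[_]; have : u ^+ 4 <= 100^-1 * u ^+ 2.
  rewrite (exprM u 2 2) expr2 ler_wpM2r ?sqr_ge0 //.
  by rewrite -real_normK ?num_real //; have := normr_ge0 u; nra.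
by lra.
Qed.

Definition triangle xi : R := \1_(`[0, 1]%classic : set R) xi * (1 - xi).

Lemma triangle_ge0 xi : 0 <= triangle xi.
Proof.
rewrite /triangle indicE; case: (boolP (xi \in _)); last by rewrite mul0r.
by rewrite inE /= in_itv /= => /andP[_ x1]; rewrite mul1r subr_ge0.
Qed.

Lemma measurable_triangle : measurable_fun setT triangle.
Proof. by apply: measurable_funM; [exact: measurable_indic|exact: measurable_funB]. Qed.

Lemma integral_triangle (f : R -> R) :
  (\int[mu]_xi (triangle xi * f xi)%:E =
   \int[mu]_(xi in `[0%R, 1%R]) ((1 - xi) * f xi)%:E)%E.
Proof.
rewrite [RHS]integral_mkcond; apply: eq_integral => xi _; rewrite /patch /triangle indicE.
by case: (boolP (xi \in _)) => _; rewrite ?mul1r ?mul0r.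
Qed.

(** The Fejer kernel is the cosine transform of the triangle; the constant 1
    added to the cosine keeps the integrand nonnegative. *)
Lemma fejer_cos_transform u :
  (\int[mu]_xi (triangle xi * (1 + cos (xi * u)))%:E = (2^-1 + fejer u)%:E)%E.
Proof.
rewrite integral_triangle.
have cf : continuous (fun xi : R => (1 - xi) * (1 + cos (xi * u))).
  apply: (@is_derive_continuous R _
    (fun xi => - (1 + cos (xi * u)) + (1 - xi) * (- sin (xi * u) * u))) => x.
  by apply: is_derive_eq; rewrite /GRing.scale /=; ring.
have [uE|u0] := eqVneq u 0.
  have dF (x : R) : is_derive x (1 : R) (fun xi => 2 * xi - xi ^+ 2)
      ((1 - x) * (1 + cos (x * u))).
    by apply: is_derive_eq; rewrite /GRing.scale /= uE mulr0 cos0; ring.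
  by rewrite (integral_is_derive ltr01 cf dF) uE fejer0; congr EFin; field.
have dF (x : R) : is_derive x (1 : R) (fun xi => xi - xi ^+ 2 / 2
    + (1 - xi) * (sin (xi * u) / u) - cos (xi * u) / u ^+ 2)
    ((1 - x) * (1 + cos (x * u))).
  by apply: is_derive_eq; rewrite /GRing.scale /=; field.
rewrite (integral_is_derive ltr01 cf dF) fejerE // !mul0r !mul1r sin0 cos0.
by congr EFin; field; exact: u0.
Qed.

Lemma measurable_cosine d (T : measurableType d) (f : T -> R) :
  measurable_fun setT f -> measurable_fun setT (fun t => cos (f t)).
Proof.
move=> mf; apply: measurableT_comp mf; apply: continuous_measurable_fun.
exact: continuous_cos.
Qed.

(** Measurability comes from the integral representation, by Tonelli. *)
Lemma measurable_fejer : measurable_fun setT fejer.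
Proof.
pose f (p : R * R) : \bar R := (triangle p.2 * (1 + cos (p.2 * p.1)))%:E.
have mf : measurable_fun setT f.
  apply/measurable_EFinP; apply: measurable_funM.
    by apply: measurableT_comp measurable_triangle _; exact: measurable_snd.
  apply: measurable_funD => //; apply: measurable_cosine.
  by apply: measurable_funM; [exact: measurable_snd|exact: measurable_fst].
have f0 p : (0 <= f p)%E.
  by rewrite lee_fin mulr_ge0 ?triangle_ge0 //; have := cos_geN1 (p.2 * p.1); lra.
have := @measurable_fun_fubini_tonelli_F _ _ _ _ _ mu f mf f0.
rewrite /fubini_F /f /= => mF.
have -> : fejer = fun u => (2^-1 + fejer u) - 2^-1.
  by apply/funext => u; rewrite addrC addKr.
apply: measurable_funB => //; apply/measurable_EFinP.
apply: eq_measurable_fun mF => u _; exact: fejer_cos_transform.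
Qed.

End Fejer.

(** * Smoothing by the Fejer kernel *)

Section FejerTonelli.
Context {R : realType}.
Local Notation mu := (@lebesgue_measure R).

Definition fejer_at (b v : R) : R := fejer (b * v).

Definition tilted_mass (w X : R -> R) (theta : R) : \bar R :=
  (\int[mu]_t (w t * expR (theta * X t))%:E)%E.

Definition tilted_wave (w X : R -> R) (theta b s xi : R) : \bar R :=
  (\int[mu]_t (w t * (expR (theta * X t) * (1 + cos (xi * (b * (X t - s))))))%:E)%E.

Lemma integral_triangle_mass : (\int[mu]_xi (triangle xi)%:E = (2^-1)%:E)%E.
Proof.
have := fejer_cos_transform (0 : R); rewrite fejer0.
have -> : (\int[mu]_xi (triangle xi * (1 + cos (xi * 0)))%:E =
    \int[mu]_xi (2%:E * (triangle xi)%:E))%E.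
  by apply: eq_integral => xi _; rewrite mulr0 cos0 -EFinM mulrC.
rewrite ge0_integralZl //; last first.
- by move=> xi _; rewrite lee_fin triangle_ge0.
- by apply/measurable_EFinP; exact: measurable_triangle.
have : (0 <= \int[mu]_xi (triangle xi)%:E)%E.
  by apply: integral_ge0 => xi _; rewrite lee_fin triangle_ge0.
case: (\int[mu]_xi _)%E => [r _|_|//].
- by rewrite -EFinM => -[] h; congr EFin; lra.
- by rewrite gt0_muley // lte_fin.
Qed.

Section OneLaw.
Variables (w X : R -> R) (theta b s : R).
Hypothesis w_ge0 : forall t, 0 <= w t.
Hypothesis mw : measurable_fun setT w.
Hypothesis mX : measurable_fun setT X.

Let f (p : R * R) : \bar R := (triangle p.1 *
  (w p.2 * (expR (theta * X p.2) * (1 + cos (p.1 * (b * (X p.2 - s)))))))%:E.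

Let mf : measurable_fun setT f.
Proof.
have m1 : measurable_fun setT (fun p : R * R => p.1) by exact: measurable_fst.
have m2 : measurable_fun setT (fun p : R * R => p.2) by exact: measurable_snd.
have mX2 : measurable_fun setT (fun p : R * R => X p.2) by exact: measurableT_comp mX _.
apply/measurable_EFinP; apply: measurable_funM.
  exact: measurableT_comp measurable_triangle _.
apply: measurable_funM; first exact: measurableT_comp mw _.
apply: measurable_funM.
  by apply: measurableT_comp => //; apply: measurable_funM.
apply: measurable_funD => //; apply: measurable_cosine; apply: measurable_funM => //.
by apply: measurable_funM => //; exact: measurable_funB.
Qed.

Let cos1_ge0 (x : R) : 0 <= 1 + cos x.
Proof. by rewrite -lerBlDl sub0r cos_geN1. Qed.

Let f0 p : (0 <= f p)%E.
Proof. by rewrite lee_fin (mulr_ge0 (triangle_ge0 _)) // !mulr_ge0 ?expR_ge0 ?cos1_ge0. Qed.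

Lemma tilted_wave_ge0 xi : (0 <= tilted_wave w X theta b s xi)%E.
Proof. by apply: integral_ge0 => t _; rewrite lee_fin !mulr_ge0 ?expR_ge0 ?cos1_ge0. Qed.

Let mg xi : measurable_fun setT
  (fun t => (w t * (expR (theta * X t) * (1 + cos (xi * (b * (X t - s))))))%:E).
Proof.
apply/measurable_EFinP; apply: measurable_funM => //; apply: measurable_funM.
  by apply: measurableT_comp => //; apply: measurable_funM.
apply: measurable_funD => //; apply: measurable_cosine; apply: measurable_funM => //.
by apply: measurable_funM => //; exact: measurable_funB.
Qed.

Let fE xi : (\int[mu]_t f (xi, t) = (triangle xi)%:E * tilted_wave w X theta b s xi)%E.
Proof.
rewrite /tilted_wave -ge0_integralZl ?lee_fin ?triangle_ge0 //; first exact: mg.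
by move=> t _; rewrite lee_fin !mulr_ge0 ?expR_ge0 ?cos1_ge0.
Qed.

Lemma measurable_triangle_wave : measurable_fun setT
  (fun xi => (triangle xi)%:E * tilted_wave w X theta b s xi)%E.
Proof.
have := @measurable_fun_fubini_tonelli_F _ _ _ _ _ mu f mf f0.
by apply: eq_measurable_fun => xi _; exact: fE.
Qed.

(** A mean of the kernel only involves the tilted transform at frequencies
    in [0, b], since the cosine transform of the kernel is supported there. *)
Lemma fejer_tonelli :
  (\int[mu]_xi ((triangle xi)%:E * tilted_wave w X theta b s xi) =
   (2^-1)%:E * tilted_mass w X theta + tilted_mean w X (fejer_at b) theta s)%E.
Proof.
under eq_integral do rewrite -fE.
have mexpX : measurable_fun setT (fun t => expR (theta * X t)).
  by apply: measurableT_comp => //; apply: measurable_funM.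
pose g1 t : \bar R := (w t * expR (theta * X t))%:E.
pose g2 t : \bar R := (w t * (expR (theta * X t) * fejer_at b (X t - s)))%:E.
have mg1 : measurable_fun setT g1 by apply/measurable_EFinP; apply: measurable_funM.
have mg2 : measurable_fun setT g2.
  apply/measurable_EFinP; apply: measurable_funM => //; apply: measurable_funM => //.
  rewrite /fejer_at; apply: measurableT_comp measurable_fejer _.
  by apply: measurable_funM => //; exact: measurable_funB.
have g10 t : (0 <= g1 t)%E by rewrite lee_fin mulr_ge0 ?expR_ge0.
have g20 t : (0 <= g2 t)%E by rewrite lee_fin mulr_ge0 // mulr_ge0 ?expR_ge0 ?fejer_ge0.
have half0 : (0 <= (2^-1 : R)%:E)%E by rewrite lee_fin invr_ge0.
rewrite fubini_tonelli // /tilted_mass /tilted_mean -/g1 -/g2.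
rewrite -ge0_integralZl //.
have mhg1 : measurable_fun setT (fun t => (2^-1)%:E * g1 t)%E by exact: emeasurable_funM.
have hg10 t : (0 <= (2^-1)%:E * g1 t)%E by exact: mule_ge0.
rewrite -ge0_integralD //.
apply: eq_integral => t _; rewrite -EFinM -EFinD.
transitivity (\int[mu]_xi ((w t * expR (theta * X t))%:E *
    (triangle xi * (1 + cos (xi * (b * (X t - s)))))%:E))%E.
  by apply: eq_integral => xi _; rewrite /f /= -EFinM; congr EFin; ring.
rewrite ge0_integralZl ?lee_fin ?mulr_ge0 ?expR_ge0 //.
- by rewrite fejer_cos_transform -EFinM /fejer_at; congr EFin; ring.
- apply/measurable_EFinP; apply: measurable_funM; first exact: measurable_triangle.
  apply: measurable_funD => //; apply: measurable_cosine.
  by apply: measurable_funM.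
- by move=> xi _; rewrite lee_fin mulr_ge0 ?triangle_ge0 ?cos1_ge0.
- by move=> t _; exact: hg10.
- by move=> t _; exact: g20.
- by move=> t _; exact: g10.
Qed.

End OneLaw.

(** The inequality between the transforms is integrated against the triangle;
    the masses, which enter through the constant 1 in [1 + cos], cancel.  The
    third law carries the error of the comparison. *)
Lemma tilted_mean_compare (w1 X1 w2 X2 w3 X3 : R -> R) (theta b s s3 eps : R)
    (M1 M2 M3 : R) :
  (forall t, 0 <= w1 t) -> measurable_fun setT w1 -> measurable_fun setT X1 ->
  (forall t, 0 <= w2 t) -> measurable_fun setT w2 -> measurable_fun setT X2 ->
  (forall t, 0 <= w3 t) -> measurable_fun setT w3 -> measurable_fun setT X3 ->
  0 <= eps ->
  tilted_mass w1 X1 theta = M1%:E -> tilted_mass w2 X2 theta = M2%:E ->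
  tilted_mass w3 X3 theta = M3%:E ->
  (forall xi, 0 <= xi <= 1 ->
    (tilted_wave w1 X1 theta b s xi + (M2 + eps * M3)%:E <=
     tilted_wave w2 X2 theta b s xi + M1%:E
     + eps%:E * tilted_wave w3 X3 theta b s3 xi)%E) ->
  (tilted_mean w1 X1 (fejer_at b) theta s <=
   tilted_mean w2 X2 (fejer_at b) theta s
   + eps%:E * tilted_mean w3 X3 (fejer_at b) theta s3)%E.
Proof.
move=> w10 mw1 mX1 w20 mw2 mX2 w30 mw3 mX3 eps0 hM1 hM2 hM3 wave.
have Mge0 w X M : (forall t, 0 <= w t) -> tilted_mass w X theta = M%:E -> 0 <= M.
  move=> w0 MM; rewrite -lee_fin -MM; apply: integral_ge0 => t _.
  by rewrite lee_fin mulr_ge0 ?expR_ge0.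
have [M10 M20 M30] : [/\ 0 <= M1, 0 <= M2 & 0 <= M3].
  by split; [exact: Mge0 hM1|exact: Mge0 hM2|exact: Mge0 hM3].
have tri_cst c : 0 <= c -> (\int[mu]_xi ((triangle xi)%:E * c%:E) = (c / 2)%:E)%E.
  move=> c0; have -> : (\int[mu]_xi ((triangle xi)%:E * c%:E) =
      \int[mu]_xi (c%:E * (triangle xi)%:E))%E.
    by apply: eq_integral => xi _; rewrite muleC.
  rewrite ge0_integralZl ?integral_triangle_mass ?lee_fin //.
  - by apply/measurable_EFinP; exact: measurable_triangle.
  - by move=> xi _; rewrite lee_fin triangle_ge0.
have t0 xi : (0 <= (triangle xi)%:E)%E by rewrite lee_fin triangle_ge0.
have mtri c : measurable_fun setT (fun xi => (triangle xi)%:E * c%:E)%E.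
  by apply/measurable_EFinP; apply: measurable_funM => //; exact: measurable_triangle.
have W1 := fejer_tonelli theta b s w10 mw1 mX1.
have W2 := fejer_tonelli theta b s w20 mw2 mX2.
have W3 := fejer_tonelli theta b s3 w30 mw3 mX3.
have mW1 := measurable_triangle_wave theta b s w10 mw1 mX1.
have mW2 := measurable_triangle_wave theta b s w20 mw2 mX2.
have mW3 := measurable_triangle_wave theta b s3 w30 mw3 mX3.
pose a1 xi : \bar R := ((triangle xi)%:E * tilted_wave w1 X1 theta b s xi)%E.
pose a2 xi : \bar R := ((triangle xi)%:E * (M2 + eps * M3)%:E)%E.
pose a3 xi : \bar R := ((triangle xi)%:E * tilted_wave w2 X2 theta b s xi)%E.
pose a4 xi : \bar R := ((triangle xi)%:E * M1%:E)%E.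
pose a6 xi : \bar R := ((triangle xi)%:E * tilted_wave w3 X3 theta b s3 xi)%E.
pose a5 xi : \bar R := (eps%:E * a6 xi)%E.
have a10 xi : [set: R] xi -> (0 <= a1 xi)%E by rewrite mule_ge0 // tilted_wave_ge0.
have a20 xi : [set: R] xi -> (0 <= a2 xi)%E.
  by rewrite mule_ge0 // lee_fin addr_ge0 // mulr_ge0.
have a30 xi : [set: R] xi -> (0 <= a3 xi)%E by rewrite mule_ge0 // tilted_wave_ge0.
have a40 xi : [set: R] xi -> (0 <= a4 xi)%E by rewrite mule_ge0 // lee_fin.
have a60 xi : [set: R] xi -> (0 <= a6 xi)%E by rewrite mule_ge0 // tilted_wave_ge0.
have a50 xi : [set: R] xi -> (0 <= a5 xi)%E by move=> h; rewrite mule_ge0 ?lee_fin ?a60.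
have a120 xi : [set: R] xi -> (0 <= a1 xi + a2 xi)%E by move=> h; rewrite adde_ge0 ?a10 ?a20.
have a340 xi : [set: R] xi -> (0 <= a3 xi + a4 xi)%E by move=> h; rewrite adde_ge0 ?a30 ?a40.
have m2 : measurable_fun setT a2 by exact: mtri.
have m4 : measurable_fun setT a4 by exact: mtri.
have m5 : measurable_fun setT a5 by exact: emeasurable_funM.
have m34 : measurable_fun setT (fun xi => a3 xi + a4 xi)%E by exact: emeasurable_funD.
have key : (\int[mu]_xi (a1 xi + a2 xi) <= \int[mu]_xi ((a3 xi + a4 xi) + a5 xi))%E.
  apply: ge0_le_integral => //; [exact: emeasurable_funD|exact: emeasurable_funD|].
  move=> xi _; have [xi01|xi01] := boolP (0 <= xi <= 1).
    rewrite /a1 /a2 /a3 /a4 /a5 /a6 (muleCA eps%:E).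
    rewrite -!ge0_muleDr ?lee_fin ?tilted_wave_ge0 ?addr_ge0 ?mulr_ge0 //.
    + by apply: lee_wpmul2l; [exact: t0|exact: wave].
    + by rewrite adde_ge0 ?tilted_wave_ge0 ?lee_fin.
    + by rewrite mule_ge0 ?tilted_wave_ge0 ?lee_fin.
  have tri0 : triangle xi = 0.
    rewrite /triangle indicE memNset ?mul0r //= in_itv /=; exact/negP.
  by rewrite /a1 /a2 /a3 /a4 /a5 /a6 tri0 !mul0e mule0 !adde0.
move: key; rewrite ge0_integralD // ge0_integralD // ge0_integralD // ge0_integralZl //.
rewrite /a1 /a2 /a3 /a4 /a6 W1 W2 W3 hM1 hM2 hM3 !tri_cst ?addr_ge0 ?mulr_ge0 //.
have tm0 w X k u : (forall t, 0 <= w t) -> (forall t, 0 <= k t) -> (0 <= tilted_mean w X k theta u)%E.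
  by move=> w0 k0; apply: integral_ge0 => t _; rewrite lee_fin !mulr_ge0 ?expR_ge0.
have fb0 t : 0 <= fejer_at b t by exact: fejer_ge0.
have := tm0 _ X1 _ s w10 fb0; have := tm0 _ X2 _ s w20 fb0; have := tm0 _ X3 _ s3 w30 fb0.
move: (tilted_mean w1 _ _ _ _) (tilted_mean w2 _ _ _ _) (tilted_mean w3 _ _ _ _).
move=> p1 p2 p3 p30 p20 p10; rewrite ge0_muleDr ?lee_fin ?mulr_ge0 ?invr_ge0 //.
have : (0 <= eps%:E * p3)%E by rewrite mule_ge0 ?lee_fin.
move: (eps%:E * p3)%E => r; rewrite -!EFinM.
case: r => [r||] // r0; case: p1 p10 => [p1||] // p10; case: p2 p20 => [p2||] // p20;
  rewrite -?EFinD ?lee_fin ?leey //= => h; lra.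
Qed.

End FejerTonelli.

(** * The Gaussian characteristic function *)

Section GaussianTransform.
Context {R : realType}.
Local Notation mu := (@lebesgue_measure R).
Implicit Types (t x eta : R).

Definition gauss_pdf t : R := (Num.sqrt (2 * pi))^-1 * expR (- (t ^+ 2 / 2)).

Lemma gauss_pdf_normal : gauss_pdf = normal_pdf 0 1.
Proof.
apply/funext => t; rewrite normal_pdfE ?oner_eq0 // /normal_peak /normal_fun /gauss_pdf.
rewrite subr0 expr1n mul1r -[pi *+ 2]mulr_natl -[1 *+ 2]mulr_natl mulr1.
by congr (_ * expR _); rewrite mulNr.
Qed.

Lemma gauss_pdf_ge0 t : 0 <= gauss_pdf t.
Proof. by rewrite mulr_ge0 ?invr_ge0 ?sqrtr_ge0 ?expR_ge0. Qed.

Lemma measurable_gauss_pdf : measurable_fun setT gauss_pdf.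
Proof. by rewrite gauss_pdf_normal; exact: measurable_normal_pdf. Qed.

Lemma integral_gauss_pdf : (\int[mu]_t (gauss_pdf t)%:E = 1)%E.
Proof. by rewrite gauss_pdf_normal; exact: integral_normal_pdf. Qed.

Lemma integrable_gauss_pdf : mu.-integrable setT (EFin \o gauss_pdf).
Proof. by rewrite gauss_pdf_normal; exact: integrable_normal_pdf. Qed.

Lemma is_derive_gauss_pdf t : is_derive t (1 : R) gauss_pdf (- t * gauss_pdf t).
Proof.
rewrite /gauss_pdf; move: (Num.sqrt _)^-1 => c.
by apply: is_derive_eq; rewrite /GRing.scale /=; field.
Qed.

Lemma integrable_bounded_mul (f g : R -> R) (C : R) :
  mu.-integrable setT (EFin \o f) -> measurable_fun setT g ->
  (forall t, `|g t| <= C) -> mu.-integrable setT (EFin \o (fun t => f t * g t)).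
Proof.
move=> intf mg gC; have mf : measurable_fun setT f by case/integrableP: intf => /measurable_EFinP.
apply: (@le_integrable _ _ _ mu setT measurableT _ (fun t => C%:E * (EFin \o f) t)%E).
- by apply/measurable_EFinP; apply: measurable_funM.
- move=> t _ /=; rewrite lee_fin !normrM mulrC ler_wpM2r //.
  by apply: le_trans (gC t) _; exact: ler_norm.
- exact: integrableZl.
Qed.

(** Half of the exponent absorbs the factor [t]; the other half is the density
    of variance 2. *)
Lemma integrable_moment_gauss_pdf :
  mu.-integrable setT (EFin \o (fun t => t * gauss_pdf t)).
Proof.
pose s : R := Num.sqrt 2.
have s0 : s != 0 by rewrite gt_eqF // sqrtr_gt0.
have s2 : s ^+ 2 = 2 by rewrite sqr_sqrtr.
have mg := measurable_gauss_pdf.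
pose c := (Num.sqrt (2 * pi) : R)^-1 / normal_peak s.
apply: (@le_integrable _ _ _ mu setT measurableT _ (fun t => c%:E * (EFin \o normal_pdf 0 s) t)%E).
- by apply/measurable_EFinP; apply: measurable_funM.
- move=> t _ /=; rewrite lee_fin normal_pdfE // /normal_fun /gauss_pdf.
  have cE (e : R) : c * (normal_peak s * e) = (Num.sqrt (2 * pi))^-1 * e.
    by rewrite mulrA divfK // gt_eqF // normal_peak_gt0.
  rewrite cE subr0 s2.
  rewrite [leRHS]ger0_norm ?mulr_ge0 ?invr_ge0 ?sqrtr_ge0 ?expR_ge0 //.
  rewrite mulrCA normrM ger0_norm ?invr_ge0 ?sqrtr_ge0 // ler_wpM2l ?invr_ge0 ?sqrtr_ge0 //.
  rewrite normrM [`|expR _|]ger0_norm ?expR_ge0 //.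
  have -> : expR (- (t ^+ 2 / 2)) = expR (- (t ^+ 2 / 4)) * expR (- (t ^+ 2 / 4)).
    by rewrite -expRD; congr expR; field.
  have -> : - t ^+ 2 / (2 *+ 2) = - (t ^+ 2 / 4) by rewrite -mulr_natr; field.
  rewrite mulrA ler_piMl ?expR_ge0 // expRN ler_pdivrMr ?expR_gt0 // mul1r.
  apply: le_trans (expR_ge1Dx _); rewrite -real_normK ?num_real //.
  by have := sqr_ge0 (1 - `|t| / 2); lra.
- by apply: integrableZl => //; exact: integrable_normal_pdf.
Qed.

(** The integral over [-n, n] is a difference of boundary values, which tends
    to the integral over the line by dominated convergence. *)
Lemma integral_derivative_line (F f : R -> R) : continuous f ->
  (forall x, is_derive x (1 : R) F (f x)) ->
  mu.-integrable setT (EFin \o f) ->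
  (F n%:R - F (- n%:R)) @[n --> \oo] --> (0 : R) ->
  \int[mu]_x f x = 0.
Proof.
move=> cf dF intf lim0.
pose I n : set R := `[- n%:R, n%:R]%classic.
have mf : measurable_fun setT f by exact: continuous_measurable_fun.
have [|||||_ _ lim] := @dominated_convergence _ _ _ mu setT measurableT
  (fun n x => (\1_(I n) x * f x)%:E) (EFin \o f) (fun x => `|f x|%:E).
- move=> n; apply/measurable_EFinP; apply: measurable_funM => //.
  by apply: measurable_indic; exact: measurable_itv.
- by apply/measurable_EFinP.
- apply: aeW => x _; apply: cvg_near_cst; near=> n; rewrite /= indicE mem_set ?mul1r //.
  rewrite /I /= in_itv /= -ler_norml; near: n; exact: nbhs_infty_ger.
- by case/integrableP: intf => mf' h; apply/integrableP; split; [exact/measurable_EFinP/measurableT_comp|move: h; under eq_integral do rewrite /= normr_id].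
- apply: aeW => x n _; rewrite lee_fin normrM ler_piMl // indicE.
  by case: (x \in I n); rewrite ?normr1 ?normr0.
have lim' : (F n%:R - F (- n%:R))%:E @[n --> \oo] --> (0 : R)%:E.
  by apply: cvg_EFin => //; exact: nearW.
have E : \forall n \near \oo,
    (F n%:R - F (- n%:R))%:E = (\int[mu]_x (\1_(I n) x * f x)%:E)%E.
  near=> n; have n0 : (0 < n)%N by near: n; exact: nbhs_infty_gt.
  rewrite -(integral_is_derive _ cf dF); last by rewrite gtrN ?ltr0n.
  rewrite integral_mkcond; apply: eq_integral => x _; rewrite /patch /I indicE.
  by case: (x \in _); rewrite ?mul1r ?mul0r.
have lim'' : (\int[mu]_x (\1_(I n) x * f x)%:E)%E @[n --> \oo] --> (0 : R)%:E.
  exact: cvg_trans (near_eq_cvg E) lim'.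
have -> : (\int[mu]_x f x) = fine (\int[mu]_x (EFin \o f) x)%E by [].
by rewrite (cvg_unique _ lim lim'').
Unshelve. all: by end_near. Qed.

Definition gauss_cos eta : R := \int[mu]_t (gauss_pdf t * cos (eta * t)).

Lemma measurable_trig (g : R -> R) eta : continuous g ->
  measurable_fun setT (fun t : R => g (eta * t)).
Proof.
move=> cg; apply: measurableT_comp; first exact: continuous_measurable_fun.
exact: measurable_funM.
Qed.

Lemma integrable_gauss_pdf_cos eta :
  mu.-integrable setT (EFin \o (fun t => gauss_pdf t * cos (eta * t))).
Proof.
apply: (@integrable_bounded_mul _ _ 1 integrable_gauss_pdf).
  by apply: measurable_trig; exact: continuous_cos.
by move=> t; exact: cos_max.
Qed.

Lemma integrable_moment_gauss_pdf_sin eta :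
  mu.-integrable setT (EFin \o (fun t => (t * gauss_pdf t) * sin (eta * t))).
Proof.
apply: (@integrable_bounded_mul _ _ 1 integrable_moment_gauss_pdf).
  by apply: measurable_trig; exact: continuous_sin.
by move=> t; exact: sin_max.
Qed.

Lemma is_derive_gauss_cos eta : is_derive eta (1 : R) gauss_cos
  (- \int[mu]_t ((t * gauss_pdf t) * sin (eta * t))).
Proof.
pose f (x t : R) := gauss_pdf t * cos (x * t).
have df x t : is_derive x (1 : R) (f ^~ t) (- (t * gauss_pdf t) * sin (x * t)).
  rewrite /f; move: (gauss_pdf t) => c.
  by apply: is_derive_eq; rewrite /GRing.scale /=; ring.
have Ia : eta \in `]eta - 1, eta + 1[ by rewrite in_itv /= ltrBlDr ltrDl ltr01.
have h := @differentiation_under_integral R _ _ mu f setT measurableT eta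
  (eta - 1) (eta + 1) Ia (fun x _ => integrable_gauss_pdf_cos x)
  (fun x t _ _ => @ex_derive _ _ _ _ _ _ _ (df x t))
  (fun t => `|t * gauss_pdf t|).
have pE x t : partial1of2 f x t = - (t * gauss_pdf t) * sin (x * t).
  by rewrite partial1of2E; exact: (@derive_val _ _ _ _ _ _ _ (df x t)).
have intG : mu.-integrable setT (EFin \o (fun t : R => `|t * gauss_pdf t|)).
  exact: integrable_norm integrable_moment_gauss_pdf.
have Gub x (t : R) : (`]eta - 1, eta + 1[%classic : set R) x -> [set: R] t ->
    `|partial1of2 f x t| <= `|t * gauss_pdf t|.
  by move=> _ _; rewrite pE mulNr normrN normrM ler_piMr ?sin_max.
have hD := h (fun=> normr_ge0 _) intG Gub.
have dJ := @derivable_under_integral R _ _ mu f setT measurableT eta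
  (eta - 1) (eta + 1) Ia (fun x _ => integrable_gauss_pdf_cos x)
  (fun x t _ _ => @ex_derive _ _ _ _ _ _ _ (df x t))
  (fun t => `|t * gauss_pdf t|) (fun=> normr_ge0 _) intG Gub.
apply: DeriveDef; first exact: dJ.
rewrite -derive1E hD; under eq_Rintegral do rewrite pE mulNr -mulN1r.
by rewrite RintegralZl ?mulN1r //; exact: integrable_moment_gauss_pdf_sin.
Qed.

Lemma gauss_by_parts eta :
  \int[mu]_t ((t * gauss_pdf t) * sin (eta * t)) = eta * gauss_cos eta.
Proof.
pose F t := gauss_pdf t * sin (eta * t).
pose f t := eta * (gauss_pdf t * cos (eta * t)) - (t * gauss_pdf t) * sin (eta * t).
have dF t : is_derive t (1 : R) F (f t).
  have dg := is_derive_gauss_pdf t; rewrite /F /f.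
  by apply: is_derive_eq; rewrite /GRing.scale /=; ring.
have i1 := integrable_gauss_pdf_cos eta; have i2 := integrable_moment_gauss_pdf_sin eta.
have i3 : mu.-integrable setT (EFin \o (fun t => eta * (gauss_pdf t * cos (eta * t)))).
  by apply: (integrableZl measurableT eta i1).
have intf : mu.-integrable setT (EFin \o f) by exact: integrableB i3 i2.
have cpdf : continuous gauss_pdf by exact: is_derive_continuous is_derive_gauss_pdf.
have cf : continuous f.
  pose f' t := - eta * (t * gauss_pdf t) * cos (eta * t)
    - eta ^+ 2 * gauss_pdf t * sin (eta * t)
    - ((1 - t ^+ 2) * gauss_pdf t * sin (eta * t)
       + eta * (t * gauss_pdf t) * cos (eta * t)).
  apply: (@is_derive_continuous R _ f') => t; have dg := is_derive_gauss_pdf t.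
  by rewrite /f /f'; apply: is_derive_eq; rewrite /GRing.scale /=; ring.
have /eqP : \int[mu]_t f t = 0.
  apply: (integral_derivative_line cf dF intf).
  pose c : R := (Num.sqrt (2 * pi))^-1.
  have c0 : 0 <= c by rewrite invr_ge0 sqrtr_ge0.
  have bound (x : R) (n : nat) : `|x| = n%:R -> `|F x| <= 2 * c * harmonic n.
    move=> xn; rewrite /F normrM.
    apply: (@le_trans _ _ (gauss_pdf x * 1)).
      by rewrite ger0_norm ?gauss_pdf_ge0 // ler_wpM2l ?gauss_pdf_ge0 // sin_max.
    rewrite mulr1 /gauss_pdf -/c (_ : 2 * c * harmonic n = c * (2 * harmonic n)); last by ring.
    rewrite ler_wpM2l // expRN /harmonic /=.
    rewrite -[x ^+ 2]real_normK ?num_real // xn -[2 * _]invrK lef_pV2 ?posrE ?expR_gt0 //.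
      apply: le_trans (expR_ge1Dx _); rewrite invfM invrK (_ : n.+1%:R = n%:R + 1); last by rewrite natr1.
      by have := sqr_ge0 (n%:R - 1 : R); have := ler0n R n; lra.
  apply: norm_cvg0; apply: (@squeeze_cvgr _ _ _ _ (cst 0) (fun n => 4 * c * harmonic n)).
  - apply: nearW => n; rewrite normr_ge0 /=; apply: le_trans (ler_normB _ _) _.
    have b1 := bound n%:R n (normr_nat _ _).
    have b2 := bound (- n%:R) n; rewrite normrN in b2; have {}b2 := b2 (normr_nat _ _).
    apply: le_trans (lerD b1 b2) _; rewrite (_ : _ + _ = 4 * c * harmonic n) //; ring.
  - exact: cvg_cst.
  - by rewrite -[X in _ --> X](mulr0 (4 * c)); apply: cvgMl_tmp; exact: cvg_harmonic.
by rewrite /f RintegralB // RintegralZl // subr_eq0 => /eqP <-.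
Qed.

(** Differentiating under the integral and integrating by parts gives
    [gauss_cos^`() = - eta * gauss_cos], so the product with
    [expR (eta ^ 2 / 2)] is constant. *)
Lemma gauss_cosE eta : gauss_cos eta = expR (- (eta ^+ 2 / 2)).
Proof.
pose K x := gauss_cos x * expR (x ^+ 2 / 2).
have dK x : is_derive x (1 : R) K 0.
  have dJ := is_derive_gauss_cos x; rewrite gauss_by_parts in dJ; rewrite /K.
  by apply: is_derive_eq; rewrite /GRing.scale /=; field.
have := @is_derive_0_is_cst _ K eta 0 dK; rewrite /K expr0n mul0r expR0 mulr1.
have -> : gauss_cos 0 = 1.
  rewrite /gauss_cos /Rintegral.
  under eq_integral do rewrite mul0r cos0 mulr1.
  by rewrite integral_gauss_pdf.
move=> E; have e0 : expR (eta ^+ 2 / 2) != 0 by rewrite gt_eqF // expR_gt0.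
by apply: (mulIf e0); rewrite E expRN mulVf.
Qed.

End GaussianTransform.

(** * The Gaussian law *)

Section GaussianLaw.
Context {R : realType}.
Local Notation mu := (@lebesgue_measure R).
Local Notation phi := (@gauss_pdf R).
Implicit Types (t x y c s theta eta b xi : R).

Let cos1_ge0 x : 0 <= 1 + cos x.
Proof. by have := cos_geN1 x; lra. Qed.

Lemma gauss_pdf_tilt theta t : expR (theta * t) * phi t = expR (theta ^+ 2 / 2) * phi (t - theta).
Proof.
by rewrite /gauss_pdf [LHS]mulrCA [RHS]mulrCA -!expRD; congr (_ * expR _); field.
Qed.

Lemma gauss_pdf_le theta x :
  phi x <= (Num.sqrt (2 * pi))^-1 * expR (theta ^+ 2 / 2 - theta * x).
Proof.
rewrite /gauss_pdf ler_wpM2l ?invr_ge0 ?sqrtr_ge0 // ler_expR.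
by have := sqr_ge0 (x - theta); lra.
Qed.

Lemma gauss_tilted_mass theta :
  tilted_mass phi id theta = (expR (theta ^+ 2 / 2))%:E.
Proof.
rewrite /tilted_mass (@ge0_integral_translate _ theta) /=.
- transitivity (\int[mu]_t ((expR (theta ^+ 2 / 2))%:E * (phi t)%:E))%E.
    apply: eq_integral => t _; rewrite mulrC gauss_pdf_tilt -EFinM; congr (_ * phi _)%:E; ring.
  rewrite ge0_integralZl ?integral_gauss_pdf ?mule1 ?lee_fin ?expR_ge0 //.
  + by apply/measurable_EFinP; exact: measurable_gauss_pdf.
  + by move=> t _; rewrite lee_fin gauss_pdf_ge0.
- apply/measurable_EFinP; apply: measurable_funM; first exact: measurable_gauss_pdf.
  by apply: measurableT_comp => //; exact: measurable_funM.
- by move=> t; rewrite lee_fin mulr_ge0 ?gauss_pdf_ge0 ?expR_ge0.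
Qed.

(** Averaging over [t] and [-t] leaves only the even part of the cosine. *)
Lemma integral_gauss_pdf_cos1 eta c :
  (\int[mu]_t (phi t * (1 + cos (eta * t + c)))%:E =
   (1 + expR (- (eta ^+ 2 / 2)) * cos c)%:E)%E.
Proof.
pose g c' t : \bar R := (phi t * (1 + cos (eta * t + c')))%:E.
have mg c' : measurable_fun setT (g c').
  apply/measurable_EFinP; apply: measurable_funM; first exact: measurable_gauss_pdf.
  apply: measurable_funD => //; apply: measurable_cosine.
  by apply: measurable_funD => //; exact: measurable_funM.
have g0 c' t : (0 <= g c' t)%E.
  by rewrite lee_fin; apply: mulr_ge0; rewrite ?gauss_pdf_ge0 ?cos1_ge0.
have sym : (\int[mu]_t g c t = \int[mu]_t g (- c)%R t)%E.
  rewrite (@ge0_integral_reflect _ 0) //; apply: eq_integral => t _.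
  rewrite /g; congr EFin; rewrite sub0r; congr (_ * (1 + _)).
    by rewrite /gauss_pdf sqrrN.
  by rewrite -cosN; congr cos; ring.
have sum : (\int[mu]_t g c t + \int[mu]_t g (- c)%R t =
    (2 * (1 + expR (- (eta ^+ 2 / 2)) * cos c))%:E)%E.
  rewrite -ge0_integralD //; [|exact: mg..].
  pose h t := 2 * phi t + 2 * cos c * (phi t * cos (eta * t)).
  transitivity (\int[mu]_t (EFin \o h) t)%E.
    apply: eq_integral => t _; rewrite /g /h /= -EFinD; congr EFin; rewrite !cosD cosN sinN; ring.
  have i1 : mu.-integrable setT (EFin \o (fun t => 2 * phi t)).
    by apply: (integrableZl measurableT 2 (@integrable_gauss_pdf R)).
  have i2 : mu.-integrable setT (EFin \o (fun t => 2 * cos c * (phi t * cos (eta * t)))).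
    by apply: (integrableZl measurableT (2 * cos c) (@integrable_gauss_pdf_cos R eta)).
  have ih : mu.-integrable setT (EFin \o h) by exact: integrableD i1 i2.
  rewrite -[LHS]fineK; last exact: integrable_fin_num ih.
  have hE : Rintegral mu setT h = 2 * Rintegral mu setT phi + 2 * cos c * gauss_cos eta.
    rewrite /h (RintegralD measurableT i1 i2); congr (_ + _).
      by rewrite RintegralZl //; exact: integrable_gauss_pdf.
    by rewrite RintegralZl //; exact: integrable_gauss_pdf_cos.
  rewrite -/(Rintegral mu setT h) hE gauss_cosE.
  have -> : Rintegral mu setT phi = 1 by rewrite /Rintegral integral_gauss_pdf.
  by congr EFin; ring.
move: sum; rewrite -sym /g; move: (\int[mu]_t _)%E => [r||] //.
by rewrite -EFinD => -[] E; congr EFin; lra.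
Qed.

(** Tilting the Gaussian law by [theta] translates it by [theta]. *)
Lemma gauss_tilted_wave theta b s xi :
  tilted_wave phi id theta b s xi =
  (expR (theta ^+ 2 / 2)
   + expR ((theta ^+ 2 - (xi * b) ^+ 2) / 2) * cos (xi * b * (theta - s)))%:E.
Proof.
rewrite /tilted_wave (@ge0_integral_translate _ theta) /=.
- transitivity (\int[mu]_t ((expR (theta ^+ 2 / 2))%:E *
     (phi t * (1 + cos (xi * b * t + xi * b * (theta - s))))%:E))%E.
    apply: eq_integral => t _; rewrite mulrA (mulrC (phi _)) gauss_pdf_tilt -EFinM -mulrA.
    by congr (_ * (phi _ * (1 + cos _)))%:E; ring.
  rewrite ge0_integralZl ?lee_fin ?expR_ge0 //.
  + rewrite integral_gauss_pdf_cos1 -EFinM mulrDr mulr1 mulrA -expRD.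
    by congr (_ + expR _ * _)%:E; field.
  + apply/measurable_EFinP; apply: measurable_funM; first exact: measurable_gauss_pdf.
    apply: measurable_funD => //; apply: measurable_cosine.
    by apply: measurable_funD => //; exact: measurable_funM.
  + by move=> t _; rewrite lee_fin; apply: mulr_ge0; rewrite ?gauss_pdf_ge0 ?cos1_ge0.
- apply/measurable_EFinP; apply: measurable_funM; first exact: measurable_gauss_pdf.
  apply: measurable_funM; first by apply: measurableT_comp => //; exact: measurable_funM.
  apply: measurable_funD => //; apply: measurable_cosine.
  apply: measurable_funM => //; apply: measurable_funM => //; exact: measurable_funB.
- by move=> t; rewrite lee_fin; apply: mulr_ge0; [exact: gauss_pdf_ge0|rewrite mulr_ge0 ?expR_ge0 ?cos1_ge0].
Qed.

End GaussianLaw.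

(** * The Gaussian tail *)

Section GaussianTail.
Context {R : realType}.
Local Notation mu := (@lebesgue_measure R).
Local Notation phi := (@gauss_pdf R).
Local Notation peak := ((Num.sqrt (2 * pi))^-1 : R).
Implicit Types (t x y c theta : R).

Definition gtail c : R := fine (law_tail phi id c).

Lemma peak_gt0 : 0 < peak.
Proof. by rewrite invr_gt0 sqrtr_gt0 mulr_gt0 // pi_gt0. Qed.

Let mphi : measurable_fun setT phi := @measurable_gauss_pdf R.

Let mstep c : measurable_fun setT (fun t : R => step (t - c)).
Proof. by apply: measurableT_comp (@measurable_step R) _; exact: measurable_funB. Qed.

Let mtail c : measurable_fun setT (fun t => (phi t * step (t - c))%:E).
Proof. by apply/measurable_EFinP; exact: measurable_funM. Qed.

Let tail0 c t : (0 <= (phi t * step (t - c))%:E)%E.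
Proof. by rewrite lee_fin mulr_ge0 ?gauss_pdf_ge0 ?step_ge0. Qed.

Lemma step_le1 x : step x <= 1.
Proof. by rewrite stepE; case: (0 <= x). Qed.

Lemma gauss_law_tail c : law_tail phi id c = (gtail c)%:E.
Proof.
rewrite /gtail fineK // ge0_fin_numE; last by apply: integral_ge0.
apply: (@le_lt_trans _ _ (\int[mu]_t (phi t)%:E)%E); last by rewrite integral_gauss_pdf ltry.
apply: ge0_le_integral => //; [exact: mtail|by apply/measurable_EFinP|].
by move=> t _; rewrite lee_fin ler_piMr ?gauss_pdf_ge0 ?step_le1.
Qed.

Lemma gtail_ge0 c : 0 <= gtail c.
Proof. by rewrite -lee_fin -gauss_law_tail; apply: integral_ge0. Qed.

Lemma gtail_le1 c : gtail c <= 1.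
Proof.
rewrite -lee_fin -gauss_law_tail -integral_gauss_pdf.
apply: ge0_le_integral => //; [exact: mtail|by apply/measurable_EFinP|].
by move=> t _; rewrite lee_fin ler_piMr ?gauss_pdf_ge0 ?step_le1.
Qed.

Lemma gtail_anti c d : c <= d -> gtail d <= gtail c.
Proof.
move=> cd; rewrite -lee_fin -!gauss_law_tail; apply: ge0_le_integral => //; [exact: mtail..|].
move=> t _; rewrite lee_fin ler_wpM2l ?gauss_pdf_ge0 // !stepE !subr_ge0.
by case: (leP d t) => [dt|_]; rewrite ?(le_trans cd dt) ?ler0n.
Qed.

Lemma gauss_tailE y : gauss_tail y = gtail y.
Proof.
rewrite /gauss_tail /gtail /Rintegral.
have -> : law_tail phi id y = (peak%:E * \int[mu]_(u in `[y, +oo[) (expR (- (u ^+ 2 / 2)))%:E)%E.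
  rewrite -ge0_integralZl //.
  - rewrite integral_mkcond; apply: eq_integral => t _; rewrite /patch stepE subr_ge0.
    by rewrite mem_setE in_itv /= andbT /gauss_pdf; case: ifP; rewrite ?mulr1 ?mulr0.
  - apply/measurable_EFinP; apply: measurable_funTS; apply: measurableT_comp => //.
    by apply: measurableT_comp => //; apply: measurable_funM => //; exact: measurable_funX.
have : (0 <= \int[mu]_(u in `[y, +oo[) (expR (- (u ^+ 2 / 2)))%:E)%E.
  by apply: integral_ge0 => t _; rewrite lee_fin expR_ge0.
case: (\int[mu]_(u in _) _)%E => [r|_|] //= .
by rewrite gt0_muley ?lte_fin ?peak_gt0 //= mulr0.
Qed.

Lemma gtail_reflect c : 1 <= gtail (- c) + gtail c.
Proof.
pose g t : \bar R := (phi t * step (c - t))%:E.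
have mg : measurable_fun setT g.
  apply/measurable_EFinP; apply: measurable_funM => //.
  by apply: measurableT_comp (@measurable_step R) _; exact: measurable_funB.
have g0 t : (0 <= g t)%E by rewrite lee_fin mulr_ge0 ?gauss_pdf_ge0 ?step_ge0.
have E : law_tail phi id (- c) = (\int[mu]_t g t)%E.
  rewrite /law_tail [LHS](@ge0_integral_reflect _ 0) //.
  apply: eq_integral => t _; rewrite /g /gauss_pdf sub0r sqrrN opprK addrC.
  by [].
rewrite -lee_fin EFinD -!gauss_law_tail -integral_gauss_pdf E /law_tail.
rewrite -ge0_integralD //; last exact: mtail.
apply: ge0_le_integral => //.
- by move=> t _; rewrite lee_fin gauss_pdf_ge0.
- by apply/measurable_EFinP.
- by apply: emeasurable_funD => //; exact: mtail.
move=> t _; rewrite /g -EFinD lee_fin -mulrDr ler_peMr ?gauss_pdf_ge0 // !stepE !subr_ge0.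
by case: (leP c t) => h; [rewrite lerDr ler0n|rewrite (ltW h) addr0].
Qed.

Lemma integral_step_expR theta : 0 < theta ->
  (\int[mu]_v (step v * expR (- (theta * v)))%:E = (theta^-1)%:E)%E.
Proof.
move=> t0.
have -> : (\int[mu]_v (step v * expR (- (theta * v)))%:E =
    \int[mu]_(v in `[0%R, +oo[) (expR (- (theta * v)))%:E)%E.
  rewrite [RHS]integral_mkcond; apply: eq_integral => v _; rewrite /patch stepE.
  by rewrite mem_setE in_itv /= andbT; case: ifP; rewrite ?mul1r ?mul0r.
have dF (v : R) : is_derive v (1 : R) (fun v => - (theta^-1 * expR (- (theta * v))))
    (expR (- (theta * v))).
  by apply: is_derive_eq; rewrite /GRing.scale /=; field; rewrite gt_eqF.
have cf : continuous (fun v : R => expR (- (theta * v))).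
  apply: (@is_derive_continuous R _ (fun v => - theta * expR (- (theta * v)))) => v.
  by apply: is_derive_eq; rewrite /GRing.scale /=; ring.
have cF := is_derive_continuous dF.
rewrite (@ge0_continuous_FTC2y _ _ (fun v => - (theta^-1 * expR (- (theta * v)))) 0 0).
- by rewrite mulr0 oppr0 expR0 mulr1 sub0e -EFinN opprK.
- by move=> v _; exact: expR_ge0.
- exact: continuous_subspaceT.
- have lim : expR (- (theta * v)) @[v --> +oo] --> (0 : R).
    apply: (@cvg_comp _ _ _ (fun v : R => theta * v) (fun x : R => expR (- x)) _ +oo).
      by apply: gt0_cvgMry => //; exact: cvg_id.
    exact: cvgr_expR.
  by rewrite -[X in _ --> X]oppr0 -[X in - X](mulr0 theta^-1); apply: cvgN; apply: cvgMl_tmp.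
- by move=> v _; case: (dF v).
- by apply: cvg_at_right_filter; exact: cF.
- by move=> v _; rewrite derive1E; case: (dF v).
Qed.

(** Exponential Markov inequality, with the factor [1 / theta] gained from
    [expR (- theta * v)]. *)
Lemma gtail_expR_le theta c : 0 < theta ->
  gtail c <= theta^-1 * (peak * expR (theta ^+ 2 / 2 - theta * c)).
Proof.
move=> t0; rewrite -lee_fin -gauss_law_tail /law_tail (@ge0_integral_translate _ c) //.
set K := peak * _; rewrite mulrC EFinM -integral_step_expR // -ge0_integralZl //.
- apply: ge0_le_integral => //.
  + apply/measurable_EFinP; apply: measurable_funM.
      by apply: measurableT_comp => //; exact: measurable_funD.
    apply: measurableT_comp (@measurable_step R) _.
    by apply: measurable_funB => //; exact: measurable_funD.
  + apply/measurable_EFinP; apply: measurable_funM => //; apply: measurable_funM => //.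
      exact: measurable_step.
    by do 2 (apply: measurableT_comp => //); exact: measurable_funM.
  move=> v _; rewrite addrK -EFinM lee_fin mulrC [leRHS]mulrCA ler_wpM2l ?step_ge0 //.
  apply: le_trans (gauss_pdf_le theta _) _; rewrite /K -[leRHS]mulrA -expRD.
  by rewrite ler_wpM2l ?(ltW peak_gt0) // ler_expR; lra.
- apply/measurable_EFinP; apply: measurable_funM; first exact: measurable_step.
  by do 2 (apply: measurableT_comp => //); exact: measurable_funM.
- by move=> v _; rewrite lee_fin mulr_ge0 ?step_ge0 ?expR_ge0.
- by rewrite lee_fin mulr_ge0 ?expR_ge0 ?(ltW peak_gt0).
Qed.

(** On [c, c + u] the density is at most its tilted majorant at [c]. *)
Lemma gtail_lipschitz theta c u : 0 <= theta -> 0 <= u ->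
  gtail c <= gtail (c + u) + u * (peak * expR (theta ^+ 2 / 2 - theta * c)).
Proof.
move=> t0 u0; set K := peak * _.
have K0 : 0 <= K by rewrite mulr_ge0 ?expR_ge0 ?(ltW peak_gt0).
have mI : measurable_fun setT (fun t => (K * \1_(`[c, (c + u)]%classic : set R) t)%:E).
  by apply/measurable_EFinP; apply: measurable_funM => //; exact: measurable_indic.
rewrite -lee_fin EFinD -!gauss_law_tail.
have -> : ((u * K)%:E = \int[mu]_t (K * \1_(`[c, (c + u)]%classic : set R) t)%:E)%E.
  transitivity (\int[mu]_t (K%:E * (\1_(`[c, (c + u)]%classic : set R) t)%:E))%E; last first.
    by apply: eq_integral.
  rewrite ge0_integralZl ?lee_fin //.
  - rewrite integral_indic //= setIT lebesgue_measure_itv /= lte_fin ltrDl.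
    case: ltP => h; first by rewrite -EFinD -EFinM addrC addKr mulrC.
    by rewrite (_ : u = 0) ?mul0r ?mule0 //; apply/eqP; rewrite eq_le h.
  - by apply/measurable_EFinP; exact: measurable_indic.
rewrite -ge0_integralD //.
- apply: ge0_le_integral => //.
  + exact: mtail.
  + by apply: emeasurable_funD => //; exact: mtail.
  move=> t _; rewrite -EFinD lee_fin !stepE indicE mem_setE in_itv /=.
  have hK : c <= t -> phi t <= K.
    move=> ct; apply: le_trans (gauss_pdf_le theta t) _.
    rewrite ler_wpM2l ?(ltW peak_gt0) // ler_expR lerD2l lerN2.
    exact: ler_wpM2l.
  have p0 := gauss_pdf_ge0 t.
  rewrite !subr_ge0; case: (leP c t) => ct; last by rewrite mulr0 addr_ge0 // mulr_ge0.
  case: (leP (c + u) t) => cut /=; first by rewrite lerDl mulr_ge0.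
  by rewrite (ltW cut) !mulr1 mulr0 add0r hK.
- exact: mtail.
- by move=> t _; rewrite lee_fin mulr_ge0.
Qed.

(** Mills' lower bound: [- t / (1 + t ^ 2) * phi t] has a derivative below [phi]. *)
Lemma gtail_mills x : 1 <= x -> x / (1 + x ^+ 2) * phi x <= gtail x.
Proof.
move=> x1; pose F (t : R) := - (t / (1 + t ^+ 2) * phi t).
pose f t := (1 - 2 / (1 + t ^+ 2) ^+ 2) * phi t.
have d0 t : 1 + t ^+ 2 != 0 by rewrite gt_eqF // ltr_pwDl // sqr_ge0.
have dF t : is_derive t (1 : R) F (f t).
  have dphi := is_derive_gauss_pdf t; have dt := d0 t; rewrite /F /f.
  by apply: is_derive_eq; rewrite /GRing.scale /=; field.
have f0 t : x <= t -> 0 <= f t.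
  move=> xt; rewrite mulr_ge0 ?gauss_pdf_ge0 // subr_ge0 ler_pdivrMr ?mul1r.
    by have t1 := le_trans x1 xt; have : 1 <= t ^+ 2 by [rewrite exprn_ege1]; nra.
  by rewrite exprn_gt0 // ltr_pwDl // sqr_ge0.
have cphi : continuous phi by exact: is_derive_continuous (@is_derive_gauss_pdf R).
have cf : continuous f.
  pose f' t := 8 * t / (1 + t ^+ 2) ^+ 3 * phi t
     - t * (1 - 2 / (1 + t ^+ 2) ^+ 2) * phi t.
  apply: (@is_derive_continuous R _ f') => t.
  have dphi := is_derive_gauss_pdf t; have dt := d0 t; rewrite /f /f'.
  have dt2 : (1 + t ^+ 2) ^+ 2 != 0 by rewrite expf_neq0.
  by apply: is_derive_eq; rewrite /GRing.scale /=; field.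
have limF : F t @[t --> +oo] --> (0 : R).
  pose c := peak * expR (1 ^+ 2 / 2) : R.
  have lim : c * expR (- t) @[t --> +oo] --> (0 : R).
    by rewrite -[X in _ --> X](mulr0 c); apply: cvgMl_tmp; exact: cvgr_expR.
  apply: norm_cvg0; apply: (@squeeze_cvgr _ _ _ _ (cst 0) (fun t => c * expR (- t))) => //.
    apply: nearW => t; rewrite normr_ge0 /= /F normrN normrM.
    rewrite (ger0_norm (gauss_pdf_ge0 t)); apply: (@le_trans _ _ (1 * phi t)).
      rewrite ler_wpM2r ?gauss_pdf_ge0 // normrM normfV.
      have p0 : 0 < 1 + t ^+ 2 by rewrite ltr_pwDl // sqr_ge0.
      rewrite (gtr0_norm p0) ler_pdivrMr // mul1r -[t ^+ 2]real_normK ?num_real //.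
      by have := sqr_ge0 (`|t| - 2^-1); lra.
    rewrite mul1r; apply: le_trans (gauss_pdf_le 1 t) _.
    by rewrite /c -mulrA -expRD mul1r.
  exact: cvg_cst.
have E : (\int[mu]_(t in `[x, +oo[) (f t)%:E = 0%:E - (F x)%:E)%E.
  apply: (@ge0_continuous_FTC2y _ f F x 0) => //.
  - exact: continuous_subspaceT.
  - by apply: cvg_at_right_filter; exact: is_derive_continuous dF x.
  - by move=> t _; rewrite derive1E; case: (dF t).
rewrite -EFinB sub0r opprK in E; rewrite -lee_fin -gauss_law_tail -E.
rewrite integral_mkcond; apply: ge0_le_integral => //.
- move=> t _; rewrite /patch mem_setE in_itv /= andbT; case: ifP => // xt.
  by rewrite lee_fin f0.
- apply/(measurable_restrictT _ _).1 => //; apply: measurable_funTS.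
  by apply/measurable_EFinP; exact: continuous_measurable_fun.
- exact: mtail.
move=> t _; rewrite /patch mem_setE in_itv /= andbT stepE subr_ge0; case: ifP => xt.
  rewrite lee_fin mulr1 /f ler_piMl ?gauss_pdf_ge0 // gerBl divr_ge0 //.
  by rewrite exprn_ge0 // addr_ge0 // sqr_ge0.
by rewrite mulr0.
Qed.

End GaussianTail.

(** * Removing the smoothing *)

Section FejerMass.
Context {R : realType}.
Local Notation mu := (@lebesgue_measure R).
Implicit Types (b h v : R).

Definition outside h v : R := 1 - \1_(`[- h, h]%classic : set R) v.

Lemma outsideE h v : outside h v = (h < `|v|)%R%:R.
Proof.
rewrite /outside indicE mem_setE in_itv /= -ler_norml ltNge.
by case: (`|v| <= h); rewrite ?subrr ?subr0.
Qed.

Lemma measurable_outside h : measurable_fun setT (outside h).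
Proof. by apply: measurable_funB => //; exact: measurable_indic. Qed.

Lemma fejer_le1 (u : R) : fejer u <= 1.
Proof.
have [->|u0] := eqVneq u 0; first by rewrite fejer0; lra.
have u2 : 0 < u ^+ 2 by rewrite exprn_even_gt0.
by rewrite fejerE // ler_pdivrMr //; have := cos_ge u; lra.
Qed.

Lemma measurable_fejer_at b : measurable_fun setT (fejer_at b).
Proof.
by rewrite /fejer_at; apply: measurableT_comp (@measurable_fejer R) _; exact: measurable_funM.
Qed.

Let cauchy h v : R := (v ^+ 2 + h ^+ 2)^-1.

Let integral_step_cauchy h : 0 < h ->
  (\int[mu]_v (step v * cauchy h v)%:E = (pi / 2 / h)%:E)%E.
Proof.
move=> h0.
have -> : (\int[mu]_v (step v * cauchy h v)%:E =
    \int[mu]_(v in `[0%R, +oo[) (cauchy h v)%:E)%E.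
  rewrite [RHS]integral_mkcond; apply: eq_integral => v _; rewrite /patch stepE.
  by rewrite mem_setE in_itv /= andbT; case: ifP; rewrite ?mul1r ?mul0r.
have p0 v : v ^+ 2 + h ^+ 2 != 0 by rewrite gt_eqF // ltr_wpDl ?sqr_ge0 ?exprn_gt0.
pose F v : R := atan (v / h) / h.
have hn : h != 0 by rewrite gt_eqF.
have dF v : is_derive v (1 : R) F (cauchy h v).
  have q0 : 1 + (v / h) ^+ 2 != 0 by rewrite gt_eqF // ltr_pwDl // sqr_ge0.
  rewrite /F; apply: is_derive_eq; rewrite /GRing.scale /= /cauchy.
  by have := p0 v; move=> ?; field; rewrite hn /= p0.
have dC v : is_derive v (1 : R) (cauchy h) (- 2 * v * (cauchy h v) ^+ 2).
  have := p0 v => pv; rewrite /cauchy; apply: is_derive_eq; rewrite /GRing.scale /=.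
  by field.
rewrite (@ge0_continuous_FTC2y _ (cauchy h) F 0 (pi / 2 / h)).
- by rewrite /F mul0r atan0 mul0r sube0.
- by move=> v _; rewrite invr_ge0 addr_ge0 // sqr_ge0.
- exact/continuous_subspaceT/(is_derive_continuous dC).
- rewrite /F; apply: cvgMr_tmp.
  apply: (@cvg_comp _ _ _ (fun v : R => v / h) (@atan R) _ +oo); last exact: cvgy_atan.
  by apply: gt0_cvgMly; [rewrite invr_gt0|exact: cvg_id].
- by move=> v _; case: (dF v).
- by apply: cvg_at_right_filter; exact: (is_derive_continuous dF).
- by move=> v _; rewrite derive1E; case: (dF v).
Qed.

(** Off the window the kernel is below [4 / b ^ 2] times the Cauchy kernel of
    scale [h], whose integral is an arctangent. *)
Lemma fejer_outside_mass b h : 0 < b -> 0 < h ->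
  (\int[mu]_v (fejer_at b v * outside h v)%:E <= (16 / (b ^+ 2 * h))%:E)%E.
Proof.
move=> b0 h0.
have mc : measurable_fun setT (fun v => (step v * cauchy h v)%:E).
  have -> : cauchy h = fun v => (h ^- 2) * (1 + (v / h) ^+ 2)^-1.
    apply/funext => v; rewrite /cauchy -invfM mulrDr mulr1 expr_div_n mulrCA divff ?mulr1 1?addrC //.
    by rewrite expf_neq0 // gt_eqF.
  apply/measurable_EFinP; apply: measurable_funM; first exact: measurable_step.
  apply: measurable_funM => //.
  apply: (@measurableT_comp _ _ _ _ _ _ (fun x : R => (1 + x ^+ 2)^-1)).
    by apply: continuous_measurable_fun; exact: continuous_oneDsqrV.
  exact: measurable_funM.
have c0 v : 0 <= cauchy h v by rewrite invr_ge0 addr_ge0 // sqr_ge0.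
have sc0 v : (0 <= (step v * cauchy h v)%:E)%E by rewrite lee_fin mulr_ge0 ?step_ge0.
have I1 := integral_step_cauchy h0.
have I2 : (\int[mu]_v (step (0 - v) * cauchy h (0 - v))%:E = (pi / 2 / h)%:E)%E.
  by rewrite -I1 [RHS](@ge0_integral_reflect _ 0).
have mc2 : measurable_fun setT (fun v => (step (0 - v) * cauchy h (0 - v))%:E).
  by apply: measurableT_comp mc _; exact: measurable_funB.
have -> : ((16 / (b ^+ 2 * h))%:E =
  (4 / b ^+ 2)%:E * ((2 / h)%:E + (2 / h)%:E))%E.
  by rewrite -EFinD -EFinM; congr EFin; field; rewrite !gt_eqF.
apply: (@le_trans _ _ (\int[mu]_v ((4 / b ^+ 2)%:E *
   ((step v * cauchy h v)%:E + (step (0 - v) * cauchy h (0 - v))%:E)))%E); last first.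
  rewrite ge0_integralZl //; last 3 first.
  - exact: emeasurable_funD.
  - by move=> v _; rewrite adde_ge0.
  - by rewrite lee_fin divr_ge0 // sqr_ge0.
  rewrite lee_wpmul2l ?lee_fin ?divr_ge0 ?sqr_ge0 // ge0_integralD //.
  rewrite I1 I2 -!EFinD lee_fin.
  have : pi / 2 / h <= 2 / h by rewrite ler_wpM2r ?invr_ge0 ?(ltW h0) // ltW // pihalf_lt2.
  by lra.
apply: ge0_le_integral => //.
- by move=> v _; rewrite lee_fin mulr_ge0 ?fejer_ge0 // outsideE ler0n.
- apply/measurable_EFinP; apply: measurable_funM; first exact: measurable_fejer_at.
  exact: measurable_outside.
- by apply: emeasurable_funM => //; exact: emeasurable_funD.
move=> v _; rewrite -EFinD -EFinM lee_fin outsideE; case: ltP => hv; last first.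
  rewrite mulr0; apply: mulr_ge0; first by rewrite divr_ge0 ?sqr_ge0.
  by apply: addr_ge0; apply: mulr_ge0; rewrite ?step_ge0 ?c0.
have v0 : v != 0 by rewrite -normr_gt0 (lt_trans h0).
rewrite mulr1 /fejer_at; apply: le_trans (fejer_le _) _; first by rewrite mulf_neq0 // gt_eqF.
have -> : cauchy h (0 - v) = cauchy h v by rewrite /cauchy sub0r sqrrN.
have s1 : 1 <= step v + step (0 - v).
  by rewrite !stepE sub0r oppr_ge0; case: (leP 0 v) => h1; rewrite ?lerDl ?ler0n // (ltW h1) add0r.
rewrite -mulrDl; apply: (@le_trans _ _ (4 / b ^+ 2 * (1 * cauchy h v))); last first.
  by rewrite ler_wpM2l ?divr_ge0 ?sqr_ge0 // ler_wpM2r.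
have v2 : 0 < v ^+ 2 by rewrite exprn_even_gt0.
have hv2 : h ^+ 2 <= v ^+ 2.
  by rewrite -[leRHS]real_normK ?num_real // lerXn2r ?nnegrE ?(ltW h0) ?(ltW hv).
rewrite mul1r exprMn invfM mulrA -mulrA [leRHS](_ : _ = 2 * b ^- 2 * (2 * cauchy h v)); last by rewrite /cauchy; ring.
rewrite mulrA ler_wpM2l ?mulr_ge0 ?invr_ge0 ?sqr_ge0 //.
have p0 : 0 < v ^+ 2 + h ^+ 2 by rewrite ltr_wpDr // sqr_ge0.
by rewrite /cauchy (ler_pdivlMr _ _ p0) mulrC (ler_pdivrMr _ _ v2); lra.
Qed.

Definition fejer_mass b : R := fine (\int[mu]_v (fejer_at b v)%:E).

Lemma fejer_massE b : 0 < b -> (\int[mu]_v (fejer_at b v)%:E = (fejer_mass b)%:E)%E.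
Proof.
move=> b0; rewrite /fejer_mass fineK // ge0_fin_numE; last first.
  by apply: integral_ge0 => v _; rewrite lee_fin fejer_ge0.
have mI : measurable_fun setT (fun v => (\1_(`[(- 1), 1]%classic : set R) v : R)%:E).
  by apply/measurable_EFinP; exact: measurable_indic.
have mo : measurable_fun setT (fun v => (fejer_at b v * outside 1 v)%:E).
  apply/measurable_EFinP; apply: measurable_funM; first exact: measurable_fejer_at.
  exact: measurable_outside.
have o0 v : (0 <= (fejer_at b v * outside 1 v)%:E)%E.
  by rewrite lee_fin mulr_ge0 ?fejer_ge0 // outsideE ler0n.
apply: (@le_lt_trans _ _ (\int[mu]_v ((\1_(`[(- 1), 1]%classic : set R) v : R)%:E
    + (fejer_at b v * outside 1 v)%:E))%E).
  apply: ge0_le_integral => //.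
  - by move=> v _; rewrite lee_fin fejer_ge0.
  - by apply/measurable_EFinP; exact: measurable_fejer_at.
  - exact: emeasurable_funD.
  move=> v _; rewrite -EFinD lee_fin /outside mulrBr mulr1 addrCA lerDl.
  by rewrite -{1}[\1__ v]mul1r -mulrBl mulr_ge0 ?subr_ge0 ?fejer_le1 // indicE ler0n.
rewrite ge0_integralD //.
have := @fejer_outside_mass b 1 b0 ltr01.
have : (0 <= \int[mu]_v (fejer_at b v * outside 1 v)%:E)%E by apply: integral_ge0.
rewrite integral_indic //= setIT lebesgue_measure_itv /= lte_fin.
case: ifP => _; case: (\int[mu]_v _)%E => //= r _ _; rewrite ?add0e ?ltry // -EFinD ltry //.
Qed.

(** On [|v| <= 1 / (10 b)] the kernel is at least 4/10. *)
Lemma fejer_mass_ge b : 0 < b -> 2 / (25 * b) <= fejer_mass b.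
Proof.
move=> b0; rewrite -lee_fin -fejer_massE //.
have w0 : - (10 * b)^-1 < (10 * b)^-1 by rewrite gtrN // invr_gt0 mulr_gt0.
apply: (@le_trans _ _ (\int[mu]_v ((4 / 10)%:E *
  (\1_(`[- (10 * b)^-1, (10 * b)^-1]%classic : set R) v : R)%:E))%E).
  rewrite ge0_integralZl ?lee_fin //; last first.
    by apply/measurable_EFinP; exact: measurable_indic.
  rewrite integral_indic //= setIT lebesgue_measure_itv /= lte_fin w0 -EFinD -EFinM lee_fin.
  by rewrite le_eqVlt; apply/orP; left; apply/eqP; field; rewrite gt_eqF.
apply: ge0_le_integral => //.
- apply/measurable_EFinP; apply: measurable_funM => //; exact: measurable_indic.
- by apply/measurable_EFinP; exact: measurable_fejer_at.
move=> v _; rewrite -EFinM lee_fin indicE mem_setE in_itv /= -ler_norml.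
case: (leP `|v| (10 * b)^-1) => hv; last by rewrite mulr0 fejer_ge0.
rewrite mulr1 /fejer_at fejer_ge // normrM (gtr0_norm b0).
move: hv; rewrite -(ler_pM2l b0) => /le_trans; apply.
by rewrite le_eqVlt; apply/orP; left; apply/eqP; field; rewrite gt_eqF.
Qed.

Lemma fejer_outside_le b h : 0 < b -> 0 < h ->
  (\int[mu]_v (fejer_at b v * outside h v)%:E <= (200 / (b * h) * fejer_mass b)%:E)%E.
Proof.
move=> b0 h0; apply: le_trans (fejer_outside_mass b0 h0) _; rewrite lee_fin.
have := fejer_mass_ge b0; move: (fejer_mass b) => N hN.
apply: (@le_trans _ _ (200 / (b * h) * (2 / (25 * b)))).
  by rewrite le_eqVlt; apply/orP; left; apply/eqP; field; rewrite !gt_eqF.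
apply: ler_wpM2l => //; apply: mulr_ge0; first exact: ler0n.
by rewrite invr_ge0 mulr_ge0 // ltW.
Qed.

End FejerMass.

Section Tauberian.
Context {R : realType}.
Local Notation mu := (@lebesgue_measure R).

Section OneTail.
Variables (k T : R -> R) (theta N : R).
Hypothesis k_ge0 : forall v, 0 <= k v.
Hypothesis mk : measurable_fun setT k.
Hypothesis T_ge0 : forall c, 0 <= T c.
Hypothesis T_anti : forall c d, c <= d -> T d <= T c.
Hypothesis theta_gt0 : 0 < theta.
Hypothesis massk : (\int[mu]_v (k v)%:E = N%:E)%E.
Variables (h delta : R).
Hypothesis outk : (\int[mu]_v (k v * outside h v)%:E <= (delta * N)%:E)%E.

Let mT : measurable_fun setT T.
Proof. by apply: nonincreasing_measurable => // c d _ _; exact: T_anti. Qed.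

Let mU s : measurable_fun setT (fun c => (expR (theta * c) * k (c - s) * T c)%:E).
Proof.
apply/measurable_EFinP; apply: measurable_funM => //; apply: measurable_funM.
  by apply: measurableT_comp => //; exact: measurable_funM.
by apply: measurableT_comp mk _; exact: measurable_funB.
Qed.

Let U0 s c : (0 <= (expR (theta * c) * k (c - s) * T c)%:E)%E.
Proof. by rewrite lee_fin !mulr_ge0 ?expR_ge0. Qed.

Let mo : measurable_fun setT (fun v => (k v * outside h v)%:E).
Proof.
by apply/measurable_EFinP; apply: measurable_funM => //; exact: measurable_outside.
Qed.

Let o0 v : (0 <= (k v * outside h v)%:E)%E.
Proof. by rewrite lee_fin mulr_ge0 // outsideE ler0n. Qed.

Let mUs (s : R) : measurable_fun setT
  (fun v : R => (expR (theta * (v + s)) * k (v + s - s) * T (v + s))%:E).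
Proof. by apply: measurableT_comp (mU s) _; exact: measurable_funD. Qed.

Let mo' (A : R) : measurable_fun setT (fun v => A%:E * (k v * outside h v)%:E)%E.
Proof. exact: emeasurable_funM. Qed.

Let o0' (A : R) : 0 <= A -> forall v, (0 <= A%:E * (k v * outside h v)%:E)%E.
Proof. by move=> A0 v; apply: mule_ge0; [rewrite lee_fin|exact: o0]. Qed.

Let mk' : measurable_fun setT (fun v => (k v)%:E).
Proof. exact/measurable_EFinP. Qed.

Let k0 v : (0 <= (k v)%:E)%E. Proof. by rewrite lee_fin. Qed.

Let mkA (A : R) : measurable_fun setT (fun v => A%:E * (k v)%:E)%E.
Proof. exact: emeasurable_funM. Qed.

Let k0A (A : R) : 0 <= A -> forall v, (0 <= A%:E * (k v)%:E)%E.
Proof. by move=> A0 v; rewrite mule_ge0 ?lee_fin. Qed.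

(** Only [c] within [h] of [s] is kept; there the tail is at least [T (s + h)]. *)
Lemma smoothed_ge s :
  ((expR (theta * (s - h)) * T (s + h) * ((1 - delta) * N))%:E <=
   \int[mu]_c (expR (theta * c) * k (c - s) * T c)%:E)%E.
Proof.
set A := expR _ * T _.
have A0 : 0 <= A by rewrite mulr_ge0 ?expR_ge0.
have U1 : (A%:E * \int[mu]_v (k v)%:E <=
    \int[mu]_c (expR (theta * c) * k (c - s) * T c)%:E
    + A%:E * \int[mu]_v (k v * outside h v)%:E)%E.
  rewrite (@ge0_integral_translate _ s (fun c => (expR (theta * c) * k (c - s) * T c)%:E)) //.
  rewrite -!ge0_integralZl ?lee_fin // -(ge0_integralD mu measurableT (fun (v : R) _ => U0 s (v + s))
    (mUs s) (fun (v : R) _ => o0' A0 v) (mo' A)).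
  apply: ge0_le_integral => //; first by move=> v _; rewrite mule_ge0 ?lee_fin.
  + exact: emeasurable_funM.
  + by apply: emeasurable_funD; [exact: mUs|exact: mo'].
  move=> v _; rewrite -!EFinM -EFinD lee_fin addrK outsideE.
  case: ltP => hv; first by rewrite mulr1 lerDr !mulr_ge0 ?expR_ge0.
  rewrite !mulr0 addr0 [leRHS]mulrAC ler_wpM2r //.
  move: hv; rewrite ler_norml => /andP[v1 v2]; rewrite /A ler_pM ?expR_ge0 //.
    by rewrite ler_expR ler_pM2l //; lra.
  by apply: T_anti; lra.
move: U1; rewrite massk; have := outk.
have : (0 <= \int[mu]_v (k v * outside h v)%:E)%E by apply: integral_ge0.
case: (\int[mu]_v (k v * _)%:E)%E => [r||] //; rewrite !lee_fin => r0 rd.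
have : (0 <= \int[mu]_c (expR (theta * c) * k (c - s) * T c)%:E)%E by apply: integral_ge0.
case: (\int[mu]_c _)%E => [u||] //; last by rewrite !leey.
rewrite -!EFinM -EFinD !lee_fin => u0 hu.
have : A * r <= A * (delta * N) by rewrite ler_wpM2l.
by move: hu; lra.
Qed.

(** Off the window only the a priori bound [Gamma] is available. *)
Lemma smoothed_le s (Gamma : R) : (forall c, expR (theta * c) * T c <= Gamma) ->
  (\int[mu]_c (expR (theta * c) * k (c - s) * T c)%:E <=
   (expR (theta * (s + h)) * T (s - h) * N + Gamma * (delta * N))%:E)%E.
Proof.
move=> TG; set A := expR _ * T _.
have A0 : 0 <= A by rewrite mulr_ge0 ?expR_ge0.
have G0 : 0 <= Gamma by apply: le_trans (TG 0); rewrite mulr_ge0 ?expR_ge0.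
apply: (@le_trans _ _ (A%:E * \int[mu]_v (k v)%:E
    + Gamma%:E * \int[mu]_v (k v * outside h v)%:E)%E); last first.
  by rewrite massk EFinD EFinM leeD2l // EFinM lee_wpmul2l ?lee_fin.
rewrite (@ge0_integral_translate _ s (fun c => (expR (theta * c) * k (c - s) * T c)%:E)) //.
rewrite -!ge0_integralZl ?lee_fin //.
rewrite -(ge0_integralD mu measurableT (fun (v : R) _ => k0A A0 v) (mkA A) (fun (v : R) _ => o0' G0 v) (mo' Gamma)).
apply: ge0_le_integral => //.
- exact: mUs.
- by apply: emeasurable_funD; [exact: mkA|exact: mo'].
move=> v _; rewrite -!EFinM -EFinD lee_fin addrK outsideE [leLHS]mulrAC.
case: ltP => hv; last first.
  rewrite !mulr0 addr0 ler_wpM2r //.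
  move: hv; rewrite ler_norml => /andP[v1 v2]; rewrite /A ler_pM ?expR_ge0 //.
    by rewrite ler_expR ler_pM2l //; lra.
  by apply: T_anti; lra.
rewrite mulr1; apply: (@le_trans _ _ (Gamma * k v)); first by rewrite ler_wpM2r.
by rewrite lerDr mulr_ge0.
Qed.

End OneTail.

End Tauberian.

(** * From Laplace transforms to tails *)

Section TailComparison.
Context {R : realType}.
Local Notation mu := (@lebesgue_measure R).
Local Notation phi := (@gauss_pdf R).
Local Notation peak := ((Num.sqrt (2 * pi))^-1 : R).

Lemma measurable_tilted_mean (w X k : R -> R) theta :
  (forall t, 0 <= w t) -> measurable_fun setT w -> measurable_fun setT X ->
  (forall v, 0 <= k v) -> measurable_fun setT k ->
  measurable_fun setT (tilted_mean w X k theta).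
Proof.
move=> w0 mw mX k0 mk.
pose f (p : R * R) : \bar R := (w p.2 * (expR (theta * X p.2) * k (X p.2 - p.1)))%:E.
have mf : measurable_fun setT f.
  have m1 : measurable_fun setT (fun p : R * R => p.1) by exact: measurable_fst.
  have mX2 : measurable_fun setT (fun p : R * R => X p.2).
    by apply: measurableT_comp mX _; exact: measurable_snd.
  apply/measurable_EFinP; apply: measurable_funM.
    by apply: measurableT_comp mw _; exact: measurable_snd.
  apply: measurable_funM; first by apply: measurableT_comp => //; exact: measurable_funM.
  by apply: measurableT_comp mk _; exact: measurable_funB.
have f0 p : (0 <= f p)%E by rewrite lee_fin !mulr_ge0 ?expR_ge0.
exact: (@measurable_fun_fubini_tonelli_F _ _ _ _ _ mu f mf f0).
Qed.

Lemma tilted_mean_ge0 (w X k : R -> R) theta s :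
  (forall t, 0 <= w t) -> (forall v, 0 <= k v) -> (0 <= tilted_mean w X k theta s)%E.
Proof.
by move=> w0 k0; apply: integral_ge0 => t _; rewrite lee_fin !mulr_ge0 ?expR_ge0.
Qed.

(** By [smoothed_tailE], integrating against [expR (- theta * v)] on the half
    line; this gains the factor [1 / theta]. *)
Lemma smoothed_tail_compare (w1 X1 w2 X2 k : R -> R) (theta C : R) : 0 < theta -> 0 <= C ->
  (forall t, 0 <= w1 t) -> measurable_fun setT w1 -> measurable_fun setT X1 ->
  (forall t, 0 <= w2 t) -> measurable_fun setT w2 -> measurable_fun setT X2 ->
  (forall v, 0 <= k v) -> measurable_fun setT k ->
  (forall s, (tilted_mean w1 X1 k theta s <= tilted_mean w2 X2 k theta s + C%:E)%E) ->
  forall s, (smoothed_tail w1 X1 k theta s <=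
             smoothed_tail w2 X2 k theta s + (C / theta)%:E)%E.
Proof.
move=> t0 C0 w10 mw1 mX1 w20 mw2 mX2 k0 mk cmp s.
rewrite !smoothed_tailE //.
pose e v : \bar R := (step v * expR (- (theta * v)))%:E.
have me : measurable_fun setT e.
  apply/measurable_EFinP; apply: measurable_funM; first exact: measurable_step.
  by do 2 (apply: measurableT_comp => //); exact: measurable_funM.
have e0 v : (0 <= e v)%E by rewrite lee_fin mulr_ge0 ?step_ge0 ?expR_ge0.
have mtm (w X : R -> R) : (forall t, 0 <= w t) -> measurable_fun setT w -> measurable_fun setT X ->
    measurable_fun setT (fun v => e v * tilted_mean w X k theta (s + v)%R)%E.
  move=> w0 mw mX; apply: emeasurable_funM => //.
  have mm := measurable_tilted_mean theta w0 mw mX k0 mk.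
  by apply: measurableT_comp mm _; exact: measurable_funD.
have tm0 (w X : R -> R) (v : R) : (forall t, 0 <= w t) -> (0 <= e v * tilted_mean w X k theta (s + v)%R)%E.
  by move=> w0; apply: mule_ge0 => //; exact: tilted_mean_ge0.
have Ce : (\int[mu]_v (e v * C%:E) = (C / theta)%:E)%E.
  transitivity (\int[mu]_v (C%:E * e v))%E; first by apply: eq_integral => v _; rewrite muleC.
  by rewrite ge0_integralZl // integral_step_expR // EFinM.
have mC : measurable_fun setT (fun v => e v * C%:E)%E by exact: emeasurable_funM.
have C0' v : (0 <= e v * C%:E)%E by apply: mule_ge0; [exact: e0|rewrite lee_fin].
rewrite -Ce -(ge0_integralD mu measurableT (fun (v : R) _ => tm0 w2 X2 v w20)
  (mtm w2 X2 w20 mw2 mX2) (fun v _ => C0' v) mC).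
apply: ge0_le_integral => //.
- by move=> v _; exact: tm0.
- exact: mtm.
- by apply: emeasurable_funD => //; exact: mtm.
move=> v _; rewrite -ge0_muleDr ?lee_fin ?tilted_mean_ge0 //.
by apply: lee_wpmul2l; [exact: e0|exact: cmp].
Qed.

(** The Gaussian tail at [c] is at most [gauss_scale theta * expR (- theta * c)]. *)
Definition gauss_scale (theta : R) : R := theta^-1 * (peak * expR (theta ^+ 2 / 2)).

(** Up to the factor [expR (theta ^ 2 / 2)], the tilted Gaussian density is at
    most its peak value. *)
Lemma gauss_tilted_mean_le (k : R -> R) (theta s N : R) :
  (forall v, 0 <= k v) -> measurable_fun setT k -> (\int[mu]_v (k v)%:E = N%:E)%E ->
  (tilted_mean phi id k theta s <= (peak * expR (theta ^+ 2 / 2) * N)%:E)%E.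
Proof.
move=> k0 mk massk; rewrite /tilted_mean EFinM -massk.
have mphi := @measurable_gauss_pdf R.
have A0 : 0 <= peak * expR (theta ^+ 2 / 2) by rewrite mulr_ge0 ?expR_ge0 ?(ltW peak_gt0).
rewrite (@ge0_integral_translate _ (- s) (fun v => (k v)%:E)) ?lee_fin //; last first.
  by apply/measurable_EFinP.
have mks : measurable_fun setT (fun v : R => (k (v + - s))%:E).
  by apply/measurable_EFinP; apply: measurableT_comp mk _; exact: measurable_funD.
rewrite -ge0_integralZl ?lee_fin //; last by move=> v _; rewrite lee_fin.
apply: ge0_le_integral => //.
- by move=> t _; rewrite lee_fin !mulr_ge0 ?expR_ge0 ?gauss_pdf_ge0.
- apply/measurable_EFinP; apply: measurable_funM => //; apply: measurable_funM.
    by apply: measurableT_comp => //; exact: measurable_funM.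
  by apply: measurableT_comp mk _; exact: measurable_funB.
- exact: emeasurable_funM.
move=> t _; rewrite -EFinM lee_fin mulrA ler_wpM2r // mulrC gauss_pdf_tilt mulrC.
rewrite ler_wpM2r ?expR_ge0 // /gauss_pdf ler_piMr ?(ltW peak_gt0) //.
by rewrite expR_le1 oppr_le0 divr_ge0 // sqr_ge0.
Qed.

(** If the tilted transforms of a law agree with the Gaussian ones up to the
    relative error [tau], on a band of width [b] large compared with the tilt,
    then the tails agree up to a multiple of [tau], on the scale
    [gauss_scale theta * expR (- theta * y)] of the Gaussian tail at [theta]. *)
Lemma tail_compare (w X TP : R -> R) (theta b tau M y : R) :
  (forall t, 0 <= w t) -> measurable_fun setT w -> measurable_fun setT X ->
  0 < theta -> 0 < tau -> tau <= 8^-1 -> 200 * theta / tau ^+ 2 <= b ->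
  (forall c, law_tail w X c = (TP c)%:E) ->
  tilted_mass w X theta = M%:E ->
  (forall s xi, 0 <= xi <= 1 -> exists2 C : R,
     tilted_wave w X theta b s xi = (M + C)%:E &
     `|C - expR ((theta ^+ 2 - (xi * b) ^+ 2) / 2) * cos (xi * b * (theta - s))|
       <= tau * expR ((theta ^+ 2 - (xi * b) ^+ 2) / 2)) ->
  `|TP y - gtail y| <= 324 * tau * (gauss_scale theta * expR (- (theta * y))).
Proof.
move=> w0 mw mX t0 tau0 tau8 hb hTP hM wave.
have b0 : 0 < b.
  apply: lt_le_trans hb; apply: divr_gt0; last exact: exprn_gt0.
  by apply: mulr_gt0 => //; rewrite ltr0n.
pose k := @fejer_at R b; have k0 v : 0 <= k v by exact: fejer_ge0.
have mk : measurable_fun setT k by exact: measurable_fejer_at.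
pose N := @fejer_mass R b; have massk := fejer_massE b0; rewrite -/k -/N in massk.
have N0 : 0 < N by apply: lt_le_trans (fejer_mass_ge b0); rewrite divr_gt0 // mulr_gt0.
have mphi := @measurable_gauss_pdf R; have phi0 := @gauss_pdf_ge0 R.
have mid : measurable_fun setT (@id R) by exact: measurable_id.
pose G := expR (theta ^+ 2 / 2).
have hG : tilted_mass phi id theta = G%:E by exact: gauss_tilted_mass.
pose Gamma := gauss_scale theta.
have Gam0 : 0 < Gamma by rewrite !mulr_gt0 ?invr_gt0 ?expR_gt0 ?sqrtr_gt0 ?mulr_gt0 ?pi_gt0.
have e3 s xi : tilted_wave phi id theta b s xi =
   (G + expR ((theta ^+ 2 - (xi * b) ^+ 2) / 2) * cos (xi * b * (theta - s)))%:E.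
  exact: gauss_tilted_wave.
have e3t xi : tilted_wave phi id theta b theta xi =
   (G + expR ((theta ^+ 2 - (xi * b) ^+ 2) / 2))%:E.
  by rewrite e3 subrr mulr0 cos0 mulr1.
have tmG : (tilted_mean phi id k theta theta <= (theta * Gamma * N)%:E)%E.
  have := gauss_tilted_mean_le theta theta k0 mk massk.
  by rewrite /Gamma /gauss_scale mulVKf // gt_eqF.
(* The third law is the Gaussian one centred at its tilted mean [theta], where
   the cosine is 1; there its transform times [tau] is the bound on the error. *)
have step1 s : (tilted_mean w X k theta s <=
    tilted_mean phi id k theta s + (tau * (theta * Gamma * N))%:E)%E.
  apply: le_trans (@tilted_mean_compare R w X phi id phi id theta b s theta tau M G G
    w0 mw mX phi0 mphi mid phi0 mphi mid (ltW tau0) hM hG hG _) _.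
    move=> xi xi01; have [C -> hC] := wave s xi xi01; rewrite e3 e3t -EFinM -!EFinD lee_fin.
    by move: hC; rewrite ler_norml => /andP[_]; lra.
  by rewrite leeD2l // EFinM lee_wpmul2l ?lee_fin ?(ltW tau0).
have step2 s : (tilted_mean phi id k theta s <=
    tilted_mean w X k theta s + (tau * (theta * Gamma * N))%:E)%E.
  apply: le_trans (@tilted_mean_compare R phi id w X phi id theta b s theta tau G M G
    phi0 mphi mid w0 mw mX phi0 mphi mid (ltW tau0) hG hM hG _) _.
    move=> xi xi01; have [C -> hC] := wave s xi xi01; rewrite e3 e3t -EFinM -!EFinD lee_fin.
    by move: hC; rewrite ler_norml => /andP[+ _]; lra.
  by rewrite leeD2l // EFinM lee_wpmul2l ?lee_fin ?(ltW tau0).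
have C0 : 0 <= tau * (theta * Gamma * N) by apply: ltW; apply: mulr_gt0 => //; apply: mulr_gt0 => //; apply: mulr_gt0.
have CE : tau * (theta * Gamma * N) / theta = tau * Gamma * N by field; rewrite gt_eqF.
have U1 := smoothed_tail_compare t0 C0 w0 mw mX phi0 mphi mid k0 mk step1.
have U2 := smoothed_tail_compare t0 C0 phi0 mphi mid w0 mw mX k0 mk step2.
rewrite CE in U1 U2.
have UP s : smoothed_tail w X k theta s =
    (\int[mu]_c (expR (theta * c) * k (c - s) * TP c)%:E)%E.
  by apply: eq_integral => c _; rewrite hTP.
have UQ s : smoothed_tail phi id k theta s =
    (\int[mu]_c (expR (theta * c) * k (c - s) * gtail c)%:E)%E.
  by apply: eq_integral => c _; rewrite gauss_law_tail.
have TP0 c : 0 <= TP c.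
  by rewrite -lee_fin -hTP; apply: integral_ge0 => t _; rewrite lee_fin mulr_ge0 ?step_ge0.
have TPa c d : c <= d -> TP d <= TP c.
  move=> cd; rewrite -lee_fin -!hTP.
  have ms z : measurable_fun setT (fun t => (w t * step (X t - z))%:E).
    apply/measurable_EFinP; apply: measurable_funM => //.
    by apply: measurableT_comp (@measurable_step R) _; exact: measurable_funB.
  apply: ge0_le_integral => //; [|exact: ms..|].
    by move=> t _; rewrite lee_fin mulr_ge0 ?step_ge0.
  move=> t _; rewrite lee_fin ler_wpM2l // !stepE !subr_ge0.
  by case: (leP d (X t)) => [dX|_]; rewrite ?(le_trans cd dX) ?ler0n.
have Qbound c : expR (theta * c) * gtail c <= Gamma.
  have := gtail_expR_le c t0; rewrite expRD mulrA.
  rewrite -(ler_pM2l (expR_gt0 (theta * c))) => /le_trans; apply.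
  rewrite /Gamma /gauss_scale !mulrA expRN le_eqVlt; apply/orP; left; apply/eqP.
  by field; rewrite !gt_eqF ?expR_gt0 // sqrtr_gt0 mulr_gt0 // pi_gt0.
(* Two windows: [1 / theta] for an a priori bound of the right order on [TP],
   and [h], across which the tilt varies only by the factor [expR tau]. *)
pose h := tau / theta; have h0 : 0 < h by rewrite divr_gt0.
have th0 : 0 < theta^-1 by rewrite invr_gt0.
have hb2 : 200 * theta <= b * tau ^+ 2 by rewrite -ler_pdivrMr ?exprn_gt0.
have tau2 : tau ^+ 2 <= 2^-1 by rewrite expr2; nra.
have out1 := fejer_outside_le b0 th0; rewrite -/k -/N in out1.
have {}out1 : (\int[mu]_v (k v * outside theta^-1 v)%:E <= (2^-1 * N)%:E)%E.
  apply: le_trans out1 _; rewrite lee_fin ler_wpM2r ?(ltW N0) //.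
  have bt0 : 0 < b * theta^-1 by rewrite mulr_gt0.
  rewrite ler_pdivrMr // -(ler_pM2r t0); apply: le_trans hb2 _.
  have -> : 2^-1 * (b * theta^-1) * theta = b * 2^-1 by field; rewrite gt_eqF.
  by rewrite ler_pM2l.
have out := fejer_outside_le b0 h0; rewrite -/k -/N in out.
have {}out : (\int[mu]_v (k v * outside h v)%:E <= (tau * N)%:E)%E.
  apply: le_trans out _; rewrite lee_fin ler_wpM2r ?(ltW N0) //.
  have bh0 : 0 < b * h by rewrite mulr_gt0.
  rewrite ler_pdivrMr // -(ler_pM2r t0); apply: le_trans hb2 _.
  by rewrite /h le_eqVlt; apply/orP; left; apply/eqP; field; rewrite gt_eqF.
pose u := expR (2 * tau).
have [u1 u4] : 1 <= u /\ u <= 1 + 4 * tau.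
  have h2 : `|2 * tau| <= 2^-1.
    by rewrite ger0_norm; move: tau0 tau8; clear; lra.
  split; first by rewrite /u -[leLHS]expR0 ler_expR mulr_ge0 // ltW.
  have := expR_second_order h2; rewrite -/u ler_norml => /andP[_].
  by move: tau0 tau8; clear; nra.
have shift (x c : R) : expR (theta * (x + c)) = expR (theta * x) * expR (theta * c).
  by rewrite mulrDr expRD.
have hE : expR (theta * (h + h)) = u by rewrite /u /h; congr expR; field; rewrite gt_eqF.
have hEN : expR (theta * (- h - h)) = u^-1 by rewrite -opprD mulrN expRN hE.
have e16 : 16^-1 <= expR (theta * (- theta^-1 - theta^-1)).
  rewrite -opprD mulrN expRN mulrDr divff ?gt_eqF // lef_pV2 ?posrE ?expR_gt0 //.
  have : expR (2^-1 : R) <= 2.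
    have := @expR_second_order R 2^-1; rewrite ger0_norm // => /(_ (lexx _)).
    by rewrite ler_norml => /andP[_]; lra.
  have -> : expR (1 + 1 : R) = expR 2^-1 ^+ 4 by rewrite !exprS expr0 mulr1 -!expRD; congr expR; field.
  have -> : 16 = 2 ^+ 4 :> R by ring.
  by move=> h2; rewrite lerXn2r ?nnegrE ?expR_ge0.
have hiQ s := smoothed_le k0 mk (@gtail_ge0 R) (@gtail_anti R) t0 massk out s Qbound.
(* The a priori bound that [smoothed_le] needs for [TP]. *)
have crude c : expR (theta * c) * TP c <= 64 * Gamma.
  have lo := smoothed_ge k0 mk TP0 TPa t0 massk out1 (c - theta^-1).
  move: U1 => /(_ (c - theta^-1)); rewrite UP UQ => U1.
  have := le_trans lo (le_trans U1 (leeD2r (tau * Gamma * N)%:E (hiQ (c - theta^-1)))).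
  rewrite -!EFinD lee_fin subrK.
  have -> : expR (theta * (c - theta^-1 + h)) =
      expR (theta * (c - theta^-1 - h)) * u.
    by rewrite -hE -shift; congr (expR (_ * _)); ring.
  have := Qbound (c - theta^-1 - h).
  have -> : c - theta^-1 - theta^-1 = c + (- theta^-1 - theta^-1) by ring.
  rewrite (shift c (- theta^-1 - theta^-1)); move: e16; set e2 := expR (theta * (- _ - _)) => e16.
  set Z := expR (theta * (c - theta^-1 - h)); set g := gtail _ => ZG big.
  have X0 : 0 <= expR (theta * c) * TP c by rewrite mulr_ge0 ?expR_ge0.
  move: X0 big; set p := expR _ * TP c => X0.
  have -> : expR (theta * c) * e2 * TP c * ((1 - 2^-1) * N) = (e2 * p / 2) * N.
    by rewrite /p; field.
  have -> : Z * u * g * N + Gamma * (tau * N) + tau * Gamma * N =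
      (u * (Z * g) + 2 * (tau * Gamma)) * N by ring.
  rewrite ler_pM2r // => big.
  have f1 : 16^-1 * p <= e2 * p by rewrite ler_wpM2r.
  have f2 : u * (Z * g) <= u * Gamma by rewrite ler_pM2l // (lt_le_trans ltr01).
  have f3 : u * Gamma <= 3 / 2 * Gamma by rewrite ler_pM2r //; move: u4 tau8; clear; lra.
  have f4 : tau * Gamma <= 8^-1 * Gamma by rewrite ler_pM2r.
  by move: f1 f2 f3 f4 big Gam0; clear; lra.
(* The sandwich: the two tails are compared at arguments shifted by [2 * h]. *)
have lo1 := smoothed_ge k0 mk TP0 TPa t0 massk out (y - h).
have lo2 := smoothed_ge k0 mk (@gtail_ge0 R) (@gtail_anti R) t0 massk out (y + h).
have hi2 := smoothed_le k0 mk TP0 TPa t0 massk out (y + h) crude.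
move: U1 U2 => /(_ (y - h)) U1 /(_ (y + h)) U2; rewrite UP UQ in U1; rewrite UP UQ in U2.
have {lo1 hiQ} := le_trans lo1 (le_trans U1 (leeD2r (tau * Gamma * N)%:E (hiQ (y - h)))).
have {lo2 hi2} := le_trans lo2 (le_trans U2 (leeD2r (tau * Gamma * N)%:E hi2)).
rewrite -!EFinD !lee_fin subrK addrK -!addrA !(shift y) hE hEN.
have E0 := expR_gt0 (theta * y); pose E := expR (theta * y); rewrite -/E in E0 *.
have GE : peak * expR (theta ^+ 2 / 2 - theta * y) = theta * Gamma / E.
  by rewrite /Gamma /gauss_scale mulVKf ?gt_eqF // expRD expRN /E; ring.
(* The shift by [2 * h] costs [2 * tau * Gamma / E] in the Gaussian tail. *)
have lip1 := gtail_lipschitz y (ltW t0) (addr_ge0 (ltW h0) (ltW h0)); rewrite GE in lip1.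
have lip2 := gtail_lipschitz (y + (- h - h)) (ltW t0) (addr_ge0 (ltW h0) (ltW h0)).
have GE2 : peak * expR (theta ^+ 2 / 2 - theta * (y + (- h - h))) = theta * Gamma / E * u.
  rewrite -GE -hE -[RHS]mulrA -expRD; congr (_ * expR _); ring.
rewrite GE2 in lip2; have yE : y + (- h - h) + (h + h) = y by ring.
rewrite yE in lip2; have hh : (h + h) * (theta * Gamma / E) = 2 * (tau * Gamma) / E.
  by rewrite /h; field; rewrite !gt_eqF.
rewrite hh in lip1; rewrite [(h + h) * _]mulrA hh in lip2.
have pb := crude y; have qb := Qbound y; rewrite -/E in pb qb.
have p0 : 0 <= E * TP y by rewrite mulr_ge0 // ltW.
have q0 : 0 <= E * gtail y by rewrite mulr_ge0 ?gtail_ge0 // ltW.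
have lip1' : E * gtail y <= E * gtail (y + (h + h)) + 2 * (tau * Gamma).
  by move: lip1; rewrite -(ler_pM2l E0) mulrDr => /le_trans; apply; rewrite lerD2l mulrCA divff ?mulr1 ?gt_eqF.
have lip2' : E * gtail (y + (- h - h)) <= E * gtail y + 2 * (tau * Gamma) * u.
  move: lip2; rewrite -(ler_pM2l E0) mulrDr => /le_trans; apply; rewrite lerD2l.
  by rewrite le_eqVlt; apply/orP; left; apply/eqP; field; rewrite gt_eqF.
set g1 := gtail (y + (h + h)) in lip1' *; set g2 := gtail (y + _) in lip2' *.
have u0 : 0 < u by apply: lt_le_trans u1.
have -> : E * g1 * ((1 - tau) * N) = ((1 - tau) * (E * g1)) * N by ring.
have -> : E * u * TP y * N + (64 * Gamma * (tau * N) + tau * Gamma * N) =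
  (u * (E * TP y) + 65 * (tau * Gamma)) * N by ring.
have -> : E / u * TP y * ((1 - tau) * N) = ((1 - tau) * (E * TP y) / u) * N by ring.
have -> : E * g2 * N + (Gamma * (tau * N) + tau * Gamma * N) =
  (E * g2 + 2 * (tau * Gamma)) * N by ring.
rewrite !ler_pM2r // ler_pdivrMr // => low up.
rewrite expRN -/Gamma -/E mulrA ler_pdivlMr // -{1}(gtr0_norm E0) -normrM mulrBl.
move: pb qb p0 q0 lip1' lip2' low up.
rewrite (mulrC (TP y)) (mulrC (gtail y)).
set p := E * TP y; set q := E * gtail y; set x1 := E * g1; set x2 := E * g2.
set G' := tau * Gamma => pb qb p0 q0 lip1' lip2' low up.
have G'0 : 0 <= G' by rewrite mulr_ge0 // ltW.
have tp : tau * p <= 64 * G' by rewrite /G' [leRHS]mulrCA ler_pM2l.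
have tq : tau * q <= G' by rewrite /G' ler_pM2l.
have up4 : (u - 1) * p <= 4 * (tau * p).
  by rewrite mulrA ler_wpM2r //; move: u4; clear; lra.
have uq4 : (u - 1) * q <= 4 * (tau * q).
  by rewrite mulrA ler_wpM2r //; move: u4; clear; lra.
have u32 : u <= 3 / 2 by move: u4 tau8; clear; lra.
have uG : u * G' <= 3 / 2 * G' by rewrite ler_wpM2r.
have uuG : u * (u * G') <= 3 / 2 * (3 / 2 * G').
  by rewrite ler_pM // ?mulr_ge0 // ltW.
have tx : (1 - tau) * (q - 2 * G') <= (1 - tau) * x1.
  by rewrite ler_wpM2l ?subr_ge0; move: lip1' tau8; clear; lra.
have tG : 0 <= tau * G' by rewrite mulr_ge0 // ltW.
have ux2 : (x2 + 2 * G') * u <= (q + 2 * G' * u + 2 * G') * u.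
  by rewrite ler_pM2r //; move: lip2'; clear; lra.
rewrite -/Gamma (_ : 324 * tau * Gamma = 324 * G'); last by rewrite /G'; ring.
rewrite ler_norml; apply/andP; split.
  by move: tp tq up4 tx low tG G'0; clear; lra.
by move: tp tq uq4 uG uuG ux2 up G'0; clear; lra.
Qed.

End TailComparison.

(** * The law of a step function on dyadic cells *)

Section DyadicLaw.
Local Open Scope complex_scope.
Context {R : realType}.
Local Notation mu := (@lebesgue_measure R).
Variables (N : nat) (x : nat -> R).

Definition unit_density (t : R) : R := \1_(`[0, 1[%classic : set R) t.

Definition dyadic_step (t : R) : R :=
  \sum_(0 <= j < 2 ^ N) x j * \1_(dyadic_cell N j) t.

Implicit Types (t : R) (i j : nat).

Let p0 : 0 < 2 ^+ N :> R. Proof. exact: exprn_gt0. Qed.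

Lemma dyadic_cellE j (t : R) :
  dyadic_cell N j t = (j%:R <= t * 2 ^+ N < j.+1%:R) :> Prop.
Proof.
by rewrite /dyadic_cell /= in_itv /= ler_pdivrMr // ltr_pdivlMr.
Qed.

Lemma dyadic_cell_inj i j t : dyadic_cell N i t -> dyadic_cell N j t -> i = j.
Proof.
rewrite !dyadic_cellE => /andP[i1 i2] /andP[j1 j2]; apply/eqP.
have := le_lt_trans i1 j2; have := le_lt_trans j1 i2; rewrite !ltr_nat !ltnS.
by move=> h1 h2; rewrite eqn_leq h1 h2.
Qed.

Lemma dyadic_cell_cover t : 0 <= t < 1 -> exists2 j, (j < 2 ^ N)%N & dyadic_cell N j t.
Proof.
move=> /andP[t0 t1].
have y0 : 0 <= t * 2 ^+ N by rewrite mulr_ge0 // ltW.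
have f0 : (0 <= Num.floor (t * 2 ^+ N)) by rewrite floor_ge0.
have fE : (`|Num.floor (t * 2 ^+ N)|%N)%:R = (Num.floor (t * 2 ^+ N))%:~R :> R.
  by rewrite -{2}(gez0_abs f0).
have fl := floor_le_tmp (t * 2 ^+ N); have fu := floorD1_gt (t * 2 ^+ N).
rewrite rmorphD /= mulr1z in fu.
exists `|Num.floor (t * 2 ^+ N)|%N.
  rewrite -(ltr_nat R) fE natrX; apply: le_lt_trans fl _.
  by rewrite gtr_pMl.
by rewrite dyadic_cellE -(natr1 `|_|%N) fE; apply/andP.
Qed.

Lemma dyadic_cell_unit j t : (j < 2 ^ N)%N -> dyadic_cell N j t -> 0 <= t < 1.
Proof.
rewrite dyadic_cellE => jN /andP[h1 h2]; apply/andP; split.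
  by rewrite -(pmulr_lge0 _ p0); apply: le_trans h1.
rewrite -(ltr_pM2r p0) mul1r; apply: lt_le_trans h2 _.
by rewrite -natrX ler_nat.
Qed.

Lemma sum_dyadic_cell (F : nat -> R) j t : (j < 2 ^ N)%N -> dyadic_cell N j t ->
  \sum_(0 <= i < 2 ^ N) F i * \1_(dyadic_cell N i) t = F j.
Proof.
move=> jN tj; rewrite (bigD1_seq j) ?iota_uniq ?mem_index_iota //=.
rewrite indicE mem_set // mulr1 big1 ?addr0 // => i ij.
rewrite indicE memNset ?mulr0 // => ti; case/eqP: ij; exact: dyadic_cell_inj ti tj.
Qed.

Lemma measurable_unit_density : measurable_fun setT unit_density.
Proof. exact: measurable_indic. Qed.

Lemma measurable_dyadic_step : measurable_fun setT dyadic_step.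
Proof.
apply: measurable_sum => j; apply: measurable_funM => //.
by apply: measurable_indic; exact: measurable_itv.
Qed.

Lemma dyadic_law_pointwise (G : R -> R) t :
  unit_density t * G (dyadic_step t) =
  \sum_(0 <= j < 2 ^ N) G (x j) * \1_(dyadic_cell N j) t.
Proof.
rewrite /unit_density indicE; case: (boolP (0 <= t < 1)) => t01.
  have [j jN tj] := dyadic_cell_cover t01.
  rewrite (sum_dyadic_cell (fun i => G (x i)) jN tj) /dyadic_step (sum_dyadic_cell x jN tj).
  by rewrite mem_set ?mul1r //= in_itv.
rewrite memNset ?mul0r; last by rewrite /= in_itv /=; exact/negP.
rewrite big_nat_cond big1 // => j; rewrite andbT => /andP[_ jN].
by rewrite indicE memNset ?mulr0 // => tj; rewrite (dyadic_cell_unit jN tj) in t01.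
Qed.

Lemma dyadic_law_integral (G : R -> R) : (forall y, 0 <= G y) ->
  (\int[mu]_t (unit_density t * G (dyadic_step t))%:E =
   ((2 ^+ N)^-1 * \sum_(0 <= j < 2 ^ N) G (x j))%:E)%E.
Proof.
move=> G0.
transitivity (\int[mu]_t (\sum_(0 <= j < 2 ^ N) (G (x j) * \1_(dyadic_cell N j) t)%:E))%E.
  by apply: eq_integral => t _; rewrite dyadic_law_pointwise sumEFin.
have mI j : measurable_fun setT (fun t => (\1_(dyadic_cell N j) t : R)%:E).
  by apply/measurable_EFinP; apply: measurable_indic; exact: measurable_itv.
rewrite ge0_integral_sum //; last 2 first.
- move=> j; apply/measurable_EFinP; apply: measurable_funM => //.
  by apply/measurable_EFinP; exact: mI.
- by move=> j t _; rewrite lee_fin mulr_ge0 // indicE ler0n.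
rewrite big_distrr /= -sumEFin; apply: eq_bigr => j _.
transitivity (\int[mu]_t ((G (x j))%:E * (\1_(dyadic_cell N j) t : R)%:E))%E.
  by apply: eq_integral.
rewrite ge0_integralZl //; try (by rewrite lee_fin); try (by move=> t _; rewrite lee_fin indicE ler0n); try exact: mI.
rewrite integral_indic //= ?setIT; last exact: measurable_itv.
rewrite /dyadic_cell lebesgue_measure_itv /= lte_fin ltr_pM2r ?invr_gt0 // ltr_nat ltnSn.
rewrite -EFinD -EFinM; congr EFin; rewrite -mulrBl -natr1 addrC addKr mul1r; exact: mulrC.
Qed.

(** Replacing [t] by a point of its cell changes the level set of a function
    that is constant on cells only at the endpoint [1]. *)
Lemma dyadic_level_measure (f : R -> R) (y : R) :
  (forall j t, (j < 2 ^ N)%N -> dyadic_cell N j t -> f t = x j) ->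
  fine (mu [set t | 0 <= t <= 1 /\ y <= f t]) =
  (2 ^+ N)^-1 * \sum_(0 <= j < 2 ^ N) step (x j - y).
Proof.
move=> fx.
pose g t := unit_density t * step (dyadic_step t - y).
have mg : measurable_fun setT g.
  apply: measurable_funM; first exact: measurable_unit_density.
  apply: measurableT_comp (@measurable_step R) _; apply: measurable_funB => //.
  exact: measurable_dyadic_step.
pose E := [set t : R | 0 <= t <= 1 /\ y <= f t].
pose E' := g @^-1` [set 1].
have mE' : measurable E' by rewrite -[E']setTI; apply: mg => //; exact: measurable_set1.
have inE' t : E' t <-> 0 <= t < 1 /\ y <= f t.
  rewrite /E' /= /g /unit_density indicE stepE subr_ge0.
  case: (boolP (0 <= t < 1)) => t01; last first.
    rewrite memNset ?mul0r; last by rewrite /= in_itv /=; exact/negP.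
    by split=> [/eqP|[]//]; rewrite eq_sym oner_eq0.
  rewrite mem_set /= ?in_itv //= mul1r; have [j jN tj] := dyadic_cell_cover t01.
  rewrite /dyadic_step (sum_dyadic_cell x jN tj) (fx j t jN tj).
  by case: (y <= x j); split=> //= [/eqP|[]//]; rewrite eq_sym oner_eq0.
have muE' : mu E' = ((2 ^+ N)^-1 * \sum_(0 <= j < 2 ^ N) step (x j - y))%:E.
  rewrite -(dyadic_law_integral (G := fun z => step (z - y))); last by move=> z; exact: step_ge0.
  rewrite -[E']setIT -integral_indic //; apply: eq_integral => t _; congr EFin.
  rewrite indicE; case: (pselect (E' t)) => [Et|nE]; first by rewrite mem_set.
  rewrite memNset //; apply/esym; move: nE; rewrite /E' /= /g /unit_density indicE stepE.
  by case: (t \in _); case: (0 <= _) => //=; rewrite ?mul1r ?mul0r ?mulr0.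
suff -> : mu [set t | 0 <= t <= 1 /\ y <= f t] = mu E' by rewrite muE'.
have [f1|f1] := pselect (y <= f 1).
  have -> : [set t | 0 <= t <= 1 /\ y <= f t] = E' `|` [set 1].
    apply/seteqP; split=> t /=.
      move=> [/andP[t0]]; rewrite le_eqVlt => /predU1P[->|t1] yt; first by right.
      by left; apply/inE'; rewrite t0 t1.
    move=> [/inE' [/andP[t0 /ltW t1] yt]|->]; first by rewrite t0 t1.
    by rewrite ler01 lexx.
  have dis : E' `&` [set (1 : R)] = set0; last first.
    rewrite (measureU mu mE' (measurable_set1 (1 : R)) dis).
    by rewrite [X in (_ + X)%E](lebesgue_measure_set1 (1 : R)) adde0.
  by rewrite -subset0 => t [/inE' [/andP[_ t1] _] /= te]; rewrite te ltxx in t1.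
have -> // : [set t | 0 <= t <= 1 /\ y <= f t] = E'.
apply/seteqP; split=> t /=.
  move=> [/andP[t0]]; rewrite le_eqVlt => /predU1P[->//|t1] yt.
  by apply/inE'; rewrite t0 t1.
by move=> /inE' [/andP[t0 /ltW t1] yt]; rewrite t0 t1.
Qed.

Lemma Re_dyadic_mean (f : nat -> R[i]) :
  complex.Re (dyadic_mean N f) = (2 ^+ N)^-1 * \sum_(0 <= j < 2 ^ N) complex.Re (f j).
Proof.
rewrite /dyadic_mean.
have ReZ (c : R) (z : R[i]) : complex.Re (c%:C * z) = c * complex.Re z.
  by case: z => a b /=; rewrite mul0r subr0.
rewrite ReZ; congr (_ * _).
by apply: (big_morph (@complex.Re R)) => // -[a b] [c d].
Qed.

(** The wave is the real part of the transform at [theta + i xi b], rotated by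
    the phase of [s]. *)
Lemma dyadic_law_wave (theta b s xi tau : R) :
  let z := Complex theta (xi * b) in
  normc (dyadic_mean N (fun j => cexp (z * (x j)%:C)) - cexp ((2^-1)%:C * z ^+ 2)) <=
    tau * normc (cexp ((2^-1)%:C * z ^+ 2)) ->
  exists2 C : R,
    tilted_wave unit_density dyadic_step theta b s xi =
      ((2 ^+ N)^-1 * (\sum_(0 <= j < 2 ^ N) expR (theta * x j)) + C)%:E &
    `|C - expR ((theta ^+ 2 - (xi * b) ^+ 2) / 2) * cos (xi * b * (theta - s))|
       <= tau * expR ((theta ^+ 2 - (xi * b) ^+ 2) / 2).
Proof.
move=> z hz; set eta := xi * b in z hz *.
exists ((2 ^+ N)^-1 * \sum_(0 <= j < 2 ^ N) (expR (theta * x j) * cos (eta * (x j - s)))).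
  rewrite /tilted_wave (dyadic_law_integral
    (G := fun y => expR (theta * y) * (1 + cos (xi * (b * (y - s)))))); last first.
    by move=> y; apply: mulr_ge0; [exact: expR_ge0|have := cos_geN1 (xi * (b * (y - s))); lra].
  rewrite -mulrDr -big_split /=; congr (_ * _)%:E; apply: eq_bigr => j _.
  by rewrite mulrDr mulr1 /eta mulrA.
pose rot := cexp (Complex 0 (- (eta * s))).
have rot1 : normc rot = 1 by rewrite normc_cexp /= expR0.
have hG : (2^-1)%:C * z ^+ 2 = Complex ((theta ^+ 2 - eta ^+ 2) / 2) (theta * eta).
  by rewrite /z expr2; congr Complex; field.
have C1 : (2 ^+ N)^-1 * \sum_(0 <= j < 2 ^ N) (expR (theta * x j) * cos (eta * (x j - s))) =
    complex.Re (rot * dyadic_mean N (fun j => cexp (z * (x j)%:C))).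
  have -> : rot * dyadic_mean N (fun j => cexp (z * (x j)%:C)) =
      dyadic_mean N (fun j => rot * cexp (z * (x j)%:C)).
    by rewrite /dyadic_mean mulrCA big_distrr.
  rewrite Re_dyadic_mean; congr (_ * _); apply: eq_bigr => j _.
  rewrite /rot -cexpD /cexp /z /= !mulr0 subr0 add0r add0r.
  by congr (_ * cos _); ring.
have C2 : expR ((theta ^+ 2 - eta ^+ 2) / 2) * cos (eta * (theta - s)) =
    complex.Re (rot * cexp ((2^-1)%:C * z ^+ 2)).
  by rewrite hG /rot -cexpD /cexp /= add0r; congr (_ * cos _); ring.
have ReB (u v : R[i]) : complex.Re u - complex.Re v = complex.Re (u - v).
  by case: u v => ? ? [].
rewrite C1 C2 ReB -mulrBr; apply: le_trans (normr_Re_le _) _.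
by rewrite normcMM rot1 mul1r; apply: le_trans hz _; rewrite normc_cexp hG.
Qed.

End DyadicLaw.

(** * Uniform estimates for a lacunary array *)

Section LacunaryArray.
Local Open Scope complex_scope.
Context {R : realType}.
Variables (q : R) (m : nat -> nat) (a : nat -> nat -> R).
Hypothesis q_gt1 : 1 < q.
Hypothesis m_gt0 : forall k : nat, (1 <= k)%N -> (0 < m k)%N.
Hypothesis m_lac : forall k : nat, (1 <= k)%N -> q <= (m k.+1)%:R / (m k)%:R.
Hypothesis q_ge2_cond : 2 <= q ->
  (exists kappa4 : R, \sum_(1 <= k < n.+1) a k n ^+ 4 @[n --> \oo] --> kappa4) /\
  n%:R * row_max a n ^+ 5 @[n --> \oo] --> (0 : R).
Hypothesis q_lt2_cond : q < 2 ->
  exists2 epsilon : R, 0 < epsilon &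
    n%:R `^ (1 + epsilon) * row_max a n ^+ 3 @[n --> \oo] --> (0 : R).

Lemma le_row_max n k : (0 < k <= n)%N -> `|a k n| <= row_max a n.
Proof.
move=> /andP[k0 kn]; rewrite /row_max; apply: (@le_bigmax_seq _ R _ _ 0 k xpredT (fun k => `|a k n|)) => //.
by rewrite mem_index_iota k0 ltnS.
Qed.

Lemma row_max_ge0 n : 0 <= row_max a n.
Proof. exact: bigmax_ge_id. Qed.

Lemma lacunary_mul k : (1 <= k)%N -> q * (m k)%:R <= (m k.+1)%:R.
Proof.
by move=> k1; have := m_lac k1; rewrite ler_pdivlMr // ltr0n; exact: m_gt0.
Qed.

(** By Bernoulli's inequality. *)
Lemma lacunary_exponent : exists2 L : nat, (0 < L)%N & 4 < ((q - 1) / q) ^+ 2 * q ^+ L.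
Proof.
have q0 : 0 < q by apply: lt_trans q_gt1.
have bern L : 1 + (q - 1) * L%:R <= q ^+ L.
  elim: L => [|L IH]; first by rewrite mulr0 addr0 expr0.
  rewrite exprS; apply: le_trans (ler_wpM2l (ltW q0) IH); rewrite -natr1.
  have : 0 <= (q - 1) * ((q - 1) * L%:R) by rewrite !mulr_ge0 ?subr_ge0 // ltW.
  lra.
set c := ((q - 1) / q) ^+ 2.
have c0 : 0 < c by rewrite exprn_gt0 // divr_gt0 // subr_gt0.
have q1 : 0 < q - 1 by rewrite subr_gt0.
pose L := (Num.truncn (4 / c / (q - 1))).+1; exists L => //.
have hL : 4 / c / (q - 1) < L%:R by apply: truncnS_gt.
rewrite mulrC -ltr_pdivrMr //; apply: lt_le_trans (bern L).
by move: hL; rewrite ltr_pdivrMr //; lra.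
Qed.

(** A lacunary sequence with ratio at least [2] has no relations at all; for a
    smaller ratio they are so few that a bound on [n * d_n ^ 3] controls them. *)
Lemma array_bounds (omega : R) : 0 < omega ->
  exists D L : R, [/\ 0 < D, 0 < L & \forall n \near \oo,
    [/\ row_max a n <= D, \sum_(1 <= k < n.+1) a k n ^+ 4 <= D &
     forall s, 0 <= s -> s <= L ->
       relation_weight (32 * (s * row_max a n)) m n 0 <= 1 + omega]].
Proof.
move=> omega0; have [q2|q2] := leP 2 q.
  have [[kappa hk] h5] := q_ge2_cond q2.
  exists (`|kappa| + 1), 1; split=> //.
  have n1 : \forall n \near \oo, (1 <= n)%N by exists 1%N.
  have hk' : \forall n \near \oo, \sum_(1 <= k < n.+1) a k n ^+ 4 <= `|kappa| + 1.
    have kk : kappa < `|kappa| + 1 by have := ler_norm kappa; lra.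
    exact: (@cvgr_le R nat \oo _ _ kappa hk).
  have h5' : \forall n \near \oo, `|n%:R * row_max a n ^+ 5| <= 1 by exact: (@cvgr0_norm_le R _ nat \oo _ _ h5 1 ltr01).
  near=> n.
  have nge1 : (1 <= n)%N by near: n.
  have sn : \sum_(1 <= k < n.+1) a k n ^+ 4 <= `|kappa| + 1 by near: n.
  have h5n : `|n%:R * row_max a n ^+ 5| <= 1 by near: n.
  split=> //.
  - apply: (@le_trans _ _ 1); last by rewrite lerDr.
    have d0 := row_max_ge0 n.
    rewrite leNgt; apply/negP => d1.
    move: h5n; rewrite ger0_norm ?mulr_ge0 ?exprn_ge0 // leNgt => /negP; apply.
    have /(lt_le_trans _) -> // : row_max a n ^+ 5 <= n%:R * row_max a n ^+ 5.
      by rewrite ler_peMl ?exprn_ge0 // ler1n.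
    by rewrite exprn_egt1.
  - move=> s s0 _; rewrite relation_weight_doubling //; first by lra.
    move=> k k1; have := lacunary_mul k1; rewrite -(ler_nat R) natrM; apply: le_trans.
    exact: ler_wpM2r.
have [eps eps0 h3] := q_lt2_cond q2.
have [L L0 hL] := lacunary_exponent.
have L1 : 1 <= L%:R :> R by rewrite ler1n.
(* [2 ^ 20] dominates [32 ^ 3] times the constants 2, 8 of
   [relation_weight_lacunary]. *)
pose s0 : R := Num.min 1 omega / (2 ^+ 20 * L%:R ^+ 2).
have K0 : 0 < 2 ^+ 20 * L%:R ^+ 2 :> R by rewrite mulr_gt0 ?exprn_gt0 //; lra.
have mo0 : 0 < Num.min 1 omega by rewrite lt_min ltr01.
have s00 : 0 < s0 by rewrite divr_gt0.
exists 1, s0; split=> //.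
have n1 : \forall n \near \oo, (1 <= n)%N by exists 1%N.
have h3' : \forall n \near \oo, `|n%:R `^ (1 + eps) * row_max a n ^+ 3| <= 1 by exact: (@cvgr0_norm_le R _ nat \oo _ _ h3 1 ltr01).
near=> n.
have d0 := row_max_ge0 n.
have nge1 : (1 <= n)%N by near: n.
have n1' : 1 <= n%:R :> R by rewrite ler1n.
have nd3 : n%:R * row_max a n ^+ 3 <= 1.
  have : `|n%:R `^ (1 + eps) * row_max a n ^+ 3| <= 1 by near: n.
  rewrite ger0_norm ?mulr_ge0 ?powR_ge0 ?exprn_ge0 //; apply: le_trans.
  apply: ler_wpM2r; first exact: exprn_ge0.
  by apply: le1r_powR => //; lra.
have d1 : row_max a n <= 1.
  rewrite leNgt; apply/negP => d1; move: nd3; rewrite leNgt => /negP; apply.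
  have /(lt_le_trans _) -> // : row_max a n ^+ 3 <= n%:R * row_max a n ^+ 3.
    by rewrite ler_peMl ?exprn_ge0.
  by rewrite exprn_egt1.
split=> //.
  have nd : n%:R * row_max a n ^+ 3 = \sum_(1 <= k < n.+1) row_max a n ^+ 3.
    by rewrite sumr_const_nat subSS subn0 mulr_natl.
  apply: le_trans nd3; rewrite nd.
  rewrite big_nat_cond [leRHS]big_nat_cond; apply: ler_sum => k; rewrite andbT => hk.
  have ak := le_row_max hk.
  have a0 : 0 <= `|a k n| by [].
  rewrite -[a k n ^+ 4]ger0_norm ?exprn_even_ge0 // normrX.
  apply: (@le_trans _ _ (`|a k n| ^+ 3)); last by apply: lerXn2r.
  by rewrite exprSr ler_piMr ?exprn_ge0 //; apply: le_trans d1.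
move=> s s_ge0 s_le; set d := row_max a n in d0 nd3 d1 *.
have s1 : s * (2 ^+ 20 * L%:R ^+ 2) <= Num.min 1 omega by rewrite -ler_pdivlMr.
have [hs1 hso] : s * (2 ^+ 20 * L%:R ^+ 2) <= 1 /\ s * (2 ^+ 20 * L%:R ^+ 2) <= omega.
  by move: s1; rewrite le_min => /andP[].
have LL : L%:R <= L%:R ^+ 2 :> R by rewrite expr2 ler_peMr //; lra.
have sL0 : 0 <= s * L%:R ^+ 2 by rewrite mulr_ge0 // exprn_ge0; lra.
have sLL : s * L%:R <= s * L%:R ^+ 2 by apply: ler_wpM2l.
have ss : s <= 1.
  have : s * 1 <= s * L%:R ^+ 2 by apply: ler_wpM2l => //; lra.
  by move: hs1 sL0; lra.
have T3 : n%:R * (32 * (s * d)) ^+ 3 * L%:R ^+ 2 <= 2 ^+ 15 * (s * L%:R ^+ 2).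
  have -> : n%:R * (32 * (s * d)) ^+ 3 * L%:R ^+ 2 =
    2 ^+ 15 * ((s * L%:R ^+ 2) * (s ^+ 2 * (n%:R * d ^+ 3))) by ring.
  apply: ler_wpM2l; first exact: exprn_ge0.
  rewrite ler_piMr // mulr_ile1 ?mulr_ge0 ?exprn_ge0 ?exprn_ile1 //.
apply: le_trans (relation_weight_lacunary q_gt1 m_gt0 lacunary_mul hL _ _ _ (leqnn n)) _.
- by rewrite !mulr_ge0.
- have : s * d * L%:R <= s * L%:R by rewrite -mulrA ler_wpM2l // ler_piMl //; lra.
  by move: hs1 sL0 sLL; lra.
- by apply: le_trans T3 _; move: hs1 sL0; lra.
- by move: T3 hso sL0; lra.
Unshelve. all: by end_near.
Qed.

(** The relative error in [walsh_mgf] only depends on the product of [normc z]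
    with quantities that [array_bounds] controls, so a small disc works for all
    large [n]. *)
Lemma walsh_mgf_uniform (tau : R) : 0 < tau ->
  exists2 delta : R, 0 < delta & \forall n \near \oo, forall N (z : R[i]),
    (forall k, (0 < k <= n)%N -> (m k < 2 ^ N)%N) -> normc z <= delta ->
    let gauss := cexp ((2^-1)%:C * z ^+ 2 * (row_norm a n ^+ 2)%:C) in
    normc (dyadic_mean N (fun j => cexp (z * (walsh_sum m a n (dyadic_point N j))%:C)) - gauss)
      <= tau * normc gauss.
Proof.
move=> tau0.
pose omega := Num.min 1 tau / 8.
have mt0 : 0 < Num.min 1 tau by rewrite lt_min ltr01.
have [mt1 mtt] : Num.min 1 tau <= 1 /\ Num.min 1 tau <= tau by rewrite !ge_min !lexx orbT.
have omega0 : 0 < omega by rewrite divr_gt0.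
have [D [L [D0 L0 nearDL]]] := array_bounds omega0.
pose delta := Num.min (Num.min 1 L) (omega / (88 * D)).
have D88 : 0 < 88 * D by rewrite mulr_gt0 // ltr0n.
exists delta; first by rewrite !lt_min ltr01 L0 divr_gt0.
near=> n.
have [dD aD wL] : [/\ row_max a n <= D, \sum_(1 <= k < n.+1) a k n ^+ 4 <= D &
     forall s, 0 <= s -> s <= L ->
       relation_weight (32 * (s * row_max a n)) m n 0 <= 1 + omega] by near: n.
move=> N z mN; rewrite !le_min => /andP[/andP[z1 zL] zD].
have z0 := normc_ge0 z.
have zD' : normc z * (88 * D) <= omega by rewrite -ler_pdivlMr.
have d0 := row_max_ge0 n.
cbv zeta; set gauss := cexp _.
have gE : gauss = cexp ((2^-1)%:C * z ^+ 2 * (\sum_(1 <= k < n.+1) a k n ^+ 2)%:C).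
  by rewrite /gauss /row_norm sqr_sqrtr // sumr_ge0 // => k _; exact: sqr_ge0.
have zdD : normc z * row_max a n <= normc z * D by apply: ler_wpM2l.
have om8 : omega <= 8^-1 by rewrite /omega; lra.
apply: le_trans (walsh_mgf gE mN (@le_row_max n) _) _.
  by move: zdD zD' om8 omega0; lra.
rewrite mulrC; apply: ler_wpM2r; first exact: normc_ge0.
set p := 88 * _ * _.
have p_le : p <= omega.
  apply: le_trans zD'; rewrite /p mulrAC [leRHS]mulrC.
  have h4 : normc z ^+ 4 <= normc z by rewrite exprS ler_piMr // exprn_ile1.
  have s4 : 0 <= \sum_(1 <= k < n.+1) a k n ^+ 4.
    by apply: sumr_ge0 => k _; rewrite exprn_even_ge0.
  by apply: ler_pM => //; [rewrite mulr_ge0|rewrite exprn_ge0|rewrite ler_pM2l].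
have p_ge0 : 0 <= p.
  by rewrite /p !mulr_ge0 ?exprn_ge0 // sumr_ge0 // => k _; rewrite exprn_even_ge0.
have ep : expR p <= 1 + 2 * omega.
  have : `|expR p - (1 + p)| <= 2 * p ^+ 2.
    by apply: expR_second_order; rewrite ger0_norm //; lra.
  rewrite ler_norml => /andP[_].
  have : p ^+ 2 <= p * 8^-1 by rewrite expr2 ler_wpM2l //; lra.
  by move: p_le p_ge0; lra.
have e0 := expR_ge0 p.
have := wL _ z0 zL; set w := relation_weight _ _ _ _ => w1.
have ew : expR p * w <= (1 + 2 * omega) * (1 + omega).
  apply: (@le_trans _ _ (expR p * (1 + omega))); first exact: ler_wpM2l.
  by apply: ler_wpM2r => //; lra.
have oo : omega * omega <= omega * 8^-1 by rewrite ler_wpM2l //; lra.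
have : 8 * omega <= tau by rewrite /omega; lra.
by move: ew oo omega0; lra.
Unshelve. all: by end_near.
Qed.

End LacunaryArray.

(** * The tail of a normalized Walsh sum *)

Section GaussRatio.
Context {R : realType}.
Local Notation peak := ((Num.sqrt (2 * pi))^-1 : R).
Implicit Types (c C theta : R).

(** The absolute error of the transfer is measured by the Chernoff bound at
    the tilt [max c 1]; by Mills' inequality this is comparable to the tail. *)
Lemma chernoff_le_gtail C c : 0 <= C -> - C <= c ->
  expR (- (1 + C)) / 2 *
    (gauss_scale (Num.max c 1) * expR (- (Num.max c 1 * c))) <= gtail c.
Proof.
move=> C0 Cc; have p0 := @peak_gt0 R.
have [c1|c1] := leP 1 c.
  have c0 : 0 < c by apply: lt_le_trans c1.
  apply: le_trans (gtail_mills c1).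
  have E : expR (c ^+ 2 / 2) * expR (- (c * c)) = expR (- (c ^+ 2 / 2)).
    by rewrite -expRD; congr expR; field.
  have -> : expR (- (1 + C)) / 2 * (gauss_scale c * expR (- (c * c))) =
      (expR (- (1 + C)) / 2 * c^-1) * gauss_pdf c.
    by rewrite /gauss_scale /gauss_pdf -E; ring.
  apply: ler_wpM2r; first exact: gauss_pdf_ge0.
  apply: (@le_trans _ _ (1 / 2 * c^-1)).
    apply: ler_wpM2r; first by rewrite invr_ge0 ltW.
    apply: ler_wpM2r; first by rewrite invr_ge0.
    by rewrite -[leRHS]expR0 ler_expR; lra.
  have c2 : 1 <= c ^+ 2 by rewrite exprn_ege1.
  rewrite ler_pdivrMr // mulrAC ler_pdivlMr; last by lra.
  by rewrite -expr2; lra.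
apply: le_trans (gtail_anti (ltW c1)); apply: le_trans (gtail_mills (lexx 1)).
have -> : 1 / (1 + 1 ^+ 2) * gauss_pdf 1 = peak / 2 * expR (- (1 + C)) * expR (2^-1 + C) :> R.
  rewrite -[RHS]mulrA -expRD /gauss_pdf (_ : - (1 + C) + (2^-1 + C) = - (1 ^+ 2 / 2)); last by lra.
  by rewrite expr1n; field; move: p0; rewrite invr_gt0 => /lt0r_neq0.
have -> : expR (- (1 + C)) / 2 * (gauss_scale 1 * expR (- (1 * c))) =
    peak / 2 * expR (- (1 + C)) * expR (2^-1 - c).
  by rewrite /gauss_scale expr1n invr1 mul1r mul1r expRD mul1r; ring.
by rewrite ler_wpM2l ?ler_expR ?mulr_ge0 ?expR_ge0 ?invr_ge0 ?sqrtr_ge0 //; lra.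
Qed.

End GaussRatio.

Section WalshTail.
Local Open Scope complex_scope.
Context {R : realType}.
Variables (m : nat -> nat) (a : nat -> nat -> R).
Local Notation A := (row_norm a).

Definition walsh_tail (n : nat) (c : R) : R :=
  fine (lebesgue_measure [set x : R | 0 <= x <= 1 /\ c <= walsh_sum m a n x / A n]).

(* Any order beyond the indices in use resolves the sum on dyadic cells. *)
Let order n := (\sum_(1 <= k < n.+1) m k)%N.
Let value n j := walsh_sum m a n (dyadic_point (order n) j) / A n.

Lemma walsh_order n k : (0 < k <= n)%N -> (m k < 2 ^ order n)%N.
Proof.
move=> kn; apply: leq_ltn_trans (ltn_expl _ (ltnSn 1)); rewrite /order.
by rewrite (bigD1_seq k) ?iota_uniq ?mem_index_iota //= leq_addr.
Qed.

Lemma walsh_tailE n c :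
  walsh_tail n c = (2 ^+ order n)^-1 * \sum_(0 <= j < 2 ^ order n) step (value n j - c).
Proof.
apply: dyadic_level_measure => j t jN tj; rewrite /value; congr (_ / _).
rewrite /walsh_sum big_nat_cond [RHS]big_nat_cond; apply: eq_bigr => k; rewrite andbT ltnS => kn.
by rewrite (walsh_constant (walsh_order kn) tj).
Qed.

Let pN n : 0 < (2 ^+ order n)^-1 :> R. Proof. by rewrite invr_gt0 exprn_gt0. Qed.

Lemma walsh_tail_le1 n c : walsh_tail n c <= 1.
Proof.
rewrite walsh_tailE ler_pdivrMl ?exprn_gt0 // mulr1.
have -> : 2 ^+ order n = \sum_(0 <= j < 2 ^ order n) 1 :> R.
  by rewrite sumr_const_nat subn0 natrX.
by apply: ler_sum => j _; exact: step_le1.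
Qed.

Lemma walsh_tail_anti n c d : c <= d -> walsh_tail n d <= walsh_tail n c.
Proof.
move=> cd; rewrite !walsh_tailE ler_wpM2l ?(ltW (pN n)) //; apply: ler_sum => j _.
rewrite !stepE !subr_ge0; case: (leP d) => // h; rewrite ?ler0n // (le_trans cd h) //.
Qed.

(** Dividing by [A n] brings the tilt [theta] and the frequencies up to
    [200 * theta / tau ^ 2] into the disc where the transform is controlled. *)
Lemma walsh_tail_compare n (tau delta theta c : R) :
  0 < tau -> tau <= 8^-1 -> 0 < theta -> 0 < A n ->
  theta * (1 + 200 / tau ^+ 2) <= delta * A n ->
  (forall N (z : R[i]),
    (forall k, (0 < k <= n)%N -> (m k < 2 ^ N)%N) -> normc z <= delta ->
    let gauss := cexp ((2^-1)%:C * z ^+ 2 * (A n ^+ 2)%:C) in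
    normc (dyadic_mean N (fun j => cexp (z * (walsh_sum m a n (dyadic_point N j))%:C)) - gauss)
      <= tau * normc gauss) ->
  `|walsh_tail n c - gtail c| <= 324 * tau * (gauss_scale theta * expR (- (theta * c))).
Proof.
move=> tau0 tau8 theta0 A0 thetaA mgf.
apply: (@tail_compare R unit_density (dyadic_step (order n) (value n)) (walsh_tail n)
  theta (200 * theta / tau ^+ 2) tau
  ((2 ^+ order n)^-1 * \sum_(0 <= j < 2 ^ order n) expR (theta * value n j))) => //.
- exact: measurable_unit_density.
- exact: measurable_dyadic_step.
- move=> d; rewrite walsh_tailE /law_tail.
  by rewrite (dyadic_law_integral _ _ (G := fun y => step (y - d))) // => y; exact: step_ge0.
- rewrite /tilted_mass.
  by rewrite (dyadic_law_integral _ _ (G := fun y => expR (theta * y))) // => y; exact: expR_ge0.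
move=> s xi /andP[xi0 xi1]; apply: dyadic_law_wave.
set b := 200 * theta / tau ^+ 2; set z := Complex theta (xi * b).
have b0 : 0 <= b.
  by apply: divr_ge0; [apply: mulr_ge0; [rewrite ler0n|exact: ltW]|rewrite exprn_ge0 // ltW].
have xb0 : 0 <= xi * b by rewrite mulr_ge0.
have xbb : xi * b <= b by rewrite ler_piMl.
have AC : (A n)%:C * (A n)^-1%:C = 1 :> R[i].
  by rewrite -rmorphM /= mulfV ?gt_eqF.
have zA : normc (z * (A n)^-1%:C) <= delta.
  rewrite normcMM normc_real ger0_norm ?invr_ge0 ?(ltW A0) // ler_pdivrMr //.
  apply: le_trans thetaA.
  have -> : theta * (1 + 200 / tau ^+ 2) = theta + b by rewrite /b; ring.
  apply: (@le_trans _ _ (theta + xi * b)); last by rewrite lerD2l.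
  have t0 : 0 <= theta + xi * b by rewrite addr_ge0 // ltW.
  rewrite /= -[leRHS](ger0_norm t0) -sqrtr_sqr ler_sqrt ?sqr_ge0 //.
  have : 0 <= theta * (xi * b) by rewrite mulr_ge0 // ltW.
  by rewrite sqrrD; lra.
have := mgf (order n) (z * (A n)^-1%:C) (@walsh_order n) zA; cbv zeta.
have -> : (2^-1)%:C * (z * (A n)^-1%:C) ^+ 2 * (A n ^+ 2)%:C = (2^-1)%:C * z ^+ 2.
  rewrite rmorphXn /= -mulrA; congr (_ * _).
  by rewrite exprMn -mulrA -exprMn mulrC [_^-1%:C * _]mulrC AC expr1n mul1r.
congr (is_true (normc (_ - _) <= _)); rewrite /dyadic_mean; congr (_ * _).
apply: eq_bigr => j _; congr cexp; rewrite /value rmorphM /=; ring.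
Qed.

End WalshTail.

(** * Asymptotic equivalence of the tails *)

Section Equivalence.
Context {R : realType}.
Variables (q : R) (m : nat -> nat) (a : nat -> nat -> R).
Hypothesis q_gt1 : 1 < q.
Hypothesis m_gt0 : forall k : nat, (1 <= k)%N -> (0 < m k)%N.
Hypothesis m_lac : forall k : nat, (1 <= k)%N -> q <= (m k.+1)%:R / (m k)%:R.
Hypothesis row_norm_infty : row_norm a n @[n --> \oo] --> +oo.
Hypothesis q_ge2_cond : 2 <= q ->
  (exists kappa4 : R, \sum_(1 <= k < n.+1) a k n ^+ 4 @[n --> \oo] --> kappa4) /\
  n%:R * row_max a n ^+ 5 @[n --> \oo] --> (0 : R).
Hypothesis q_lt2_cond : q < 2 ->
  exists2 epsilon : R, 0 < epsilon &
    n%:R `^ (1 + epsilon) * row_max a n ^+ 3 @[n --> \oo] --> (0 : R).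
Local Notation A := (row_norm a).
Local Notation peak := ((Num.sqrt (2 * pi))^-1 : R).

Lemma row_norm_ge (K : R) : \forall n \near \oo, K <= A n.
Proof. exact: (proj1 (@cvgryPge R nat \oo _ _) row_norm_infty K). Qed.

(** With the tilt [max c 1] the error of [walsh_tail_compare] is relative to the
    Gaussian tail, by [chernoff_le_gtail]. *)
Lemma walsh_tail_bounded_below (C omega : R) : 0 <= C -> 0 < omega ->
  exists2 delta : R, 0 < delta & \forall n \near \oo, forall c,
    - C <= c -> c <= delta * A n ->
    `|walsh_tail m a n c - gtail c| <= omega * gtail c.
Proof.
move=> C0 omega0; pose k := expR (- (1 + C)) / 2.
have k0 : 0 < k by rewrite divr_gt0 ?expR_gt0.
have h324 : 0 < 324 :> R by rewrite ltr0n.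
pose tau := Num.min 8^-1 (omega * k / 324).
have ok0 : 0 < omega * k / 324 by rewrite divr_gt0 // mulr_gt0.
have tau0 : 0 < tau by rewrite lt_min ok0 invr_gt0 ltr0n.
have tau8 : tau <= 8^-1 by rewrite ge_min lexx.
have tauk : tau * 324 <= omega * k by rewrite -ler_pdivlMr // ge_min lexx orbT.
have [delta delta0 mgf] := walsh_mgf_uniform q_gt1 m_gt0 m_lac q_ge2_cond q_lt2_cond tau0.
pose K := 1 + 200 / tau ^+ 2.
have K0 : 0 < K.
  by apply: addr_gt0; [exact: ltr01|apply: divr_gt0; [rewrite ltr0n|exact: exprn_gt0]].
exists (delta / K); first exact: divr_gt0.
have A1 := row_norm_ge 1; have AK := row_norm_ge (K / delta).
near=> n.
have A1n : 1 <= A n by near: n.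
have AKn : K / delta <= A n by near: n.
move=> c cC cA.
have A0 : 0 < A n by apply: lt_le_trans A1n.
have theta0 : 0 < Num.max c 1 by rewrite lt_max ltr01 orbT.
have thetaA : Num.max c 1 * K <= delta * A n.
  case: (leP c 1) => _; last by move: cA; rewrite mulrAC ler_pdivlMr.
  by move: AKn; rewrite ler_pdivrMr // mul1r [A n * _]mulrC.
have mgfn' : forall N (z : R[i]),
    (forall k, (0 < k <= n)%N -> (m k < 2 ^ N)%N) -> normc z <= delta ->
    let gauss := cexp (((2^-1)%:C * z ^+ 2 * (A n ^+ 2)%:C)%C) in
    normc (dyadic_mean N (fun j => cexp ((z * (walsh_sum m a n (dyadic_point N j))%:C)%C)) - gauss)
      <= tau * normc gauss by near: n.
apply: le_trans (walsh_tail_compare c tau0 tau8 theta0 A0 thetaA mgfn') _.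
apply: (@le_trans _ _ (omega * k * (gauss_scale (Num.max c 1) * expR (- (Num.max c 1 * c))))).
  apply: ler_wpM2r; last by rewrite mulrC.
  apply: mulr_ge0; last exact: expR_ge0.
  by rewrite /gauss_scale mulr_ge0 ?invr_ge0 ?(ltW theta0) // mulr_ge0 ?expR_ge0 ?(ltW (@peak_gt0 R)).
by rewrite -mulrA ler_wpM2l ?(ltW omega0) // /k chernoff_le_gtail.
Unshelve. all: by end_near.
Qed.

Lemma gtail_near1 (eta : R) : 0 < eta -> exists2 C, 0 <= C & 1 - eta <= gtail (- C).
Proof.
move=> eta0; have p0 := @peak_gt0 R.
pose u : R := eta / peak; have u0 : 0 < u by rewrite divr_gt0.
exists (2^-1 + `|ln u|); first by rewrite addr_ge0 // invr_ge0.
have h := gtail_reflect (2^-1 + `|ln u|).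
have h2 := gtail_expR_le (2^-1 + `|ln u|) (@ltr01 R).
have : expR (1 ^+ 2 / 2 - 1 * (2^-1 + `|ln u|)) <= u.
  rewrite -[leRHS](lnK u0) ler_expR expr1n mul1r.
  by have := ler_norm (- ln u); rewrite normrN; lra.
move=> /(ler_wpM2l (ltW p0)); rewrite /u mulrCA mulfV ?gt_eqF // mulr1.
by move: h h2; rewrite invr1 mul1r; lra.
Qed.

(** To the left of [- C] both tails are close to 1, by monotonicity. *)
Lemma walsh_tail_equiv (omega : R) : 0 < omega ->
  exists2 delta : R, 0 < delta & \forall n \near \oo, forall c,
    `|c| <= delta * A n -> `|walsh_tail m a n c - gtail c| <= omega * gtail c.
Proof.
move=> omega0; pose eta := Num.min 1 omega / 8.
have mo0 : 0 < Num.min 1 omega by rewrite lt_min ltr01.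
have mo1 : Num.min 1 omega <= 1 by rewrite ge_min lexx.
have moo : Num.min 1 omega <= omega by rewrite ge_min lexx orbT.
have eta0 : 0 < eta by rewrite divr_gt0 // ltr0n.
have eta8 : eta <= 8^-1 by rewrite /eta; lra.
have etao : 8 * eta <= omega by rewrite /eta; lra.
have [C C0 gC] := gtail_near1 eta0.
have [d1 d10 h1] := walsh_tail_bounded_below C0 omega0.
have [d2 d20 h2] := walsh_tail_bounded_below C0 eta0.
exists d1 => //.
have A2 := row_norm_ge 0.
near=> n.
have A0 : 0 <= A n by near: n.
have h1n : forall c, - C <= c -> c <= d1 * A n ->
    `|walsh_tail m a n c - gtail c| <= omega * gtail c by near: n.
have h2n : forall c, - C <= c -> c <= d2 * A n ->
    `|walsh_tail m a n c - gtail c| <= eta * gtail c by near: n.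
move=> c; rewrite ler_norml => /andP[_ cA].
have [Cc|cC] := leP (- C) c; first exact: h1n.
have g1 := gtail_le1 c; have w1 := walsh_tail_le1 m a n c.
have gc : 1 - eta <= gtail c := le_trans gC (gtail_anti (ltW cC)).
have wc := walsh_tail_anti m a n (ltW cC).
have : `|walsh_tail m a n (- C) - gtail (- C)| <= eta * gtail (- C).
  by apply: h2n => //; apply: (@le_trans _ _ 0); [lra|rewrite mulr_ge0 // ltW].
rewrite ler_norml => /andP[lo _].
have e2 : eta * gtail (- C) <= eta by rewrite ler_piMr ?(ltW eta0) // gtail_le1.
have o2 : 8 * eta * (1 - eta) <= omega * gtail c.
  by apply: ler_pM => //; lra.
have e3 : eta * eta <= eta * 8^-1 by rewrite ler_wpM2l // ltW.
by rewrite ler_norml; apply/andP; split; move: lo wc gC gc o2 e2 e3 w1 g1 eta0; lra.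
Unshelve. all: by end_near.
Qed.

(** The Chernoff bound with tilt [y] and Mills' bound differ by the factor
    [1 + y ^- 2]. *)
Lemma gtail_asymp (y : R) : 1 <= y ->
  `|gtail y - expR (- (y ^+ 2 / 2)) / (y * Num.sqrt (2 * pi))| <=
  y^-1 * (expR (- (y ^+ 2 / 2)) / (y * Num.sqrt (2 * pi))).
Proof.
move=> y1; have y0 : 0 < y by apply: lt_le_trans y1.
set g := expR _ / _.
have gE : g = y^-1 * gauss_pdf y by rewrite /g /gauss_pdf invfM; ring.
have g0 : 0 <= g by rewrite gE mulr_ge0 ?gauss_pdf_ge0 // invr_ge0 ltW.
have up : gtail y <= g.
  apply: le_trans (gtail_expR_le y y0) _; rewrite gE /gauss_pdf.
  by rewrite (_ : y ^+ 2 / 2 - y * y = - (y ^+ 2 / 2)) //; field.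
have lo := gtail_mills y1.
have lo' : y ^+ 2 / (1 + y ^+ 2) * g <= gtail y.
  apply: le_trans lo; rewrite gE mulrA le_eqVlt; apply/orP; left; apply/eqP.
  by congr (_ * _); rewrite expr2 mulrAC mulfK // gt_eqF.
have y2 : 0 < 1 + y ^+ 2 by rewrite ltr_pwDl // exprn_ge0 // ltW.
have fr : 1 - y^-1 <= y ^+ 2 / (1 + y ^+ 2).
  rewrite ler_pdivlMr // mulrDl mul1r mulNr lerBlDr.
  have : y * y <= y^-1 * (1 + y ^+ 2) + (y ^+ 2 - 1).
    rewrite mulrDr mulr1 expr2 mulKf ?gt_eqF //.
    by have : 0 <= y^-1 by [rewrite invr_ge0 ltW]; nra.
  by lra.
have lo2 : (1 - y^-1) * g <= gtail y by apply: le_trans lo'; exact: ler_wpM2r.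
have yg : 0 <= y^-1 * g by rewrite mulr_ge0 // invr_ge0 ltW.
by rewrite ler_norml; apply/andP; split; move: lo2 up yg; lra.
Qed.

Lemma equiv_of_ratio (f g : nat -> R) :
  (forall e, 0 < e -> \forall n \near \oo, `|f n - g n| <= e * `|g n|) -> f ~_\oo g.
Proof. by move=> h; apply/eqaddoP => e e0; exact: h. Qed.

Lemma tail_equiv_gauss (y : nat -> R) : y =o_\oo A ->
  (fun n => walsh_tail m a n (y n)) ~_\oo (fun n => gauss_tail (y n)).
Proof.
move=> /eqoP yo; apply: equiv_of_ratio => e e0.
have [delta delta0 h] := walsh_tail_equiv e0.
have yd := yo delta delta0; have A2 := row_norm_ge 0.
near=> n.
have A0 : 0 <= A n by near: n.
have yn : `|y n| <= delta * `|A n| by near: n.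
have hn : forall c, `|c| <= delta * A n ->
   `|walsh_tail m a n c - gtail c| <= e * gtail c by near: n.
by rewrite gauss_tailE (ger0_norm (gtail_ge0 _)); apply: hn; rewrite -(ger0_norm A0).
Unshelve. all: by end_near.
Qed.

Lemma gauss_tail_equiv (y : nat -> R) : y n @[n --> \oo] --> +oo ->
  (fun n => gauss_tail (y n)) ~_\oo
  (fun n => expR (- (y n ^+ 2 / 2)) / (y n * Num.sqrt (2 * pi))).
Proof.
move=> yoo; have yge (K : R) : \forall n \near \oo, K <= y n.
  exact: (proj1 (@cvgryPge R nat \oo _ _) yoo K).
apply: equiv_of_ratio => e e0.
have y1 := yge 1; have ye := yge e^-1.
near=> n.
have y1n : 1 <= y n by near: n.
have yen : e^-1 <= y n by near: n.
have y0 : 0 < y n by apply: lt_le_trans y1n.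
rewrite gauss_tailE; apply: le_trans (gtail_asymp y1n) _.
set g := expR _ / _.
have g0 : 0 <= g by rewrite divr_ge0 ?expR_ge0 // mulr_ge0 ?sqrtr_ge0 // ltW.
rewrite (ger0_norm g0); apply: ler_wpM2r => //.
by rewrite invf_ple ?posrE.
Unshelve. all: by end_near.
Qed.

End Equivalence.

Theorem theorem2p6 (R : realType) (q : R) (m : nat -> nat)
    (a : nat -> nat -> R)
    (q_gt1 : 1 < q)
    (m_gt0 : forall k : nat, (1 <= k)%N -> (0 < m k)%N)
    (m_incr : forall k : nat, (1 <= k)%N -> (m k < m k.+1)%N)
    (m_lacunary : forall k : nat, (1 <= k)%N ->
       q <= (m k.+1)%:R / (m k)%:R)
    (row_norm_infty : row_norm a n @[n --> \oo] --> +oo)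
    (q_ge2_cond : 2 <= q ->
       (exists kappa4 : R,
          \sum_(1 <= k < n.+1) a k n ^+ 4 @[n --> \oo] --> kappa4) /\
       n%:R * row_max a n ^+ 5 @[n --> \oo] --> (0 : R))
    (q_lt2_cond : q < 2 ->
       exists2 epsilon : R, 0 < epsilon &
         n%:R `^ (1 + epsilon) * row_max a n ^+ 3 @[n --> \oo] --> (0 : R)) :
  forall y : nat -> R, y =o_\oo (row_norm a) ->
    let tail (n : nat) : R :=
      fine (lebesgue_measure
        [set x : R | 0 <= x <= 1 /\
                     y n <= walsh_sum m a n x / row_norm a n]) in
    tail ~_\oo (fun n => gauss_tail (y n)) /\
    (y n @[n --> \oo] --> +oo ->
     tail ~_\oo
       (fun n => expR (- (y n ^+ 2 / 2)) / (y n * Num.sqrt (2 * pi)))).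
Proof.
move=> y yo tail; split.
  exact: (tail_equiv_gauss q_gt1 m_gt0 m_lacunary row_norm_infty q_ge2_cond q_lt2_cond yo).
move=> yoo; apply: equiv_trans (gauss_tail_equiv yoo).
exact: (tail_equiv_gauss q_gt1 m_gt0 m_lacunary row_norm_infty q_ge2_cond q_lt2_cond yo).
Qed.
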